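(* Let $(b_N)_N$ be a sequence of integers with $0\le b_N\le N-1$, let $w_N:=\min(N,2b_N+1)$, and suppose that there exist positive constants $c$ and $q$ such that $w_N\ge cN^q$ for all $N$. Let $(W_N)_N$ and $(W_N^{\mathrm{per}})_N$ be, respectively, a strict and a periodic centred Wigner band ensemble with half-widths $b_N$ and variance $v$. I. In both cases $X_N=W_N$ and $X_N=W_N^{\mathrm{per}}$, $$\mathbb{P}\Big(\limsup_{N\to\infty}\frac{\|X_N\|_{op}}{\sqrt{w_N}}\le2\sqrt v\Big)=1.$$ II. In the case $X_N=W_N^{\mathrm{per}}$ of periodic ensembles, one has the stronger result $$\mathbb{P}\Big(\lim_{N\to\infty}\frac{\|X_N\|_{op}}{\sqrt{w_N}}=2\sqrt v\Big)=1.$$ III. The result displayed in II also holds for strict band matrices $X_N=W_N$ with half-widths $b_N$ satisfying $\lim_{N\to\infty}\frac{b_N}{N}\in\{0,1\}$.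
   Context: A (full) Wigner ensemble with mean $m$ and variance $v$ is a sequence $(X_N)_{N\ge1}$ of random real symmetric $N\times N$ matrices on a common probability space $(\Omega,\mathcal{F},\mathbb{P})$ such that for each fixed $N$ the entries $X_N(i,j)$, $1\le i\le j\le N$, are independent, and all entries $X_N(i,j)$ (for all $N,i,j$) have one common distribution $\rho$ on $\mathbb{R}$ with finite moments of all orders; $m=\int x\,d\rho(x)$ and $v=\int x^2\,d\rho(x)-m^2$. Nothing is assumed about the joint dependence of $X_N$ and $X_M$ for $N\ne M$. The case $v=0$ is allowed. The ensemble is centred if $m=0$. Band ensembles with half-widths $b_N$ are obtained from a Wigner ensemble $(X_N)_N$ as follows. Strict Wigner band ensemble: $W_N(i,j)=X_N(i,j)$ if $|i-j|\le b_N$ and $W_N(i,j)=0$ otherwise. Periodic Wigner band ensemble: $W_N^{\mathrm{per}}(i,j)=X_N(i,j)$ if $|i-j|_N\le b_N$ and $W_N^{\mathrm{per}}(i,j)=0$ otherwise, where $|i|_N:=\min(|i|,N-|i|)$ for $|i|\le N$. The mean and variance of the band ensemble are those of $(X_N)_N$. The number $w_N$ is called the bandwidth. $\|\cdot\|_{op}$ denotes the $\ell_2$-operator norm, which for a real symmetric matrix is the largest modulus of its eigenvalues. *)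

(* Defs.v *)
From HB Require Import structures.
From mathcomp Require Export all_boot all_order all_algebra.
From mathcomp Require Export all_classical all_reals all_analysis.
Export Order.TTheory GRing.Theory Num.Theory.
Export numFieldNormedType.Exports.

#[export] Set Implicit Arguments.
#[export] Unset Strict Implicit.
#[export] Unset Printing Implicit Defensive.

Local Open Scope classical_set_scope.
Local Open Scope ring_scope.

(* Mutual independence of the subfamily [Y i], [i \in A]: the product rule over
   every finite subset of indices. *)
Definition mutually_independent (d : measure_display) (T : measurableType d)
    (R : realType) (P : probability T R) (I : finType) (A : {set I})
    (Y : I -> {RV P >-> R}) : Prop :=
  forall J : {set I}, J \subset A ->
  forall B : I -> set R, (forall i, measurable (B i)) ->
    P (\bigcap_(i in [set` J]) (Y i @^-1` B i))
    = (\prod_(i in J) P (Y i @^-1` B i))%E.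

Record wigner_ensemble (d : measure_display) (T : measurableType d)
    (R : realType) (P : probability T R)
    (X : forall N : nat, 'I_N -> 'I_N -> {RV P >-> R})
    (rho : probability R R) (m v : R) : Prop := WignerEnsemble {
  wigner_sym : forall N (i j : 'I_N) (t : T), X N i j t = X N j i t ;
  wigner_indep : forall N,
    mutually_independent [set k : 'I_N * 'I_N | (k.1 <= k.2)%N]%SET
      (fun k => X N k.1 k.2) ;
  wigner_law : forall N (i j : 'I_N) (A : set R), measurable A ->
    distribution P (X N i j) A = rho A ;
  wigner_moments : forall k : nat,
    rho.-integrable [set: R] (fun x => (x ^+ k)%:E) ;
  wigner_mean : m = \int[rho]_x x ;
  wigner_variance : v = (\int[rho]_x (x ^+ 2)) - m ^+ 2 }.

(* [|k|_N] for [0 <= k <= N]. *)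
Definition circ_abs (N k : nat) : nat := minn k (N - k).

Definition strict_band (d : measure_display) (T : measurableType d)
    (R : realType) (P : probability T R) (b : nat -> nat)
    (X : forall N : nat, 'I_N -> 'I_N -> {RV P >-> R})
    (N : nat) (t : T) : 'M[R]_N :=
  \matrix_(i, j) if (`|i - j| <= b N)%N then X N i j t else 0.

Definition periodic_band (d : measure_display) (T : measurableType d)
    (R : realType) (P : probability T R) (b : nat -> nat)
    (X : forall N : nat, 'I_N -> 'I_N -> {RV P >-> R})
    (N : nat) (t : T) : 'M[R]_N :=
  \matrix_(i, j) if (circ_abs N `|i - j| <= b N)%N then X N i j t else 0.

Definition bandwidth (b : nat -> nat) (N : nat) : nat := minn N (2 * b N + 1).

(* The library norms on matrices are entrywise sup norms. *)
Definition l2norm (R : realType) (N : nat) (x : 'cV[R]_N) : R :=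
  Num.sqrt (\sum_i x i 0 ^+ 2).

Definition opnorm (R : realType) (N : nat) (A : 'M[R]_N) : R :=
  sup [set l2norm (A *m x) | x in [set x : 'cV[R]_N | l2norm x <= 1]].

Definition scaled_opnorm (R : realType) (T : Type) (b : nat -> nat)
    (W : forall N : nat, T -> 'M[R]_N) (t : T) (N : nat) : R :=
  opnorm (W N t) / Num.sqrt (bandwidth b N)%:R.

(* Main.v *)
Require Import Defs.
From mathcomp Require Import measurable_realfun.
From mathcomp Require Import zify ring lra.
Local Open Scope classical_set_scope.
Local Open Scope ring_scope.

(** Write w for the bandwidth.  The entries are truncated at K = N^(q/8) and
    divided by s * sqrt w, where v <= s^2.  As all moments are finite, almost
    surely only finitely many of the matrices notice the truncation
    ([overflow_ae]).  Afterwards the m-th moment of an entry is at most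
    w^-1 * kappa^(m-2), with kappa = K / (s * sqrt w) a negative power of N; the
    first moment, although no longer zero, is still at most w^-1
    ([mom_weight]).

    Upper bound.  The expected trace of the n-th power is a sum over closed
    walks of products of moments, one for each edge.  Read a walk step by step
    and call an edge open while it has been traversed exactly once.  A step to a
    new vertex has at most w choices and costs w^-1.  A step that closes an open
    edge costs nothing.  Every other step is called bad: it has few choices and
    gains a factor w^-1 or kappa.  The difficulty is that closing steps may be
    ambiguous, because several open edges can meet at the current vertex.  The
    potential [excess] measures this ambiguity: it drops at each ambiguous
    closing step, only bad steps raise it, and by at most 2.  Weighting a walk
    with M^excess therefore turns the ambiguity into a factor polynomial in the
    length, paid for by the bad steps, and the sum over all walks of length n < M
    is at most N * (2 + M^3 / w + M^2 * kappa)^n ([run_bound], [walk_sum]); the 2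
    is one unit for new vertices and one for closing steps.  With n of order log N
    the base tends to 2, so that Markov's inequality and the Borel-Cantelli lemma
    give the upper bound ([upper_ae]).

    Lower bound.  For fixed k the trace of the power 2k is at most N times the
    2k-th power of the norm.  A walk without bad steps explores a tree, its open
    edges forming a stack; if it is closed, it traverses each of its edges
    exactly twice and contributes the k-th power of the second moment
    ([clean_closed]).  Such walks correspond to Dyck paths decorated by the
    choice of new vertices, and there are about w^k times a Catalan number of
    them for each starting point ([clean_closings_ge], [dyck_ge]); the 2k-th root
    of the Catalan number tends to 2.  Giving every bad step an additional factor
    gam, with gam growing like a power of N, leaves the upper bound of order N
    and shows that walks with bad steps are negligible ([Ex_trace_ge]).  The
    variance of the trace is a sum over pairs of closed walks that share an edge.
    Rotating the second walk so that it starts with a shared edge makes the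
    concatenation a walk with a bad step, whence a variance of order N divided by
    a power of N ([pair_sum], [variance_trace_le]).  Chebyshev's inequality then
    gives summable probabilities ([lower_ae]).

    The lower bound uses the band only through [wide_neighbourhoods]: from most
    vertices, a bounded number of steps meets only vertices of almost full
    degree.  This holds at all vertices of a periodic band, away from the two
    ends of a strict band with b_N / N tending to 0, and at all vertices of a
    strict band with b_N / N tending to 1. *)

(** * Operator norm and traces of powers *)

Section OperatorNorm.
Variables (R : realType) (N : nat).
Implicit Types (A : 'M[R]_N) (x y : 'cV[R]_N).

Definition l2sq x : R := \sum_i x i 0 ^+ 2.

Lemma l2sq_ge0 x : 0 <= l2sq x.
Proof. by apply: sumr_ge0 => i _; rewrite sqr_ge0. Qed.

Lemma l2norm_sqr x : l2norm x ^+ 2 = l2sq x.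
Proof. by rewrite /l2norm sqr_sqrtr // l2sq_ge0. Qed.

Lemma l2norm_ge0 x : 0 <= l2norm x.
Proof. exact: sqrtr_ge0. Qed.

Lemma l2sqZ a x : l2sq (a *: x) = a ^+ 2 * l2sq x.
Proof. by rewrite /l2sq mulr_sumr; apply: eq_bigr => i _; rewrite mxE exprMn. Qed.

(** Lagrange's identity: twice the gap is a sum of squares. *)
Lemma cauchy_schwarz_sum (I : finType) (a b : I -> R) :
  (\sum_i a i * b i) ^+ 2 <= (\sum_i a i ^+ 2) * (\sum_i b i ^+ 2).
Proof.
rewrite -subr_ge0 -(pmulr_rge0 _ (ltr0Sn R 1)).
have -> : 2%:R * ((\sum_i a i ^+ 2) * (\sum_i b i ^+ 2) - (\sum_i a i * b i) ^+ 2)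
  = \sum_i \sum_j (a i * b j - a j * b i) ^+ 2.
  rewrite expr2 !big_distrlr /= mulrBr mulr2n mulrDl mul1r [X in _ + X - _]exchange_big /=.
  rewrite -big_split mulr_sumr -sumrB; apply: eq_bigr => i _.
  rewrite -big_split mulr_sumr -sumrB; apply: eq_bigr => j _ /=; ring.
by apply: sumr_ge0 => i _; apply: sumr_ge0 => j _; rewrite sqr_ge0.
Qed.

Lemma dot_sqr_le x y : ((x^T *m y) 0 0) ^+ 2 <= l2sq x * l2sq y.
Proof.
rewrite mxE; under eq_bigr do rewrite mxE.
exact: cauchy_schwarz_sum.
Qed.

Lemma l2sqE x : l2sq x = (x^T *m x) 0 0.
Proof. by rewrite mxE; apply: eq_bigr => i _; rewrite mxE expr2. Qed.

Lemma trmx_pow A k : A^T = A -> (A ^+ k)^T = A ^+ k.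
Proof.
move=> sA; elim: k => [|k IH]; first by rewrite expr0 trmx1.
by rewrite {1}exprS -[A * _]/(A *m _) trmx_mul IH sA exprSr.
Qed.

Lemma mulmx_pow A k x : A ^+ k.+1 *m x = A *m (A ^+ k *m x).
Proof. by rewrite exprS -[A * _]/(A *m _) mulmxA. Qed.

(** By symmetry, the left-hand side is the squared inner product of A^k x and
    A^(k+2) x. *)
Lemma l2sq_pow_logconvex A k x : A^T = A ->
  l2sq (A ^+ k.+1 *m x) ^+ 2 <= l2sq (A ^+ k *m x) * l2sq (A ^+ k.+2 *m x).
Proof.
move=> sA; apply: le_trans (dot_sqr_le _ _).
have E i j : (A ^+ i *m x)^T *m (A ^+ j *m x) = x^T *m A ^+ (i + j) *m x.
  by rewrite trmx_mul trmx_pow // exprD -[A ^+ i * _]/(A ^+ i *m _) !mulmxA.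
by rewrite l2sqE !E addSnnS.
Qed.

Lemma trace_powE A k : A^T = A -> \tr (A ^+ (2 * k)) = \sum_i \sum_j (A ^+ k) i j ^+ 2.
Proof.
move=> sA; rewrite mul2n -addnn exprD; apply: eq_bigr => i _; rewrite mxE.
by apply: eq_bigr => j _; rewrite -[in X in _ * X](trmx_pow k sA) mxE expr2.
Qed.

Lemma trace_pow_ge0 A k : A^T = A -> 0 <= \tr (A ^+ (2 * k)).
Proof.
by move=> sA; rewrite trace_powE // sumr_ge0 // => i _; rewrite sumr_ge0 // => j _; rewrite sqr_ge0.
Qed.

Lemma l2sq_mul_le A x : l2sq (A *m x) <= (\sum_i \sum_j A i j ^+ 2) * l2sq x.
Proof.
rewrite mulr_suml; apply: ler_sum => i _; rewrite mxE; exact: cauchy_schwarz_sum.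
Qed.

(** The ratios of consecutive terms increase, so each is at least a 1 / a 0. *)
Lemma logconvex_pow (a : nat -> R) k : (forall i, 0 <= a i) ->
  (forall i, a i.+1 ^+ 2 <= a i * a i.+2) -> a 1%N ^+ k.+1 <= a 0%N ^+ k * a k.+1.
Proof.
move=> a0 ac.
have ratio i : a i * a 1%N <= a 0%N * a i.+1.
  elim: i => [|i IH] //.
  have [ai0|] := eqVneq (a i) 0.
    have : a i.+1 ^+ 2 <= 0 by rewrite (le_trans (ac i)) // ai0 mul0r.
    rewrite le_eqVlt ltNge sqr_ge0 orbF sqrf_eq0 => /eqP ->.
    by rewrite mul0r mulr_ge0.
  rewrite neq_lt ltNge a0 /= => aip; rewrite -(ler_pM2l aip).
  have := ler_wpM2l (a0 i.+1) IH; have := ler_wpM2l (a0 0%N) (ac i).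
  by rewrite expr2; nra.
elim: k => [|k IH]; first by rewrite expr0 mul1r.
rewrite exprSr; apply: le_trans (ler_wpM2r (a0 1%N) IH) _.
by rewrite -mulrA [a 0%N ^+ k.+1]exprSr -[leRHS]mulrA ler_wpM2l ?exprn_ge0.
Qed.

(** Log-convexity passes from A x to A^(k+1) x, whose norm is bounded by the
    Frobenius norm of A^(k+1). *)
Lemma l2sq_mul_pow_le A k x : A^T = A -> l2sq x <= 1 ->
  l2sq (A *m x) ^+ k.+1 <= \tr (A ^+ (2 * k.+1)).
Proof.
move=> sA x1.
have := @logconvex_pow (fun i => l2sq (A ^+ i *m x)) k (fun i => l2sq_ge0 _)
   (fun i => l2sq_pow_logconvex i x sA).
rewrite expr1 expr0 mul1mx => /le_trans -> //.
rewrite -[leRHS]mul1r ler_pM ?exprn_ge0 ?exprn_ile1 ?l2sq_ge0 //.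
apply: le_trans (l2sq_mul_le _ _) _; rewrite trace_powE //.
rewrite ler_piMr // sumr_ge0 // => i _; rewrite sumr_ge0 // => j _; exact: sqr_ge0.
Qed.

Let unit_image A := [set l2norm (A *m x) | x in [set x : 'cV[R]_N | l2norm x <= 1]].

Lemma unit_image0 A : unit_image A 0.
Proof.
exists 0; rewrite /= ?mulmx0 /l2norm big1 ?sqrtr0 // => i _; by rewrite mxE expr0n.
Qed.

Lemma l2norm_le1 x : l2norm x <= 1 -> l2sq x <= 1.
Proof. by move=> x1; rewrite -l2norm_sqr exprn_ile1 // l2norm_ge0. Qed.

Lemma has_sup_unit_image A : has_sup (unit_image A).
Proof.
split; first by exists 0; exact: unit_image0.
exists (Num.sqrt (\sum_i \sum_j A i j ^+ 2)) => _ [x /= x1 <-].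
rewrite ler_wsqrtr //; apply: le_trans (l2sq_mul_le A x) _.
rewrite ler_piMr ?l2norm_le1 // sumr_ge0 // => i _; rewrite sumr_ge0 // => j _; exact: sqr_ge0.
Qed.

Lemma opnorm_ge0 A : 0 <= opnorm A.
Proof. by apply: sup_upper_bound (unit_image0 A); exact: has_sup_unit_image. Qed.

Lemma opnorm_le_trace A k c : A^T = A -> 0 <= c ->
  \tr (A ^+ (2 * k.+1)) <= c ^+ (2 * k.+1) -> opnorm A <= c.
Proof.
move=> sA c0 trc; apply: ge_sup; first by exists 0; exact: unit_image0.
move=> _ [x /= /l2norm_le1 x1 <-].
rewrite -(@ler_pXn2r _ (2 * k.+1)) ?nnegrE ?l2norm_ge0 //.
apply: le_trans trc; rewrite exprM l2norm_sqr; exact: l2sq_mul_pow_le.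
Qed.

Lemma l2norm_mul_le A x : l2norm (A *m x) <= opnorm A * l2norm x.
Proof.
have [x0|xn0] := eqVneq (l2sq x) 0.
  have -> : l2norm (A *m x) = 0.
    apply/eqP; rewrite -sqrf_eq0 l2norm_sqr eq_le l2sq_ge0 andbT.
    by apply: le_trans (l2sq_mul_le A x) _; rewrite x0 mulr0.
  by rewrite mulr_ge0 ?opnorm_ge0 ?l2norm_ge0.
have nx0 : 0 < l2norm x by rewrite lt0r l2norm_ge0 andbT -sqrf_eq0 l2norm_sqr.
have normZ a y : 0 <= a -> l2norm (a *: y) = a * l2norm y.
  move=> a0; apply/eqP; rewrite -(@eqrXn2 _ 2) ?mulr_ge0 ?l2norm_ge0 //.
  by rewrite exprMn !l2norm_sqr l2sqZ.
rewrite -ler_pdivrMr // mulrC -normZ ?invr_ge0 ?l2norm_ge0 // scalemxAr.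
apply: sup_upper_bound; first exact: has_sup_unit_image.
by exists ((l2norm x)^-1 *: x) => //=; rewrite normZ ?invr_ge0 ?l2norm_ge0 // mulVf // gt_eqF.
Qed.

(** The trace is the sum of |A^k e_j|^2 over the standard basis. *)
Lemma trace_le_opnorm A k : A^T = A -> \tr (A ^+ (2 * k)) <= N%:R * opnorm A ^+ (2 * k).
Proof.
move=> sA; rewrite trace_powE //.
have pw x : l2sq (A ^+ k *m x) <= opnorm A ^+ (2 * k) * l2sq x.
  elim: k => [|k IH]; first by rewrite muln0 !expr0 mul1mx mul1r.
  rewrite mulmx_pow mulnS exprD -mulrA -l2norm_sqr.
  apply: le_trans (_ : opnorm A ^+ 2 * l2sq (A ^+ k *m x) <= _); last first.
    by rewrite ler_wpM2l // sqr_ge0.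
  rewrite -l2norm_sqr -exprMn ler_sqr ?nnegrE ?mulr_ge0 ?l2norm_ge0 ?opnorm_ge0 //.
  exact: l2norm_mul_le.
rewrite exchange_big /= -[N in N%:R]card_ord mulr_natl -sumr_const; apply: ler_sum => j _.
have := pw (delta_mx j 0).
rewrite [l2sq (delta_mx _ _)](bigD1 j) //= mxE !eqxx expr1n big1 ?addr0 ?mulr1; last first.
  by move=> i /negbTE ij; rewrite mxE ij expr0n.
apply: le_trans; rewrite le_eqVlt; apply/orP; left; apply/eqP.
by apply: eq_bigr => i _; rewrite -colE mxE.
Qed.

(** The bounds of the norm by traces are off by a factor N^(1/2k), which
    disappears as k grows.  The equivalence describes the norm by countably many
    polynomials in the entries, which is how its measurability is obtained. *)
Lemma opnorm_leP A c : A^T = A -> 0 <= c ->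
  opnorm A <= c <-> forall k, \tr (A ^+ (2 * k.+1)) <= N%:R * c ^+ (2 * k.+1).
Proof.
move=> sA c0; split=> [Ac k|H].
  apply: le_trans (trace_le_opnorm _ sA) _; rewrite ler_wpM2l //.
  by rewrite lerXn2r // nnegrE // opnorm_ge0.
apply: contrapT => /negP; rewrite -ltNge => cA.
have A0 : 0 < opnorm A by exact: le_lt_trans cA.
pose d := (c + opnorm A) / 2.
have [cd dA] : c < d /\ d < opnorm A by split; rewrite /d; lra.
have d0 : 0 < d by exact: le_lt_trans cd.
suff : opnorm A <= d by rewrite leNgt dA.
have r0 : 0 <= c / d by rewrite divr_ge0 // ltW.
have /cvgrPdist_lt /(_ (N.+1%:R^-1)) : (c / d) ^+ n @[n --> \oo] --> 0.
  by apply: cvg_expr; rewrite ger0_norm // ltr_pdivrMr // mul1r.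
rewrite invr_gt0 ltr0n => /(_ isT) [n _ /(_ (2 * n.+1)%N)].
rewrite /= => /(_ ltac:(lia)); rewrite sub0r normrN ger0_norm ?exprn_ge0 // => rn.
apply: (opnorm_le_trace (k := n)) => //; first exact: ltW.
apply: le_trans (H n) _.
have -> : c = c / d * d by rewrite divfK // gt_eqF.
rewrite exprMn mulrA ler_piMl ?exprn_ge0 ?(ltW d0) //.
apply: le_trans (ler_wpM2l (ler0n _ _) (ltW rn)) _.
by rewrite ler_pdivrMr ?ltr0n // mul1r ler_nat.
Qed.

End OperatorNorm.

(** * Weighted walks and the excess potential *)

Section TupleSums.
Variables (V : finType) (A : nmodType).

Lemma sum_tuple0 (F : seq V -> A) : \sum_(p : 0.-tuple V) F p = F [::].
Proof.
rewrite (bigD1 [tuple]) //= big1 ?addr0 // => p.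
by move=> /eqP[]; exact: tuple0.
Qed.

Lemma sum_tupleS n (F : seq V -> A) :
  \sum_(p : n.+1.-tuple V) F p = \sum_y \sum_(p : n.-tuple V) F (y :: p).
Proof.
rewrite pair_big /=.
rewrite (reindex (fun q : V * n.-tuple V => [tuple of q.1 :: q.2])) //=.
exists (fun p : n.+1.-tuple V => (thead p, [tuple of behead p])) => [[y p] _|p _] /=.
  by congr (_, _); apply: val_inj.
by rewrite [RHS]tuple_eta; apply: val_inj.
Qed.
End TupleSums.

Lemma sum_tuple0_nat (V : finType) (F : seq V -> nat) :
  (\sum_(p : 0.-tuple V) F p = F [::])%N.
Proof. exact: (sum_tuple0 F). Qed.

Lemma sum_tupleS_nat (V : finType) n (F : seq V -> nat) :
  (\sum_(p : n.+1.-tuple V) F p = \sum_y \sum_(p : n.-tuple V) F (y :: p))%N.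
Proof. exact: (sum_tupleS n F). Qed.

(** An undirected edge is represented by the ordered pair of its ends, that is by
    an index of the independent family of entries on and above the diagonal. *)
Definition uedge N (i j : 'I_N) : 'I_N * 'I_N :=
  if (i <= j)%N then (i, j) else (j, i).

Lemma uedgeC N (i j : 'I_N) : uedge i j = uedge j i.
Proof.
rewrite /uedge; case: (ltngtP i j) => // /val_inj ->; by [].
Qed.

Lemma uedge_eqE N (u y v z : 'I_N) : (uedge u y == uedge v z) =
  ((v == u) && (z == y)) || ((v == y) && (z == u)).
Proof.
rewrite /uedge; case: ifP => uy; case: ifP => vz; rewrite xpair_eqE -!val_eqE /=; lia.
Qed.

Fixpoint wedges N (u : 'I_N) (p : seq 'I_N) : seq ('I_N * 'I_N) :=
  if p is y :: p' then uedge u y :: wedges y p' else [::].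

Section Excess.
Variable N : nat.
Implicit Types (u v y z : 'I_N) (h : seq ('I_N * 'I_N)).

(** Edges traversed exactly once in the history h are called open; a loop counts
    once. *)
Definition open_degree h v := (\sum_z (count_mem (uedge v z) h == 1))%N.

(** Without bad steps the open edges form a path that ends at the current vertex
    u, and then at most one of them meets u and at most two meet any other vertex.
    The potential counts the open edges beyond this. *)
Definition excess h u := (\sum_v (open_degree h v - (2 - (v == u))))%N.

Lemma sum_eq1 (a : 'I_N) : (\sum_(z : 'I_N) (z == a) = 1)%N.
Proof. by rewrite (bigD1 a) //= eqxx big1 // => z /negbTE ->. Qed.

Lemma sum_uedge u y v : (\sum_z (uedge u y == uedge v z) = ((v == u) || (v == y)))%N.
Proof.
under eq_bigr do rewrite uedge_eqE.
case: (v =P u) => [?|_] /=; case: (v =P y) => [?|_] /=; subst.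
- by under eq_bigr do rewrite orbb; exact: sum_eq1.
- by under eq_bigr do rewrite orbF; exact: sum_eq1.
- exact: sum_eq1.
- by rewrite big1.
Qed.

Lemma open_degree_open h u y v : count_mem (uedge u y) h = 0%N ->
  open_degree (uedge u y :: h) v = (open_degree h v + ((v == u) || (v == y)))%N.
Proof.
move=> c0; rewrite /open_degree -sum_uedge -big_split; apply: eq_bigr => z _ /=.
by case: (uedge u y =P uedge v z) => [<-|_] /=; rewrite ?c0 ?addn0.
Qed.

Lemma open_degree_close h u y v : count_mem (uedge u y) h = 1%N ->
  open_degree h v = (open_degree (uedge u y :: h) v + ((v == u) || (v == y)))%N.
Proof.
move=> c0; rewrite /open_degree -sum_uedge -big_split; apply: eq_bigr => z _ /=.
by case: (uedge u y =P uedge v z) => [<-|_] /=; rewrite ?c0 ?addn0.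
Qed.

Lemma open_degree_again h u y v : (1 < count_mem (uedge u y) h)%N ->
  open_degree (uedge u y :: h) v = open_degree h v.
Proof.
move=> c0; rewrite /open_degree; apply: eq_bigr => z _ /=; case: (uedge u y =P uedge v z) => [<-|_] //=.
by case: (count_mem _ _) c0 => [|[]].
Qed.

(** The open degree of u grows, but so does its allowance, as u is no longer the
    current vertex. *)
Lemma excess_new h u y : count_mem (uedge u y) h = 0%N -> open_degree h y = 0%N ->
  (excess (uedge u y :: h) y <= excess h u)%N.
Proof.
move=> c0 d0; apply: leq_sum => v _; rewrite (open_degree_open v c0).
case: (eqVneq v y) => [->|_]; [rewrite d0|]; case: (_ == u) => /=; lia.
Qed.

Lemma excess_open h u y : count_mem (uedge u y) h = 0%N ->
  (excess (uedge u y :: h) y <= excess h u + 2)%N.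
Proof.
move=> c0; have -> : 2%N = (\sum_v (v == y) * 2)%N by rewrite -big_distrl /= sum_eq1.
rewrite -big_split /=.
apply: leq_sum => v _; rewrite (open_degree_open v c0).
case: (eqVneq v y) => [->|_]; case: (_ == u) => /=; lia.
Qed.

Lemma excess_close h u y : count_mem (uedge u y) h = 1%N ->
  (excess (uedge u y :: h) y <= excess h u)%N.
Proof.
move=> c0; apply: leq_sum => v _; rewrite (open_degree_close v c0).
case: (eqVneq v y) => [->|_]; case: (_ == u) => /=; lia.
Qed.

(** The step is ambiguous, as several open edges meet at u.  But then the excess at
    u is positive, and it drops since u loses an open edge and its allowance does
    not shrink. *)
Lemma excess_close_lt h u y : count_mem (uedge u y) h = 1%N -> (1 < open_degree h u)%N ->
  (excess (uedge u y :: h) y < excess h u)%N.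
Proof.
move=> c0 d1; rewrite -addn1 -(sum_eq1 u) -big_split /=.
apply: leq_sum => v _; move: d1; rewrite !(open_degree_close _ c0).
case: (eqVneq v u) => [->|_]; rewrite ?eqxx /=; case: (_ == y) => /=; lia.
Qed.

Lemma excess_again h u y : (1 < count_mem (uedge u y) h)%N ->
  (excess (uedge u y :: h) y <= excess h u + 1)%N.
Proof.
move=> c0; rewrite -(sum_eq1 y) -big_split /=.
apply: leq_sum => v _; rewrite (open_degree_again v c0).
case: (eqVneq v y) => [->|_]; case: (_ == u) => /=; lia.
Qed.

Lemma excess_jump h u z : (excess h z <= excess h u + 1)%N.
Proof.
rewrite -(sum_eq1 z) -big_split /=; apply: leq_sum => v _.
by case: (eqVneq v z) => [->|_]; case: (_ == u) => /=; lia.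
Qed.

Lemma excess_nil u : excess [::] u = 0%N.
Proof. by rewrite /excess big1 // => v _; rewrite /open_degree big1. Qed.

End Excess.

Section Weights.
Variables (N : nat) (R : realFieldType) (iw kap gam : R).
Hypotheses (iw0 : 0 <= iw) (kap0 : 0 <= kap) (gam1 : 1 <= gam).
Implicit Types (u v y z x : 'I_N) (h : seq ('I_N * 'I_N)) (l p : seq 'I_N).

(** Neither the discovery of a vertex nor the closing of an open edge. *)
Definition bad_step l h u y :=
  let c := count_mem (uedge u y) h in (c == 0%N) && (y \in l) || (1 < c)%N.

(** The ratio of consecutive values of [mult_weight] below.  There iw stands for
    the inverse of the bandwidth, the size of the second moment of an entry, and
    kap for a bound of the entries. *)
Definition mult_factor (c : nat) : R :=
  if c is c'.+1 then if c' is 0 then 1 else kap else iw.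

(** The factor gam marks bad steps: a bound that holds for large gam shows that
    walks with a bad step contribute little. *)
Definition step_weight l h u y : R :=
  (if bad_step l h u y then gam else 1) * mult_factor (count_mem (uedge u y) h).

Fixpoint bad l h u p :=
  if p is y :: p' then bad_step l h u y || bad (y :: l) (uedge u y :: h) y p'
  else false.

Fixpoint run_weight l h u p : R :=
  if p is y :: p' then
    step_weight l h u y * run_weight (y :: l) (uedge u y :: h) y p'
  else 1.

(** The bound for the absolute m-th moment of an entry.  The first moment has the
    same bound as the second one, as truncation destroys exact centring. *)
Definition mult_weight (m : nat) : R :=
  if m is m'.+1 then iw * kap ^+ m'.-1 else 1.

Definition edge_weight h : R := \prod_f mult_weight (count_mem f h).

Lemma mult_factor_ge0 c : 0 <= mult_factor c.
Proof. by case: c => [|[]] /=. Qed.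

Lemma mult_weight_ge0 m : 0 <= mult_weight m.
Proof. by case: m => [|m] //=; rewrite mulr_ge0 ?exprn_ge0. Qed.

Lemma edge_weight_ge0 h : 0 <= edge_weight h.
Proof. by apply: prodr_ge0 => f _; exact: mult_weight_ge0. Qed.

Lemma edge_weight_nil : edge_weight [::] = 1.
Proof. by rewrite /edge_weight big1. Qed.

Lemma edge_weight_cons f h :
  edge_weight (f :: h) = edge_weight h * mult_factor (count_mem f h).
Proof.
rewrite /edge_weight (bigD1 f) //= [in RHS](bigD1 f) //= eqxx.
rewrite [RHS]mulrAC; congr (_ * _); last first.
  by apply: eq_bigr => g; rewrite eq_sym => /negbTE ->.
case: (count_mem f h) => [|[|m]] /=; rewrite ?expr0 ?mulr1 ?mul1r //.
by rewrite exprSr mulrA.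
Qed.

Lemma perm_edge_weight h h' : perm_eq h h' -> edge_weight h = edge_weight h'.
Proof. by move=> /permP E; apply: eq_bigr => f _; rewrite E. Qed.

Lemma step_weight_ge0 l h u y : 0 <= step_weight l h u y.
Proof.
by rewrite mulr_ge0 ?mult_factor_ge0 //; case: ifP => // _; rewrite (le_trans ler01).
Qed.

Lemma run_weight_ge0 l h u p : 0 <= run_weight l h u p.
Proof.
by elim: p l h u => //= y p IH l h u; rewrite mulr_ge0 ?step_weight_ge0.
Qed.

Lemma run_weight_ge l h u p :
  edge_weight (catrev (wedges u p) h) * (if bad l h u p then gam else 1)
    <= edge_weight h * run_weight l h u p.
Proof.
elim: p l h u => [|y p IH] l h u /=; first by rewrite mulr1.
have := IH (y :: l) (uedge u y :: h) y.
rewrite edge_weight_cons /step_weight.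
set W := edge_weight (catrev _ _); set r := run_weight _ _ _ _.
have W0 : 0 <= W by exact: edge_weight_ge0.
case: (bad_step l h u y) => /=; last by rewrite mul1r -!mulrA.
move=> H; apply: (@le_trans _ _ (gam * W)); first by rewrite mulrC.
have g0 : 0 <= gam by rewrite (le_trans ler01).
have W1 : W <= edge_weight h * mult_factor (count_mem (uedge u y) h) * r.
  apply: le_trans H; rewrite ler_peMr //; by case: ifP.
by apply: le_trans (ler_wpM2l g0 W1) _; rewrite !mulrA [gam * _]mulrC.
Qed.

End Weights.

Section Bound.
Variables (N : nat) (R : realFieldType) (e : rel 'I_N) (iw kap gam : R) (M : nat).
Hypotheses (iw0 : 0 <= iw) (kap0 : 0 <= kap) (gam1 : 1 <= gam) (M0 : (0 < M)%N).
Hypothesis edeg : forall u, #|[pred y | e u y]|%:R * iw <= 1.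
Implicit Types (u v y z x : 'I_N) (h : seq ('I_N * 'I_N)) (l p : seq 'I_N).

(** Testing one end of each edge suffices, as [uedge] is symmetric. *)
Definition covers l h := forall v y, uedge v y \in h -> y \in l.

Lemma covers_step l h u y : u \in l -> covers l h -> covers (y :: l) (uedge u y :: h).
Proof.
move=> ul c v z; rewrite inE => /orP[|/c]; last by rewrite inE orbC => ->.
rewrite eq_sym uedge_eqE inE => /orP[] /andP[/eqP ? /eqP ?]; subst; rewrite ?eqxx //.
by rewrite ul orbT.
Qed.

(** The two regular kinds of steps contribute 1 each.  A bad step has at most M
    choices and raises the excess by at most 2 if the edge is new, by at most 1 if
    it has been traversed twice before; each unit of excess costs a factor M. *)
Definition growth : R := 2 + gam * (M%:R ^+ 3 * iw + M%:R ^+ 2 * kap).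

Local Notation sw := (step_weight iw kap gam).
Local Notation rw := (run_weight iw kap gam).

Lemma growth_ge0 : 0 <= growth.
Proof.
have g0 : 0 <= gam by rewrite (le_trans ler01).
by rewrite addr_ge0 // mulr_ge0 // addr_ge0 // mulr_ge0 // exprn_ge0.
Qed.

(** New vertices contribute at most 1 since the degree is at most 1 / iw.  So do
    closing steps: either there is only one, or there are at most M and each of
    them lowers the excess. *)
Lemma step_bound l h u : u \in l -> covers l h -> (size l <= M)%N ->
  \sum_(y | e u y) sw l h u y * M%:R ^+ excess (uedge u y :: h) y
    <= growth * M%:R ^+ excess h u.
Proof.
move=> ul clh slM.
have M1 : 1 <= M%:R :> R by rewrite ler1n.
have Mgt0 : 0 < M%:R :> R by rewrite ltr0n.
have g0 : 0 <= gam by rewrite (le_trans ler01).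
set E := M%:R ^+ excess h u.
have E0 : 0 <= E by rewrite exprn_ge0.
(* Bound for the effect on the potential of one closing step at u. *)
pose c1 : R := if (open_degree h u <= 1)%N then 1 else M%:R^-1.
have c10 : 0 <= c1 by rewrite /c1; case: ifP => // _; rewrite invr_ge0.
pose A : R := gam * iw * M%:R ^+ 2 + gam * kap * M%:R.
have A0 : 0 <= A by rewrite addr_ge0 // ?mulr_ge0 ?exprn_ge0.
have leM a b : (a <= b)%N -> (M%:R : R) ^+ a <= M%:R ^+ b by move=> ab; rewrite ler_weXn2l.
have pt y : sw l h u y * M%:R ^+ excess (uedge u y :: h) y <=
    E * ((y \notin l)%:R * iw + (y \in l)%:R * A +
         (count_mem (uedge u y) h == 1%N)%:R * c1).
  rewrite /step_weight /bad_step; case ce : (count_mem _ h) => [|[|m]] /=.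
  - rewrite mul0r addr0; case: (boolP (y \in l)) => yl /=; rewrite ?mul0r ?mul1r ?addr0 ?add0r.
      rewrite mulrC; apply: (@le_trans _ _ (E * M%:R ^+ 2 * (gam * iw))).
        by rewrite ler_wpM2r ?mulr_ge0 // -exprD leM // excess_open.
      by rewrite -mulrA ler_wpM2l // /A [_ * (gam * iw)]mulrC lerDl mulr_ge0 // mulr_ge0.
    rewrite mulrC ler_wpM2r // leM // excess_new //.
    rewrite /open_degree big1 // => z _; apply/eqP; rewrite eqb0; apply/negP => /eqP cz.
    have /clh : uedge z y \in h by rewrite uedgeC -has_pred1 has_count cz.
    by rewrite (negbTE yl).
  - rewrite !mul1r.
    apply: (@le_trans _ _ (E * c1)); last first.
      by rewrite ler_wpM2l // lerDr addr_ge0 // mulr_ge0.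
    rewrite /c1; case: ifP => od; first by rewrite mulr1 leM // excess_close.
    rewrite ler_pdivlMr // -exprSr leM // excess_close_lt // ltnNge od //.
  - have yl : y \in l by apply: (clh u); rewrite -has_pred1 has_count ce.
    rewrite yl /= !(mul0r, mul1r, add0r, addr0) mulrC.
    apply: (@le_trans _ _ (E * M%:R * (gam * kap))).
      by rewrite ler_wpM2r ?mulr_ge0 // -exprSr leM // -addn1 excess_again // ce.
    rewrite -mulrA ler_wpM2l // /A [M%:R * _]mulrC lerDr.
    by rewrite !mulr_ge0 // exprn_ge0.
apply: le_trans (ler_sum _ (fun y _ => pt y)) _.
rewrite -big_distrr /= mulrC ler_wpM2r // !big_split /=.
rewrite -!mulr_suml.
have S1 : (\sum_(y | e u y) (y \notin l)%:R) * iw <= 1 :> R.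
  apply: le_trans (edeg u); rewrite ler_wpM2r // -sum1_card natr_sum.
  by rewrite ler_sum // => y _; case: (y \notin l).
have S2 : (\sum_(y | e u y) (y \in l)%:R) <= M%:R :> R.
  apply: (@le_trans _ _ (\sum_(y in l) 1)).
    rewrite [leRHS]big_mkcond /= big_mkcond /=.
    by apply: ler_sum => y _; case: (e u y); case: (y \in l).
  rewrite sumr_const ler_nat.
  exact: leq_trans (card_size l) slM.
have S3 : (\sum_(y | e u y) (count_mem (uedge u y) h == 1%N)%:R) <= (open_degree h u)%:R :> R.
  rewrite /open_degree natr_sum [leLHS]big_mkcond /=.
  by apply: ler_sum => y _; case: (e u y).
have odM : (open_degree h u <= M)%N.
  apply: leq_trans slM; apply: leq_trans (card_size l).
  rewrite -sum1_card /open_degree [leqRHS]big_mkcond /=.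
  apply: leq_sum => y _; case: ifP => yl; first by case: (_ == _).
  rewrite leqn0 eqb0; apply/negP => /eqP cz.
  have /clh : uedge u y \in h by rewrite -has_pred1 has_count cz.
  by rewrite yl.
have S3' : (open_degree h u)%:R * c1 <= 1 :> R.
  rewrite /c1; case: ifP => od; first by rewrite mulr1 -[1]/(1%:R) ler_nat.
  by rewrite ler_pdivrMr // mul1r ler_nat.
have := ler_wpM2r c10 S3; have := ler_wpM2r A0 S2.
rewrite /growth /A => *.
have -> : gam * (M%:R ^+ 3 * iw + M%:R ^+ 2 * kap) =
  M%:R * (gam * iw * M%:R ^+ 2 + gam * kap * M%:R) by ring.
lra.
Qed.

Lemma run_bound n l h u : u \in l -> covers l h -> (size l + n <= M)%N ->
  \sum_(p : n.-tuple 'I_N | path e u p)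
     rw l h u p * M%:R ^+ excess (catrev (wedges u p) h) (last u p)
    <= growth ^+ n * M%:R ^+ excess h u.
Proof.
elim: n l h u => [|n IH] l h u ul clh slM.
  rewrite big_mkcond /= (sum_tuple0 (fun p => if path e u p then
     rw l h u p * M%:R ^+ excess (catrev (wedges u p) h) (last u p) else 0)) /=.
  by [].
rewrite big_mkcond /= (sum_tupleS _ (fun p => if path e u p then
     rw l h u p * M%:R ^+ excess (catrev (wedges u p) h) (last u p) else 0)) /=.
apply: (@le_trans _ _ (\sum_(y | e u y)
   sw l h u y * (growth ^+ n * M%:R ^+ excess (uedge u y :: h) y))).
  rewrite [leRHS]big_mkcond /=; apply: ler_sum => y _.
  case: (e u y) => /=; last by rewrite big1.
  rewrite -big_mkcond /=; under eq_bigr do rewrite -mulrA.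
  rewrite -big_distrr /=.
  apply: ler_wpM2l; first exact: step_weight_ge0.
  apply: IH; rewrite ?inE ?eqxx //; first exact: covers_step.
  by rewrite /= addSnnS.
under eq_bigr do rewrite mulrCA.
rewrite -big_distrr /= exprSr -mulrA; apply: ler_wpM2l.
  by rewrite exprn_ge0 // growth_ge0.
by apply: step_bound => //; apply: leq_trans slM; rewrite leq_addr.
Qed.

End Bound.

(** * Walks without bad steps *)

(** Paths with steps +1 and -1 that go from height h to 0 in n steps within the
    nonnegative integers, each ascent being weighted by theta. *)
Fixpoint dyck (theta n h : nat) : nat :=
  if n is n'.+1 then
    (theta * dyck theta n' h.+1 + (if h is h'.+1 then dyck theta n' h' else 0))%N
  else (h == 0)%N.

(** The ballot theorem. *)
Lemma dyck_ballot theta m h : (dyck theta (m.*2 + h) h * (m.*2 + h).+1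
   = h.+1 * 'C((m.*2 + h).+1, m) * theta ^ m)%N.
Proof.
move en : (m.*2 + h)%N => n; elim: n m h en => [|n IH] m h en.
  have [-> ->] : m = 0%N /\ h = 0%N by lia.
  by [].
have H1 : (n.+1 * (theta * dyck theta n h.+1) = h.+2 * (if m is m'.+1 then 'C(n.+1, m') else 0) * theta ^ m)%N.
  case: m en => [|m] en.
    suff -> : dyck theta n h.+1 = 0%N by rewrite !muln0.
    have : (n < h.+1)%N by lia.
    elim: n (h.+1) {IH en} => [|k IHk] [|j] //= kj; rewrite !IHk ?muln0 //; lia.
  have := IH m h.+1; rewrite expnS => ih.
  have {}ih := ih ltac:(lia).
  by rewrite mulnCA [(n.+1 * _)%N]mulnC ih; ring.
have H2 : (n.+1 * (if h is h'.+1 then dyck theta n h' else 0) = h * 'C(n.+1, m) * theta ^ m)%N.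
  case: h en {H1} => [|h] en; first by rewrite muln0.
  have := IH m h; rewrite mulnC => ih; apply: ih; lia.
have H3 : ('C(n.+1, m) * m = (if m is m'.+1 then 'C(n.+1, m') else 0) * (m + h.+1))%N.
  case: m en {H1 H2} => [|m] en; first by rewrite muln0.
  have := mul_bin_left n.+1 m; rewrite mulnC => ->.
  by rewrite [RHS]mulnC; congr (_ * _)%N; lia.
have H4 : 'C(n.+2, m) = ('C(n.+1, m) + (if m is m'.+1 then 'C(n.+1, m') else 0))%N.
  by case: m {en H1 H2 H3} => [|m]; rewrite ?bin0 ?binS ?addn0.
rewrite [dyck _ _ _]/= H4.
move: (dyck theta n h.+1) (if h is _.+1 then _ else _) (if m is _.+1 then _ else _) H1 H2 H3 => X Y a.
move: ('C(n.+1, m)) (theta ^ m)%N => b T H1 H2 H3.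
apply/eqP; rewrite -(eqn_pmul2l (ltn0Sn n)); apply/eqP.
rewrite mulnA mulnDr H1 H2 -en.
apply/eqP; rewrite -(eqn_add2r (2 * T * (b * m))) {2}H3; apply/eqP.
rewrite -mul2n; ring.
Qed.

(** For theta = 1 the first factor on the right is the k-th Catalan number. *)
Lemma dyck_ge theta k :
  ((4 * theta) ^ k <= dyck theta k.*2 0 * (k.*2.+1 * k.+1))%N.
Proof.
have := dyck_ballot theta k 0; rewrite addn0 mul1n mulnA => ->.
have -> : ((4 * theta) ^ k = 4 ^ k * theta ^ k)%N by rewrite expnMn.
rewrite mulnAC leq_mul2r; apply/orP; right.
elim: k => [|k IH]; first by [].
have E : ('C(k.+1.*2.+1, k.+1) * k.+2 = 'C(k.*2.+1, k) * (2 * k.*2.+3))%N.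
  have -> : 'C(k.+1.*2.+1, k.+1) = 'C(k.*2.+3, k.+2).
    rewrite doubleS -[RHS]bin_sub; last lia.
    by congr binomial; lia.
  rewrite mulnC -mul_bin_diag binS.
  have -> : 'C(k.*2.+1, k.+1) = 'C(k.*2.+1, k).
    by rewrite -bin_sub; [congr binomial; lia|lia].
  by ring.
rewrite E expnS; apply: leq_trans (leq_mul (leqnn 4) IH) _.
rewrite mulnCA leq_mul2l; apply/orP; right; lia.
Qed.

Section Runs.
Variables (N : nat) (e : rel 'I_N).
Hypothesis esym : symmetric e.
Implicit Types (u v y z x : 'I_N) (h : seq ('I_N * 'I_N)) (l p s : seq 'I_N).

Lemma covers_run l h u p : u \in l -> covers l h ->
  last u p \in catrev p l /\ covers (catrev p l) (catrev (wedges u p) h).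
Proof.
elim: p l h u => //= y p IH l h u ul c.
by apply: IH; [rewrite inE eqxx|exact: covers_step].
Qed.

Lemma wedges_mem u s v y : uedge v y \in wedges u s -> v \in u :: s.
Proof.
elim: s u => //= z s IH u; rewrite inE => /orP[|/IH H]; last by rewrite inE H orbT.
by rewrite uedge_eqE !inE eq_sym [v == u]eq_sym => /orP[] /andP[/eqP-> /eqP->];
  rewrite eqxx ?orbT.
Qed.

(** Invariant of walks from x without bad steps: the open edges form a stack, the
    simple path s that leads from u back to x, and a closed edge is never used
    again. *)
Definition tree_state x l h u s : Prop :=
  [/\ uniq (u :: s), last u s = x, {subset u :: s <= l}, path e u s &
      forall f, (count_mem f h <= 2)%N /\ (count_mem f h == 1%N) = (f \in wedges u s)].

Lemma tree_start x : tree_state x [:: x] [::] x [::].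
Proof. by split. Qed.

Lemma count_new l h u y : covers l h -> y \notin l -> count_mem (uedge u y) h = 0%N.
Proof.
move=> c yl; apply/eqP; rewrite -leqn0 leqNgt -has_count has_pred1.
by apply: contra yl => /c.
Qed.

Lemma tree_new x l h u s y : covers l h -> tree_state x l h u s -> e u y -> y \notin l ->
  ~~ bad_step l h u y /\ tree_state x (y :: l) (uedge u y :: h) y (u :: s).
Proof.
move=> c [us lx sl ps cf] euy yl; have c0 := count_new u c yl.
split; first by rewrite /bad_step c0 (negbTE yl).
split => //.
- rewrite cons_uniq us andbT; apply: contra yl => /sl //.
- by move=> v; rewrite [in X in _ -> X]inE inE => /orP[->//|/sl ->]; rewrite orbT.
- by rewrite /= esym euy.
move=> f; rewrite /= inE uedgeC eq_sym; case: eqP => [->|_] /=.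
  by rewrite uedgeC c0.
by rewrite add0n; exact: cf.
Qed.

(** As the stack is a simple path, its only edge at u is the first one, so that the
    step returns to the parent of u. *)
Lemma tree_back x l h u s y : tree_state x l h u s -> e u y ->
   count_mem (uedge u y) h = 1%N ->
  exists2 s', s = y :: s' & tree_state x (y :: l) (uedge u y :: h) y s'.
Proof.
move=> [us lx sl ps cf] euy c1.
have : uedge u y \in wedges u s by have [_ <-] := cf (uedge u y); rewrite c1.
case: s us lx sl ps cf => [|z s] //= /andP[uzs uzs'] lx sl /andP[euz ps] cf.
rewrite inE => /orP[|/wedges_mem]; last by rewrite (negbTE uzs).
rewrite uedge_eqE eqxx /= => /orP[/eqP zy|/andP[_ /eqP zu]]; last first.
  by rewrite zu mem_head in uzs.
subst z; exists s => //; split => //.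
  by move=> v vs; rewrite inE sl ?orbT // inE vs orbT.
have nin : uedge u y \notin wedges y s.
  by apply: contra uzs => /wedges_mem.
move=> f /=; case: eqP => [<-|ne] /=.
  by rewrite c1 (negbTE nin).
have [c2 ->] := cf f; split => //.
by rewrite inE; case: eqP => // E; case: ne.
Qed.

Lemma clean_run x l h u s p : u \in l -> covers l h -> tree_state x l h u s ->
  path e u p -> ~~ bad l h u p ->
  exists s', tree_state x (catrev p l) (catrev (wedges u p) h) (last u p) s'.
Proof.
elim: p l h u s => [|y p IH] l h u s ul c ts /=; first by exists s.
move=> /andP[euy pp]; rewrite negb_or => /andP[nb nbp].
have c' := covers_step ul c (y := y).
have yl' : y \in y :: l by rewrite mem_head.
case: (boolP (y \in l)) => yl; last first.
  by have [_ ts'] := tree_new c ts euy yl; exact: IH ts' _ _.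
have c1 : count_mem (uedge u y) h = 1%N.
  by move: nb; rewrite /bad_step yl andbT; case: (count_mem _ _) => [|[]].
have [s' _ ts'] := tree_back ts euy c1; exact: IH ts' _ _.
Qed.

Lemma count_catrev f (s t : seq ('I_N * 'I_N)) :
  count_mem f (catrev s t) = (count_mem f s + count_mem f t)%N.
Proof. by rewrite catrevE count_cat count_rev. Qed.

Lemma covers0 l : @covers N l [::].
Proof. by []. Qed.

(** Back at the start, a simple path from x to x is trivial: the stack is empty. *)
Lemma clean_closed x p : path e x p -> last x p = x -> ~~ bad [:: x] [::] x p ->
  forall f, count_mem f (wedges x p) != 1%N /\ (count_mem f (wedges x p) <= 2)%N.
Proof.
move=> pp lp nb f.
have [s [us lx _ _ cf]] := clean_run (mem_head x [::]) (@covers0 _) (tree_start x) pp nb.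
move: us lx cf; rewrite lp; case: s => [|z s] us lx cf; last first.
  by case/andP: us; rewrite -[X in X \notin _]lx /= mem_last.
by have [] := cf f; rewrite count_catrev addn0 => -> ->.
Qed.

Definition clean_closings n l h u x : nat :=
  (\sum_(p : n.-tuple 'I_N) [&& path e u p, ~~ bad l h u p & last u p == x])%N.

(** The height of the stack follows a Dyck path.  An ascent can go to any of the
    neighbours not yet visited, of which there are at least theta; a descent goes
    to the parent. *)
Lemma clean_closings_ge (good : nat -> pred 'I_N) theta M :
  (forall k u, good k.+1 u -> (theta + M <= #|[pred y | e u y]|)%N) ->
  (forall k u y, good k.+1 u -> e u y -> good k y) ->
  forall n x l h u s, u \in l -> covers l h -> tree_state x l h u s ->
  (size l + n <= M)%N -> good n u ->
  (dyck theta n (size s) <= clean_closings n l h u x)%N.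
Proof.
move=> gdeg gstep; elim=> [|n IH] x l h u s ul c ts lM gu.
  rewrite /clean_closings (sum_tuple0_nat (fun p => nat_of_bool [&& path e u p, ~~ bad l h u p & last u p == x])) /=.
  by case: ts => _ + _ _ _; case: s => //= ->; rewrite eqxx.
rewrite /clean_closings (sum_tupleS_nat _ (fun p => nat_of_bool [&& path e u p, ~~ bad l h u p & last u p == x])) /=.
have step y : e u y -> ~~ bad_step l h u y ->
   (\sum_(p : n.-tuple 'I_N) nat_of_bool [&& path e y p, 
     ~~ (bad_step l h u y || bad (y :: l) (uedge u y :: h) y p) & last y p == x]
   = clean_closings n (y :: l) (uedge u y :: h) y x)%N.
  by move=> euy nb; apply: eq_bigr => p _; rewrite (negbTE nb).
have yl' y : y \in y :: l by rewrite mem_head.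
have lM' y : (size (y :: l) + n <= M)%N by rewrite /= addSnnS.
rewrite (bigID (mem l)) /= [leqRHS]addnC; apply: leq_add.
  apply: (@leq_trans (\sum_(y | e u y && (y \notin l)) dyck theta n (size s).+1)%N); last first.
    rewrite big_mkcondl /= leq_sum // => y yl; case: ifP => //= euy.
    have [nb ts'] := tree_new c ts euy yl.
    rewrite step //; apply: IH ts' _ _ => //; first exact: covers_step.
    exact: gstep euy.
  rewrite sum_nat_const leq_mul2r; apply/orP; right.
  have := gdeg _ _ gu; rewrite -(leq_add2r M).
  have : (#|[pred y | e u y]| <= #|[pred y | e u y && (y \notin l)]| + size l)%N.
    apply: leq_trans (leq_add (leqnn _) (card_size l)).
    rewrite -cardUI; apply: leq_trans (leq_addr _ _).
    by apply: subset_leq_card; apply/fintype.subsetP => y; rewrite !inE; case: (y \in l) => // ->.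
  move=> H1 H2; have -> : #|(fun y => e u y && (y \notin l))| =
    #|[pred y | e u y && (y \notin l)]| by [].
  lia.
case: s ts => [|z s] ts //.
have euz : e u z by case: ts => _ _ _ /=/andP[].
have c1 : count_mem (uedge u z) h = 1%N.
  by apply/eqP; case: ts => _ _ _ _ /(_ (uedge u z)) [_ ->]; rewrite mem_head.
have zl : z \in l by case: ts => _ _ sl _ _; apply: sl; rewrite !inE eqxx orbT.
have nb : ~~ bad_step l h u z by rewrite /bad_step c1.
rewrite (bigD1 z) //= euz /= step //; apply: leq_trans (leq_addr _ _).
have [s' [<-] ts'] := tree_back ts euz c1.
apply: IH ts' _ _ => //; first exact: covers_step.
exact: gstep euz.
Qed.

End Runs.

Section Sums.
Variables (N : nat) (R : realFieldType) (e : rel 'I_N) (iw kap gam : R) (M : nat).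
Hypothesis esym : symmetric e.
Hypotheses (iw0 : 0 <= iw) (kap0 : 0 <= kap) (gam1 : 1 <= gam) (M0 : (0 < M)%N).
Hypothesis edeg : forall u, #|[pred y | e u y]|%:R * iw <= 1.
Local Notation W := (edge_weight iw kap).
Local Notation rw := (run_weight iw kap gam).
Local Notation G := (growth iw kap gam M).

Lemma perm_catrev_wedges (x : 'I_N) p h :
  perm_eq (catrev (wedges x p) h) (wedges x p ++ h).
Proof. by rewrite catrevE perm_cat2r perm_rev. Qed.

Lemma walk_sum n : (n < M)%N ->
  \sum_x \sum_(p : n.-tuple 'I_N | path e x p)
     W (wedges x p) * (if bad [:: x] [::] x p then gam else 1)
  <= N%:R * G ^+ n.
Proof.
move=> nM; rewrite -[N in N%:R]card_ord mulrC -sumr_const mulr_sumr.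
apply: ler_sum => x _; rewrite mulr1.
apply: le_trans (_ : G ^+ n * M%:R ^+ excess [::] x <= _); last by rewrite excess_nil mulr1.
apply: le_trans (run_bound iw0 kap0 gam1 M0 edeg (mem_head x [::]) (@covers0 _ _) _) => //.
apply: ler_sum => p _.
have := run_weight_ge iw0 kap0 gam1 [:: x] [::] x p.
rewrite edge_weight_nil mul1r (perm_edge_weight _ _ (perm_catrev_wedges _ _ _)) cats0.
move=> /le_trans -> //; rewrite ler_peMr ?run_weight_ge0 //.
by rewrite exprn_ege1 // ler1n.
Qed.

(** Here p is closed and q starts with an edge of p.  If p has no bad step, it has
    traversed this edge twice already, so that the first step of q is bad.  In both
    cases the concatenation earns a factor gam.  The jump from x to the start z of
    q costs M choices and one unit of excess. *)
Lemma pair_sum n m : (n.+1 + m.+1 <= M)%N ->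
  \sum_x \sum_(p : n.-tuple 'I_N | path e x p && (last x p == x))
    \sum_z \sum_(q : m.+1.-tuple 'I_N |
                 path e z q && (uedge z (head z q) \in wedges x p))
     W (wedges x p ++ wedges z q) * gam
  <= N%:R * (M%:R ^+ 2 * G ^+ (n + m.+1)).
Proof.
move=> nM; have g0 : 0 <= gam by rewrite (le_trans ler01).
have M1 : 1 <= M%:R :> R by rewrite ler1n.
have G0 : 0 <= G by exact: growth_ge0.
rewrite -[N in N%:R]card_ord mulrC -sumr_const mulr_sumr.
apply: ler_sum => x _; rewrite mulr1.
apply: (@le_trans _ _ (M%:R ^+ 2 * G ^+ m.+1 * (G ^+ n * M%:R ^+ excess [::] x))); last first.
  by rewrite excess_nil mulr1 -mulrA -exprD addnC.
have := run_bound iw0 kap0 gam1 M0 edeg (mem_head x [::]) (@covers0 _ _) (n := n).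
move=> /(_ ltac:(rewrite /=; lia)) RB.
have c0 : 0 <= M%:R ^+ 2 * G ^+ m.+1 by rewrite mulr_ge0 ?exprn_ge0.
apply: le_trans (ler_wpM2l c0 RB); rewrite mulr_sumr.
rewrite big_mkcondr /=; apply: ler_sum => p pp.
set E := M%:R ^+ excess _ _; have E1 : 1 <= E by rewrite exprn_ege1.
have rwp0 := run_weight_ge0 iw0 kap0 gam1 [:: x] [::] x p.
case: eqP => lp; last by rewrite !mulr_ge0 ?exprn_ge0 // (le_trans ler01).
set h := catrev (wedges x p) [::]; set l := catrev p [:: x].
have [xl cov] := covers_run p (mem_head x [::]) (@covers0 _ _).
rewrite -/l -/h in xl cov.
have sl : size l = n.+1 by rewrite /l catrevE size_cat size_rev size_tuple addn1.
have hE : perm_eq h (wedges x p) by rewrite -[wedges x p]cats0; exact: perm_catrev_wedges.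
have key z (q : m.+1.-tuple 'I_N) : path e z q -> uedge z (head z q) \in wedges x p ->
  W (wedges x p ++ wedges z q) * gam <= rw [:: x] [::] x p * rw l h z q.
  move=> pq hq.
  have rwq0 := run_weight_ge0 iw0 kap0 gam1 l h z q.
  have := run_weight_ge iw0 kap0 gam1 l h z q.
  have := run_weight_ge iw0 kap0 gam1 [:: x] [::] x p.
  rewrite edge_weight_nil mul1r -/h.
  rewrite (perm_edge_weight _ _ (_ : perm_eq (catrev (wedges z q) h) (wedges x p ++ wedges z q))); last first.
    apply: perm_trans (perm_catrev_wedges _ _ _) _.
    by rewrite perm_catC perm_cat2r.
  have W0 := edge_weight_ge0 iw0 kap0 (wedges x p ++ wedges z q).
  have Wh0 := edge_weight_ge0 iw0 kap0 h.
  case: (boolP (bad [:: x] [::] x p)) => bp H1 H2.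
    apply: le_trans (ler_wpM2r rwq0 H1); rewrite mulrAC ler_wpM2r //.
    apply: le_trans H2; rewrite ler_peMr //; by case: ifP.
  apply: le_trans (ler_wpM2r rwq0 (le_trans _ H1)); last by rewrite mulr1.
  suff bq : bad l h z q by rewrite bq in H2.
  have {}hq : uedge z (head z q) \in h by rewrite (perm_mem hE).
  case/tupleP: q hq {H2 pq rwq0 W0} => y q /= hq; apply/orP; left.
  rewrite /bad_step; have := @clean_closed _ e esym x p pp lp bp (uedge z y).
  rewrite -!(permP hE); move: hq; rewrite -has_pred1 has_count.
  by case: (count_mem _ h) => [|[|j]] // _ [].
apply: (@le_trans _ _ (\sum_(z in l) rw [:: x] [::] x p * (G ^+ m.+1 * M%:R ^+ excess h z))).
  rewrite [leRHS]big_mkcond /=; apply: ler_sum => z _; case: ifP => zl.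
    apply: (@le_trans _ _ (\sum_(q : m.+1.-tuple 'I_N | path e z q)
      rw [:: x] [::] x p * (rw l h z q * M%:R ^+ excess (catrev (wedges z q) h) (last z q)))).
      rewrite big_mkcondr /=; apply: ler_sum => q pq.
      have rwq0 := run_weight_ge0 iw0 kap0 gam1 l h z q.
      case: ifP => hq; last by rewrite !mulr_ge0 ?exprn_ge0.
      apply: le_trans (key z q pq hq) _; rewrite ler_wpM2l // ler_peMr //.
      by rewrite exprn_ege1.
    rewrite -mulr_sumr ler_wpM2l //.
    apply: run_bound => //; by rewrite sl.
  rewrite big1 // => q /andP[_ hq].
  move: hq; rewrite -(perm_mem hE) uedgeC => /cov; by rewrite zl.
apply: (@le_trans _ _ (\sum_(z in l) rw [:: x] [::] x p * (G ^+ m.+1 * (E * M%:R)))).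
  apply: ler_sum => z _; rewrite ler_wpM2l // ler_wpM2l ?exprn_ge0 //.
  by rewrite /E lp -exprSr ler_weXn2l // -addn1 excess_jump.
rewrite sumr_const -[_ *+ #|_|]mulr_natl.
have cl : (#|l|%:R : R) <= M%:R.
  by rewrite ler_nat (leq_trans (card_size _)) // sl (leq_trans _ nM) // leq_addr.
apply: (@le_trans _ _ (M%:R * (rw [:: x] [::] x p * (G ^+ m.+1 * (E * M%:R))))).
  by rewrite ler_wpM2r // !mulr_ge0 ?exprn_ge0 // (le_trans ler01).
by rewrite le_eqVlt; apply/orP; left; apply/eqP; ring.
Qed.

End Sums.

(** * Closed walks as cyclic words *)

Section Rotation.
Variables (N : nat) (e : rel 'I_N).

Lemma drop_zip (S T : Type) i (s : seq S) (t : seq T) :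
  zip (drop i s) (drop i t) = drop i (zip s t).
Proof.
by elim: i s t => [|i IH] [|x s] [|y t] //=; [case: (drop i t)|case: (drop i s)].
Qed.

Lemma take_zip (S T : Type) i (s : seq S) (t : seq T) :
  zip (take i s) (take i t) = take i (zip s t).
Proof. by elim: i s t => [|i IH] [|x s] [|y t] //=; rewrite IH. Qed.

Lemma zip_rot (S T : Type) i (s : seq S) (t : seq T) : size s = size t ->
  zip (rot i s) (rot i t) = rot i (zip s t).
Proof.
by move=> st; rewrite /rot zip_cat ?size_drop ?st // drop_zip take_zip.
Qed.

(** The edges of the closed walk through c, including the one from the last vertex
    to the first, which makes rotations visible. *)
Definition cycle_edges (c : seq 'I_N) := [seq uedge a.1 a.2 | a <- zip c (rot 1 c)].

Lemma cycle_edges_rot i c : cycle_edges (rot i c) = rot i (cycle_edges c).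
Proof. by rewrite /cycle_edges rot_rot zip_rot ?size_rot // map_rot. Qed.

Lemma wedgesE (u : 'I_N) s : wedges u s = [seq uedge a.1 a.2 | a <- zip (belast u s) s].
Proof. by elim: s u => //= y s IH u; rewrite IH. Qed.

Lemma cycle_edgesE (z : 'I_N) s : cycle_edges (z :: s) = wedges z (rot 1 (z :: s)).
Proof. by rewrite wedgesE /cycle_edges rot1_cons belast_rcons. Qed.

(** A closed walk from z is determined by the list q of its later vertices, which
    ends with z; rotating q puts z in front. *)
Lemma sum_closed (A : nmodType) m (G : 'I_N -> seq 'I_N -> A) :
  \sum_z \sum_(q : m.+1.-tuple 'I_N | path e z q && (last z q == z)) G z q
  = \sum_(c : m.+1.-tuple 'I_N | cycle e c) G (thead c) (rot 1 c).
Proof.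
under eq_bigr do rewrite big_mkcond /=.
rewrite exchange_big /= (reindex (fun c : m.+1.-tuple 'I_N => [tuple of rot 1 c])) /=; last first.
  exists (fun c : m.+1.-tuple 'I_N => [tuple of rotr 1 c]) => c _; apply: val_inj => /=.
    exact: rotK.
  exact: rotrK.
rewrite [RHS]big_mkcond /=; apply: eq_bigr => c _.
case/tupleP: c => x c /=; rewrite theadE rot1_cons.
under eq_bigr do rewrite last_rcons.
rewrite (bigD1 x) //= eqxx andbT big1 ?addr0 // => z /negbTE zx.
by rewrite eq_sym zx andbF.
Qed.

(** A cyclic word that meets h can be rotated so that it does so with its first
    edge, and there are m + 1 rotations. *)
Lemma sum_meeting_cycles (R : numDomainType) m (h : seq ('I_N * 'I_N))
    (F : seq ('I_N * 'I_N) -> R) :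
  (forall s, 0 <= F s) -> (forall s t, perm_eq s t -> F s = F t) ->
  \sum_(c : m.+1.-tuple 'I_N | cycle e c && has (mem h) (cycle_edges c)) F (cycle_edges c)
  <= m.+1%:R * \sum_(c : m.+1.-tuple 'I_N | cycle e c && has (mem h) (take 1 (cycle_edges c)))
                 F (cycle_edges c).
Proof.
move=> F0 Fp.
pose S := \sum_(c : m.+1.-tuple 'I_N | cycle e c && has (mem h) (take 1 (cycle_edges c)))
  F (cycle_edges c).
rewrite -/S; have -> : m.+1%:R * S = \sum_(i < m.+1) S by rewrite sumr_const card_ord mulr_natl.
have rotS i : S = \sum_(c : m.+1.-tuple 'I_N | cycle e c &&
    has (mem h) (take 1 (rot i (cycle_edges c)))) F (cycle_edges c).
  rewrite /S (reindex (fun c : m.+1.-tuple 'I_N => [tuple of rot i c])) /=; last first.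
    exists (fun c : m.+1.-tuple 'I_N => [tuple of rotr i c]) => c _; apply: val_inj => /=.
      exact: rotK.
    exact: rotrK.
  apply: eq_big => c; first by rewrite rot_cycle cycle_edges_rot.
  by move=> _; rewrite cycle_edges_rot; apply: Fp; rewrite perm_rot.
rewrite (eq_bigr _ (fun (i : 'I_m.+1) _ => rotS i)).
under [leRHS]eq_bigr do rewrite big_mkcond.
rewrite exchange_big /= [leLHS]big_mkcond; apply: ler_sum => c _.
case: ifP => [/andP[cc hc]|_]; last by apply: sumr_ge0 => i _; case: ifP.
have sz : size (cycle_edges c) = m.+1.
  by rewrite size_map size_zip size_rot size_tuple minnn.
set E := cycle_edges c in hc sz *.
have ih : (find (mem h) E < m.+1)%N by rewrite -sz -has_find.
rewrite (bigD1 (Ordinal ih)) //= cc /=.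
have -> : has (mem h) (take 1 (rot (find (mem h) E) E)).
  have /hasP[f0 _ _] := hc.
  by rewrite /rot (drop_nth f0) ?sz //= take0 /= orbF; exact: (@nth_find _ f0 (mem h)).
rewrite lerDl; apply: sumr_ge0 => i _; by case: ifP.
Qed.

End Rotation.

(** * Independence and expectations of bounded functions *)

Definition bounded_measurable d (T : measurableType d) (R : realType) (f : T -> R) : Prop :=
  measurable_fun [set: T] f /\ exists C : R, forall x, `|f x| <= C.

Section BoundedMeasurable.
Variables (d : measure_display) (T : measurableType d) (R : realType).
Implicit Types f g : T -> R.

Lemma bmeas_cst c : bounded_measurable (cst c : T -> R).
Proof. by split; [exact: measurable_cst|exists `|c|]. Qed.

Lemma bmeasD f g : bounded_measurable f -> bounded_measurable g -> bounded_measurable (fun x => f x + g x).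
Proof.
move=> [mf [C fC]] [mg [D gD]]; split; first exact: measurable_funD.
by exists (C + D) => x; rewrite (le_trans (ler_normD _ _)) // lerD.
Qed.

Lemma bmeasM f g : bounded_measurable f -> bounded_measurable g -> bounded_measurable (fun x => f x * g x).
Proof.
move=> [mf [C fC]] [mg [D gD]]; split; first exact: measurable_funM.
by exists (C * D) => x; rewrite normrM ler_pM.
Qed.

Lemma bmeasN f : bounded_measurable f -> bounded_measurable (fun x => - f x).
Proof.
move=> bf; have -> : (fun x => - f x) = (fun x => cst (-1) x * f x).
  by apply/funext => x; rewrite mulN1r.
exact: bmeasM (bmeas_cst _) bf.
Qed.

Lemma bmeasB f g : bounded_measurable f -> bounded_measurable g -> bounded_measurable (fun x => f x - g x).
Proof. by move=> bf bg; exact: bmeasD bf (bmeasN bg). Qed.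

Lemma bmeasX f n : bounded_measurable f -> bounded_measurable (fun x => f x ^+ n).
Proof.
move=> bf; elim: n => [|n IH]; first exact: bmeas_cst.
rewrite (_ : (fun x => _) = (fun x => f x * f x ^+ n)); first exact: bmeasM.
by apply/funext => x; rewrite exprS.
Qed.

Lemma bmeas_norm f : bounded_measurable f -> bounded_measurable (fun x => `|f x|).
Proof.
move=> [mf [C fC]]; split; first exact: measurableT_comp.
by exists C => x; rewrite normr_id.
Qed.

Lemma bmeas_sum I (s : seq I) (Q : pred I) (F : I -> T -> R) :
  (forall i, bounded_measurable (F i)) -> bounded_measurable (fun x => \sum_(i <- s | Q i) F i x).
Proof.
move=> bF; elim: s => [|i s IH].
  by under eq_fun do rewrite big_nil; exact: bmeas_cst.
under eq_fun do rewrite big_cons.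
by case: (Q i) => //; exact: bmeasD.
Qed.

Lemma bmeas_prod I (s : seq I) (Q : pred I) (F : I -> T -> R) :
  (forall i, bounded_measurable (F i)) -> bounded_measurable (fun x => \prod_(i <- s | Q i) F i x).
Proof.
move=> bF; elim: s => [|i s IH].
  by under eq_fun do rewrite big_nil; exact: bmeas_cst.
under eq_fun do rewrite big_cons.
by case: (Q i) => //; exact: bmeasM.
Qed.

Lemma bmeas_indic (B : set T) : measurable B -> bounded_measurable (\1_B : T -> R).
Proof.
move=> mB; split; first exact: measurable_indic.
by exists 1 => x; rewrite indicE; case: (_ \in _); rewrite ?normr1 ?normr0.
Qed.

End BoundedMeasurable.

Lemma bmeas_comp d d' (T : measurableType d) (U : measurableType d') (R : realType)
  (Y : T -> U) (f : U -> R) : measurable_fun [set: T] Y -> bounded_measurable f -> bounded_measurable (f \o Y).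
Proof.
move=> mY [mf [C fC]]; split; first exact: measurableT_comp.
by exists C => x /=.
Qed.

Section BoundedExpectation.
Variables (d : measure_display) (T : measurableType d) (R : realType).
Variable P : probability T R.
Implicit Types f g : T -> R.
Local Notation "''Ex' f" := (Rintegral P setT f) (at level 10, f at level 8).

Lemma bmeas_integrable f : bounded_measurable f -> P.-integrable [set: T] (EFin \o f).
Proof.
move=> [mf [C fC]]; apply: measurable_bounded_integrable => //.
  by apply: le_lt_trans (probability_le1 P measurableT) _; exact: ltry.
exists C; split; first by rewrite num_real.
by move=> M CM x _ /=; rewrite (le_trans (fC x)) // ltW.
Qed.

Lemma ExD f g : bounded_measurable f -> bounded_measurable g -> 'Ex (fun x => f x + g x) = 'Ex f + 'Ex g.
Proof. by move=> bf bg; rewrite RintegralD //; exact: bmeas_integrable. Qed.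

Lemma ExB f g : bounded_measurable f -> bounded_measurable g -> 'Ex (fun x => f x - g x) = 'Ex f - 'Ex g.
Proof. by move=> bf bg; rewrite RintegralB //; exact: bmeas_integrable. Qed.

Lemma ExZ f c : bounded_measurable f -> 'Ex (fun x => c * f x) = c * 'Ex f.
Proof. by move=> bf; rewrite RintegralZl //; exact: bmeas_integrable. Qed.

Lemma Ex_cst c : 'Ex (fun=> c) = c.
Proof. rewrite Rintegral_cst // (_ : fine _ = 1) ?mulr1 // -[RHS]/(fine 1%E).
by congr fine; exact: probability_setT. Qed.

Lemma Ex_le f g : bounded_measurable f -> bounded_measurable g -> (forall x, f x <= g x) -> 'Ex f <= 'Ex g.
Proof. by move=> bf bg fg; apply: le_Rintegral => //; exact: bmeas_integrable. Qed.

Lemma Ex_ge0 f : (forall x, 0 <= f x) -> 0 <= 'Ex f.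
Proof. by move=> f0; apply: Rintegral_ge0. Qed.

Lemma Ex_normr f : bounded_measurable f -> `|'Ex f| <= 'Ex (fun x => `|f x|).
Proof. by move=> bf; apply: le_normr_Rintegral => //; exact: bmeas_integrable. Qed.

Lemma Ex_sum I (s : seq I) (Q : pred I) (F : I -> T -> R) :
  (forall i, bounded_measurable (F i)) ->
  'Ex (fun x => \sum_(i <- s | Q i) F i x) = \sum_(i <- s | Q i) 'Ex (F i).
Proof.
move=> bF; elim: s => [|i s IH].
  by under eq_fun do rewrite big_nil; rewrite Ex_cst big_nil.
under eq_fun do rewrite big_cons.
rewrite big_cons; case: (Q i) => //; rewrite ExD ?IH //.
exact: bmeas_sum.
Qed.

Lemma Ex_indic (B : set T) : measurable B -> 'Ex (\1_B) = fine (P B).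
Proof. by move=> mB; rewrite /Rintegral integral_indic // setIT. Qed.

Lemma staircase (y : R) (K : nat) : 0 <= y <= K.+1%:R ->
  \sum_(k < K) (k.+1%:R <= y)%R%:R <= y <= \sum_(k < K) (k.+1%:R <= y)%R%:R + 1.
Proof.
elim: K => [|K IH] /andP[y0 yK]; first by rewrite big_ord0 add0r y0.
rewrite big_ord_recr /=; case: (lerP y K.+1%:R) => yK1.
  have := IH; rewrite y0 yK1 => /(_ isT) /andP[H1 H2].
  case: (lerP K.+1%:R y) => Ky /=; last by rewrite addr0 H1.
  have -> : y = K.+1%:R by apply/eqP; rewrite eq_le yK1.
  have -> : \sum_(k < K) (k.+1%:R <= K.+1%:R :> R)%R%:R = K%:R :> R.
    under eq_bigr => k _ do rewrite ler_nat ltnS (ltnW (ltn_ord k)).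
    by rewrite sumr_const card_ord.
  by rewrite !natr1 lexx ler_nat leqnSn.
rewrite (ltW yK1).
have -> : \sum_(k < K) (k.+1%:R <= y)%R%:R = K%:R :> R.
  rewrite (eq_bigr (fun=> 1)) ?sumr_const ?card_ord // => k _.
  by rewrite (le_trans _ (ltW yK1)) // ler_nat ltnS ltnW.
by rewrite !natr1 (ltW yK1).
Qed.

(** The identity is linear in f and holds for indicators, hence for step functions,
    and a bounded function is a uniform limit of these. *)
Lemma Ex_factor_indic d' (U : measurableType d') (Y : T -> U) (h : T -> R) (c : R) :
  measurable_fun [set: T] Y -> bounded_measurable h ->
  (forall B : set U, measurable B ->
     'Ex (fun x => \1_B (Y x) * h x) = 'Ex (fun x => \1_B (Y x)) * c) ->
  forall f : U -> R, bounded_measurable f ->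
     'Ex (fun x => f (Y x) * h x) = 'Ex (fun x => f (Y x)) * c.
Proof.
move=> mY bh HB.
have bY (f : U -> R) : bounded_measurable f -> bounded_measurable (fun x => f (Y x)).
  by move=> bf; exact: bmeas_comp mY bf.
have Eh : 'Ex h = c.
  have := HB setT measurableT; rewrite indicT.
  by under eq_fun do rewrite mul1r; rewrite Ex_cst mul1r.
have pos (f : U -> R) : bounded_measurable f -> (forall x, 0 <= f x) ->
    'Ex (fun x => f (Y x) * h x) = 'Ex (fun x => f (Y x)) * c.
  move=> bf f0; have [mf [C fC]] := bf.
  have C0 x : f x <= C by apply: le_trans (fC x); rewrite ler_norm.
  pose D := 'Ex (fun x => `|h x|) + `|c|.
  have D0 : 0 <= D by rewrite addr_ge0 // Ex_ge0.
  suff H n : `|'Ex (fun x => f (Y x) * h x) - 'Ex (fun x => f (Y x)) * c| <= D / n.+1%:R.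
    apply/eqP; rewrite -subr_eq0 -normr_le0; apply/ler_addgt0Pr => e e0.
    rewrite add0r; apply: le_trans (H (Num.truncn (D / e))) _.
    rewrite ler_pdivrMr ?ltr0n // mulrC -ler_pdivrMr //.
    by apply: ltW; rewrite truncnS_gt.
  (* The step function with jumps 1 / (n + 1) below f, of at most K steps. *)
  pose K := Num.truncn (n.+1%:R * C).
  pose B k := [set x | k.+1%:R <= n.+1%:R * f x].
  have mB k : measurable (B k).
    rewrite /B -[X in measurable X]setTI; apply: measurable_fun_le => //.
    by apply: measurable_funM.
  pose fn (x : U) : R := n.+1%:R^-1 * \sum_(k < K) \1_(B k) x.
  have bfn : bounded_measurable fn.
    apply: bmeasM; first exact: bmeas_cst.
    by apply: bmeas_sum => k; exact: bmeas_indic.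
  have iB k x : \1_(B k) x = (k.+1%:R <= n.+1%:R * f x)%R%:R :> R.
    rewrite indicE; congr (_%:R); congr nat_of_bool.
    by apply/idP/idP; rewrite inE.
  have apx x : `|f x - fn x| <= n.+1%:R^-1.
    have : 0 <= n.+1%:R * f x <= K.+1%:R.
      rewrite mulr_ge0 //= ltW // (le_lt_trans _ (truncnS_gt _)) //.
      by rewrite ler_wpM2l.
    move=> /staircase; rewrite /fn.
    rewrite -(eq_bigr _ (fun k _ => iB (nat_of_ord k) x)).
    set S := \sum_(k < K) _ => /andP[S1 S2].
    have n0 : 0 < n.+1%:R :> R by rewrite ltr0n.
    rewrite -(ler_pM2l n0) -{1}(ger0_norm (ltW n0)) -normrM mulrBr mulVKf ?gt_eqF //.
    rewrite mulfV ?gt_eqF //.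
    by rewrite ger0_norm ?subr_ge0 // lerBlDl.
  have Efn : 'Ex (fun x => fn (Y x) * h x) = 'Ex (fun x => fn (Y x)) * c.
    have -> : (fun x => fn (Y x) * h x) =
      (fun x => n.+1%:R^-1 * \sum_(k < K) (\1_(B k) (Y x) * h x)).
      by apply/funext => x; rewrite /fn -mulrA mulr_suml.
    rewrite ExZ; last first.
      by apply: bmeas_sum => k; apply: bmeasM bh; apply: bY; exact: bmeas_indic.
    rewrite Ex_sum; last by move=> k; apply: bmeasM bh; apply: bY; exact: bmeas_indic.
    rewrite (eq_bigr _ (fun (k : 'I_K) _ => HB _ (mB k))) -mulr_suml mulrA; congr (_ * c).
    rewrite -Ex_sum; last by move=> k; apply: bY; exact: bmeas_indic.
    rewrite -ExZ //.
    by apply: bmeas_sum => k; apply: bY; exact: bmeas_indic.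
  have bfh := bmeasM (bY _ bf) bh; have bfnh := bmeasM (bY _ bfn) bh.
  have -> : 'Ex (fun x => f (Y x) * h x) - 'Ex (fun x => f (Y x)) * c =
     'Ex (fun x => (f (Y x) - fn (Y x)) * h x) - 'Ex (fun x => f (Y x) - fn (Y x)) * c.
    rewrite (ExB (bY _ bf) (bY _ bfn)).
    have -> : (fun x => (f (Y x) - fn (Y x)) * h x) = (fun x => f (Y x) * h x - fn (Y x) * h x).
      by apply/funext => x; rewrite mulrBl.
    rewrite (ExB bfh bfnh) Efn; ring.
  have bd := bmeasB (bY _ bf) (bY _ bfn).
  apply: le_trans (ler_normB _ _) _; rewrite /D mulrDl lerD //.
    apply: le_trans (Ex_normr (bmeasM bd bh)) _.
    rewrite mulrC -ExZ; last exact: bmeas_norm.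
    apply: Ex_le; first by apply: bmeas_norm; exact: bmeasM.
      by apply: bmeasM; [exact: bmeas_cst|exact: bmeas_norm].
    by move=> x; rewrite normrM ler_wpM2r.
  rewrite normrM mulrC ler_wpM2l //.
  apply: le_trans (Ex_normr bd) _; rewrite -[leRHS]Ex_cst.
  apply: Ex_le => //; first exact: bmeas_norm.
  exact: bmeas_cst.
move=> f bf; have [mf [C fC]] := bf.
have := pos (fun x => f x + C) (bmeasD bf (bmeas_cst _ C)).
move=> /(_ _)/wrap[]; first by move=> x; rewrite -lerBlDr sub0r lerNl (le_trans _ (fC x)) // -normrN ler_norm.
under eq_fun do rewrite mulrDl.
have bch : bounded_measurable (fun x => C * h x) by apply: bmeasM bh; exact: bmeas_cst.
rewrite (ExD (bmeasM (bY _ bf) bh) bch) (ExZ _ bh) Eh.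
rewrite (ExD (bY _ bf) (bmeas_cst _ C)) Ex_cst mulrDl.
by move/addIr.
Qed.

(** The definition of independence is the case of indicators; they are replaced by
    general functions one index after the other. *)
Lemma Ex_prod_indep (I : finType) (A : {set I}) (Y : I -> {RV P >-> R}) :
  mutually_independent A Y ->
  forall f : I -> R -> R, (forall i, bounded_measurable (f i)) ->
  'Ex (fun x => \prod_(i in A) f i (Y i x)) = \prod_(i in A) 'Ex (fun x => f i (Y i x)).
Proof.
move=> indY.
have mY i : measurable_fun setT (Y i : T -> R) by exact: measurable_funPT.
have bY i (f : R -> R) : bounded_measurable f -> bounded_measurable (fun x => f (Y i x)).
  by move=> bf; exact: bmeas_comp (mY i) bf.
(* Induction on the set J of indices whose function may differ from an indicator. *)
suff H (J : {set I}) (f : I -> R -> R) : (forall i, bounded_measurable (f i)) ->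
   (forall i, i \in A -> i \notin J -> exists2 B, measurable B & f i = \1_B) ->
   'Ex (fun x => \prod_(i in A) f i (Y i x)) = \prod_(i in A) 'Ex (fun x => f i (Y i x)).
  by move=> f bf; apply: (H A) => // i ->.
have [n] := ubnP #|J|; elim: n J f => // n IH J f; rewrite ltnS => Jn bf Hind.
have bYf i : bounded_measurable (fun x => f i (Y i x)) by exact: bY.
case: (pickP [pred i in A :&: J]) => [i|noJ].
  rewrite !inE => /andP[iA iJ].
  have split_i (g : I -> R -> R) : (fun x => \prod_(j in A) g j (Y j x)) =
      (fun x => g i (Y i x) * \prod_(j in A | j != i) g j (Y j x)).
    by apply/funext => x; rewrite (bigD1 i).
  pose h x := \prod_(j in A | j != i) f j (Y j x).
  rewrite (bigD1 i) //= split_i.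
  apply: (@Ex_factor_indic _ _ (Y i) h) => //; first exact: bmeas_prod.
  move=> B mB; rewrite /h.
  pose g j := if j == i then \1_B : R -> R else f j.
  have gi : g i = \1_B by rewrite /g eqxx.
  have gj j : j != i -> g j = f j by rewrite /g => /negbTE ->.
  have := IH (J :\ i)%SET g.
  rewrite (bigD1 i) //= split_i gi.
  rewrite (eq_bigr (fun j => 'Ex (fun x => f j (Y j x)))); last first.
    by move=> j /andP[_ ji]; rewrite gj.
  rewrite (_ : (fun x => _ * \prod_(j in A | j != i) g j (Y j x)) =
     (fun x => \1_B (Y i x) * \prod_(j in A | j != i) f j (Y j x))); last first.
    by apply/funext => x; congr (_ * _); apply: eq_bigr => j /andP[_ ji]; rewrite gj.
  apply.
  - by apply: leq_trans Jn; rewrite [in ltnRHS](cardsD1 i) iJ.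
  - by move=> j; rewrite /g; case: eqP => // _; exact: bmeas_indic.
  - move=> j jA; rewrite !inE negb_and negbK /g; case: eqP => [_ _|_ /= jJ]; first by exists B.
    exact: Hind.
pose B i := f i @^-1` [set 1].
have mB i : measurable (B i).
  by rewrite -[B i]setTI; case: (bf i) => mf _; exact: mf.
have fB i : i \in A -> f i = \1_(B i).
  move=> iA; have [|C mC fC] := Hind i iA.
    by have := noJ i; rewrite !inE iA /= => ->.
  rewrite /B fC; congr (\1_ _); apply/seteqP; split => x /=; rewrite indicE.
    by move=> /mem_set ->.
  by case: (boolP (x \in C)) => [/set_mem//|_ /eqP]; rewrite eq_sym oner_eq0.
have mYB i : measurable (Y i @^-1` B i) by rewrite -[X in measurable X]setTI; exact: mY.
have EB i : i \in A -> 'Ex (fun x => f i (Y i x)) = fine (P (Y i @^-1` B i)).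
  move=> iA; rewrite -Ex_indic // fB //.
rewrite (eq_bigr _ EB).
have mI : measurable (\bigcap_(i in [set` A]) (Y i @^-1` B i)).
  by apply: fin_bigcap_measurable => //; exact: finite_finset.
have -> : (fun x => \prod_(i in A) f i (Y i x)) = \1_(\bigcap_(i in [set` A]) (Y i @^-1` B i)).
  apply/funext => x; rewrite indicE.
  rewrite (eq_bigr (fun i => (x \in Y i @^-1` B i)%:R)); last by move=> i iA; rewrite fB.
  have [xI|xI] := boolP (x \in _).
    rewrite big1 // => i iA; rewrite mem_set //; move/set_mem: xI; exact.
  apply/eqP/prodf_eq0; apply: contrapT => nex; move/negP: xI; apply.
  apply/mem_set => i /= iA; apply: contrapT => nxi; apply: nex; exists i => //.
  by rewrite memNset.
rewrite Ex_indic // (indY A (subxx A) B mB).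
rewrite (eq_bigr (fun i => (fine (P (Y i @^-1` B i)))%:E)) ?prodEFin // => i _.
by rewrite fineK // fin_num_measure.
Qed.


End BoundedExpectation.

(** * Mean and variance of the trace of a power *)

Section TraceMoments.
Variables (d : measure_display) (T : measurableType d) (R : realType).
Variable P : probability T R.
Variables (N : nat) (e : rel 'I_N) (Z : 'I_N * 'I_N -> T -> R).
Variables (mom : nat -> R) (iw kap : R) (M : nat).
Local Notation "''Ex' f" := (Rintegral P setT f) (at level 10, f at level 8).

Definition band_mx (t : T) : 'M[R]_N :=
  \matrix_(i, j) if e i j then Z (uedge i j) t else 0.

(** The expectation of the product of independent, identically distributed entries
    along the edges h, in terms of their common moments. *)
Definition mom_prod (h : seq ('I_N * 'I_N)) : R := \prod_f mom (count_mem f h).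

Definition ordered_edge (k : 'I_N * 'I_N) := (k.1 <= k.2)%N.

Hypothesis esym : symmetric e.
Hypothesis Zb : forall f, bounded_measurable (Z f).
Hypothesis Zprod : forall h, all ordered_edge h ->
  'Ex (fun t => \prod_(f <- h) Z f t) = mom_prod h.
Hypothesis mom_le : forall m, `|mom m| <= mult_weight iw kap m.
Hypotheses (iw0 : 0 <= iw) (kap0 : 0 <= kap).
Hypothesis edeg : forall u, #|[pred y | e u y]|%:R * iw <= 1.

Local Notation W := (edge_weight iw kap).

Lemma uedge_ordered (i j : 'I_N) : ordered_edge (uedge i j).
Proof. by rewrite /uedge; case: ifP => ij; rewrite /ordered_edge //=; lia. Qed.

Lemma wedges_ordered x p : all ordered_edge (wedges x p).
Proof. by elim: p x => //= y p IH x; rewrite uedge_ordered IH. Qed.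

Lemma pow_walks n t x z : (band_mx t ^+ n) x z =
  \sum_(p : n.-tuple 'I_N | path e x p && (last x p == z)) \prod_(f <- wedges x p) Z f t.
Proof.
elim: n x => [|n IH] x.
  rewrite expr0 mxE big_mkcond /= (sum_tuple0 (fun p => if path e x p && (last x p == z)
     then \prod_(f <- wedges x p) Z f t else 0)) /= big_nil.
  by case: (x == z).
rewrite exprS mxE [RHS]big_mkcond /= (sum_tupleS _ (fun p => if path e x p && (last x p == z)
     then \prod_(f <- wedges x p) Z f t else 0)) /=.
apply: eq_bigr => y _; rewrite mxE IH; case: (e x y) => /=; last by rewrite mul0r big1.
rewrite mulr_sumr big_mkcond /=; apply: eq_bigr => p _.
by case: ifP => // _; rewrite big_cons.
Qed.

Lemma trace_walks n t : \tr (band_mx t ^+ n) =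
  \sum_x \sum_(p : n.-tuple 'I_N | path e x p && (last x p == x)) \prod_(f <- wedges x p) Z f t.
Proof. by apply: eq_bigr => x _; rewrite pow_walks. Qed.

Lemma bmeas_trace n : bounded_measurable (fun t => \tr (band_mx t ^+ n)).
Proof.
rewrite (_ : (fun t => _) = fun t => \sum_x \sum_(p : n.-tuple 'I_N |
   path e x p && (last x p == x)) \prod_(f <- wedges x p) Z f t).
  by apply: bmeas_sum => x; apply: bmeas_sum => p; exact: bmeas_prod.
by apply/funext => t; rewrite trace_walks.
Qed.

Lemma mom_prod_le h : `|mom_prod h| <= W h.
Proof.
rewrite /mom_prod normr_prod; apply: ler_prod => f _.
by rewrite normr_ge0 mom_le.
Qed.

Lemma Ex_trace n : 'Ex (fun t => \tr (band_mx t ^+ n)) =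
  \sum_x \sum_(p : n.-tuple 'I_N | path e x p && (last x p == x)) mom_prod (wedges x p).
Proof.
under eq_fun do rewrite trace_walks.
rewrite Ex_sum; last by move=> x; apply: bmeas_sum => p; exact: bmeas_prod.
apply: eq_bigr => x _; rewrite Ex_sum; last by move=> p; exact: bmeas_prod.
by apply: eq_bigr => p _; rewrite Zprod // wedges_ordered.
Qed.

Lemma Ex_trace_le n : (n < M)%N ->
  'Ex (fun t => \tr (band_mx t ^+ n)) <= N%:R * growth iw kap 1 M ^+ n.
Proof.
move=> nM; rewrite Ex_trace.
have M0 : (0 < M)%N by lia.
apply: le_trans (walk_sum iw0 kap0 (lexx 1) M0 edeg nM).
apply: ler_sum => x _; rewrite big_mkcondr /=; apply: ler_sum => p pp.
have W0 := edge_weight_ge0 iw0 kap0 (wedges x p).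
rewrite if_same mulr1; case: ifP => // _.
exact: le_trans (ler_norm _) (mom_prod_le _).
Qed.

Lemma sum_count_mem (E : finType) (h : seq E) : (\sum_f count_mem f h = size h)%N.
Proof.
elim: h => [|g h IH] /=; first by rewrite big1.
by rewrite big_split /= IH (bigD1 g) //= eqxx big1 // => f; rewrite eq_sym => /negbTE ->.
Qed.

Lemma mom_prod_doubled (h : seq ('I_N * 'I_N)) k : mom 0 = 1 -> size h = k.*2 ->
  (forall f, count_mem f h != 1%N /\ (count_mem f h <= 2)%N) -> mom_prod h = mom 2 ^+ k.
Proof.
move=> m0 sh ch.
have E f : mom (count_mem f h) = mom 2 ^+ (count_mem f h)./2.
  by have [] := ch f; case: (count_mem f h) => [|[|[|]]] //.
rewrite /mom_prod (eq_bigr _ (fun f _ => E f)) prodrXr; congr (_ ^+ _).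
apply: double_inj; rewrite -sh -sum_count_mem -!mul2n big_distrr /=.
apply: eq_bigr => f _; rewrite mul2n.
by have [] := ch f; case: (count_mem f h) => [|[|[|]]] //.
Qed.

Lemma size_wedges (x : 'I_N) p : size (wedges x p) = size p.
Proof. by elim: p x => //= y p IH x; rewrite IH. Qed.

(** Closed walks without bad steps contribute the k-th power of the second moment
    each.  All others carry a factor gam in [walk_sum]. *)
Lemma Ex_trace_ge k gam : mom 0 = 1 -> 1 <= gam -> (k.*2 < M)%N ->
  (\sum_x clean_closings e k.*2 [:: x] [::] x x)%N%:R * mom 2 ^+ k
    - N%:R * growth iw kap gam M ^+ k.*2 / gam
  <= 'Ex (fun t => \tr (band_mx t ^+ k.*2)).
Proof.
move=> m0 g1 nM; rewrite Ex_trace lerBlDr.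
have M0 : (0 < M)%N by lia.
have g0 : 0 < gam by exact: lt_le_trans g1.
have := walk_sum iw0 kap0 g1 M0 edeg nM.
rewrite -(ler_pM2r (_ : 0 < gam^-1)) ?invr_gt0 // => WS.
apply: le_trans (lerD (lexx _) WS).
rewrite natr_sum !mulr_suml -big_split /=; apply: ler_sum => x _.
rewrite /clean_closings natr_sum !mulr_suml [in leRHS]big_mkcondr /= -big_split /=.
rewrite big_mkcond [leRHS]big_mkcond /=.
rewrite [leRHS]big_mkcond; apply: ler_sum => p _.
have W0 := edge_weight_ge0 iw0 kap0 (wedges x p).
case: (boolP (path e x p)) => pp /=; last by rewrite mul0r.
have mW := mom_prod_le (wedges x p).
case: (boolP (bad _ _ _ _)) => bp /=.
  rewrite mul0r (mulfK (lt0r_neq0 g0)); case: (_ == x); last by rewrite add0r.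
  by move: mW; rewrite ler_norml => /andP[? _]; lra.
case: eqP => lp; last by rewrite mul0r add0r mulr1 divr_ge0 // ltW.
rewrite mul1r (mom_prod_doubled (k := k) m0 _ (clean_closed esym pp lp bp)) ?size_wedges ?size_tuple //.
by rewrite lerDl mulr1 divr_ge0 // ltW.
Qed.

Hypotheses (kap1 : kap <= 1) (iw_le_kap2 : iw <= kap ^+ 2).

(** The product has one more factor iw and lacks at most two factors kap, and
    iw <= kap^2. *)
Lemma mult_weightM a b :
  mult_weight iw kap a * mult_weight iw kap b <= mult_weight iw kap (a + b).
Proof.
case: a => [|a]; first by rewrite mul1r.
case: b => [|b]; first by rewrite addn0 mulr1.
rewrite addSn /= addnS /=.
apply: (@le_trans _ _ (iw * kap ^+ (2 + a.-1 + b.-1))).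
  rewrite -addnA exprD.
  have -> : iw * kap ^+ a.-1 * (iw * kap ^+ b.-1) = iw * (iw * kap ^+ (a.-1 + b.-1)).
    by rewrite exprD; ring.
  by rewrite ler_wpM2l // ler_wpM2r // exprn_ge0.
by rewrite ler_wpM2l // ler_wiXn2l //; lia.
Qed.

Lemma edge_weightM (h h' : seq ('I_N * 'I_N)) : W h * W h' <= W (h ++ h').
Proof.
rewrite /edge_weight -big_split /=; apply: ler_prod => f _.
by rewrite mulr_ge0 ?mult_weight_ge0 //= count_cat mult_weightM.
Qed.

(** Products along disjoint sets of edges are independent. *)
Lemma cov_le h h' : mom 0 = 1 ->
  mom_prod (h ++ h') - mom_prod h * mom_prod h' <= (has (mem h) h')%:R * (2 * W (h ++ h')).
Proof.
move=> m0; case: (boolP (has _ _)) => [_|/hasPn nh].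
  rewrite mul1r mulr2n mulrDl mul1r; apply: le_trans (ler_norm _) _.
  apply: le_trans (ler_normB _ _) _; apply: lerD; first exact: mom_prod_le.
  rewrite normrM; apply: le_trans (edge_weightM _ _).
  by apply: ler_pM => //; exact: mom_prod_le.
rewrite mul0r subr_le0 le_eqVlt; apply/orP; left; apply/eqP.
rewrite /mom_prod -big_split /=; apply: eq_bigr => f _; rewrite count_cat.
have [c0|c0] := eqVneq (count_mem f h') 0%N; first by rewrite c0 addn0 m0 mulr1.
have fh' : f \in h' by rewrite -has_pred1 has_count lt0n.
have -> : count_mem f h = 0%N by apply/count_memPn; exact: nh.
by rewrite add0n m0 mul1r.
Qed.

(** Only pairs of closed walks with a common edge contribute.  The second walk is
    rotated, at the cost of a factor m + 1, until it starts with a common edge, so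
    that [pair_sum] applies. *)
Lemma variance_trace_le m gam : mom 0 = 1 -> 1 <= gam -> (m.+1.*2 < M)%N ->
  'Ex (fun t => (\tr (band_mx t ^+ m.+1) - 'Ex (fun t => \tr (band_mx t ^+ m.+1))) ^+ 2)
  <= 2 * m.+1%:R * (N%:R * (M%:R ^+ 2 * growth iw kap gam M ^+ (m.+1.*2))) / gam.
Proof.
move=> m0 g1 nM.
have M0 : (0 < M)%N by lia.
have g0 : 0 < gam by exact: lt_le_trans g1.
pose F t := \tr (band_mx t ^+ m.+1).
have bF : bounded_measurable F by exact: bmeas_trace.
set EF := 'Ex F.
have -> : 'Ex (fun t => (F t - EF) ^+ 2) = 'Ex (fun t => F t * F t) - EF * EF.
  rewrite (_ : (fun t => _) = (fun t => (F t * F t + (- (2 * EF)) * F t) + EF * EF)); last first.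
    by apply/funext => t /=; rewrite sqrrB; ring.
  have bFF := bmeasM bF bF.
  have bcF : bounded_measurable (fun t => - (2 * EF) * F t) by apply: bmeasM => //; exact: bmeas_cst.
  rewrite (ExD P (bmeasD bFF bcF) (bmeas_cst T (EF * EF))) (ExD P bFF bcF) (ExZ P _ bF).
  rewrite (Ex_cst P (EF * EF)) -/EF.
  ring.
have FE t : F t = \sum_(c : m.+1.-tuple 'I_N | cycle e c) \prod_(f <- cycle_edges c) Z f t.
  rewrite /F trace_walks (sum_closed e m (fun x q => \prod_(f <- wedges x q) Z f t)).
  by apply: eq_bigr => c _; case/tupleP: c => x c; rewrite theadE /= cycle_edgesE.
have ord_cyc (c : m.+1.-tuple 'I_N) : all ordered_edge (cycle_edges c).
  by case/tupleP: c => x c /=; rewrite cycle_edgesE wedges_ordered.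
have EFE : EF = \sum_(c : m.+1.-tuple 'I_N | cycle e c) mom_prod (cycle_edges c).
  rewrite /EF (_ : F = fun t => \sum_(c : m.+1.-tuple 'I_N | cycle e c) \prod_(f <- cycle_edges c) Z f t);
    last by apply/funext => t; exact: FE.
  rewrite Ex_sum; last by move=> c; exact: bmeas_prod.
  by apply: eq_bigr => c _; rewrite Zprod.
have EFF : 'Ex (fun t => F t * F t) = \sum_(c : m.+1.-tuple 'I_N | cycle e c)
  \sum_(c' : m.+1.-tuple 'I_N | cycle e c') mom_prod (cycle_edges c ++ cycle_edges c').
  rewrite (_ : (fun t => _) = (fun t => \sum_(c : m.+1.-tuple 'I_N | cycle e c)
     \sum_(c' : m.+1.-tuple 'I_N | cycle e c') \prod_(f <- cycle_edges c ++ cycle_edges c') Z f t)); last first.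
    apply/funext => t; rewrite !FE mulr_suml; apply: eq_bigr => c _.
    by rewrite mulr_sumr; apply: eq_bigr => c' _; rewrite big_cat.
  rewrite Ex_sum; last by move=> c; apply: bmeas_sum => c'; exact: bmeas_prod.
  apply: eq_bigr => c _; rewrite Ex_sum; last by move=> c'; exact: bmeas_prod.
  by apply: eq_bigr => c' _; rewrite Zprod // all_cat !ord_cyc.
rewrite EFF EFE mulr_suml -sumrB.
under eq_bigr do rewrite mulr_sumr -sumrB.
have nM' : (m.+2 + m.+1 <= M)%N by lia.
have PS := pair_sum esym iw0 kap0 g1 M0 edeg nM'.
rewrite addnn in PS.
rewrite -mulrA; apply: le_trans (ler_wpM2l _ (ler_wpM2r _ PS)); last 2 first.
- by rewrite mulr_ge0.
- by rewrite invr_ge0 ltW.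
rewrite (sum_closed e m (fun x p => \sum_z \sum_(q : m.+1.-tuple 'I_N |
      path e z q && (uedge z (head z q) \in wedges x p))
     W (wedges x p ++ wedges z q) * gam)).
rewrite mulr_suml mulr_sumr; apply: ler_sum => c cc.
apply: (@le_trans _ _ (2 * (m.+1%:R * \sum_(c' : m.+1.-tuple 'I_N | cycle e c' &&
    has (mem (cycle_edges c)) (take 1 (cycle_edges c'))) W (cycle_edges c ++ cycle_edges c')))).
  apply: le_trans (ler_wpM2l _ (sum_meeting_cycles e m (cycle_edges c) (F := fun s => W (cycle_edges c ++ s)) _ _)) => //.
  - rewrite mulr_sumr [leRHS]big_mkcondr /=; apply: ler_sum => c' _.
    apply: le_trans (cov_le _ _ m0) _.
    by case: ifP => _; rewrite ?mul1r ?mul0r.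
  - by move=> s; exact: edge_weight_ge0.
  - by move=> s s' ss; apply: perm_edge_weight; rewrite perm_cat2l.
rewrite mulrA ler_wpM2l ?mulr_ge0 //.
rewrite [leRHS]mulr_suml.
apply: (@le_trans _ _ (\sum_z \sum_(q : m.+1.-tuple 'I_N | path e z q && (last z q == z))
   (uedge z (head z q) \in cycle_edges c)%:R * W (cycle_edges c ++ wedges z q))).
  rewrite (sum_closed e m (fun z q => (uedge z (head z q) \in cycle_edges c)%:R *
     W (cycle_edges c ++ wedges z q))).
  rewrite [leLHS]big_mkcondr /=; apply: ler_sum => c' cc'.
  case/tupleP: c' cc' => z c' cc' /=; rewrite theadE cycle_edgesE.
  rewrite rot1_cons; case: (rcons c' z) => [|y s] /=; rewrite ?take0 /= ?orbF.
    by rewrite mulr_ge0 ?edge_weight_ge0.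
  by case: ifP => _; rewrite ?mul1r // mul0r.
apply: ler_sum => z _; rewrite mulr_suml.
rewrite [leLHS]big_mkcondr [leRHS]big_mkcondr /=; apply: ler_sum => q pq.
case/tupleP: c cc => x c cc; rewrite theadE -cycle_edgesE.
have W0 := edge_weight_ge0 iw0 kap0 (cycle_edges (x :: c) ++ wedges z q).
case: ifP => _; case: ifP => _; rewrite ?mul0r ?mul1r ?(mulfK (lt0r_neq0 g0)) //.
Qed.

End TraceMoments.

(** * Truncated entries *)

Section MeasurableOrder.
Variables (d : measure_display) (T : measurableType d) (R : realType) (f g : T -> R).
Hypotheses (mf : measurable_fun [set: T] f) (mg : measurable_fun [set: T] g).

Lemma measurable_set_lt : measurable [set x | f x < g x].
Proof.
have H := measurable_fun_ltr mf mg.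
have := H measurableT [set true] I; by rewrite setTI; congr measurable; apply/seteqP; split => x.
Qed.

Lemma measurable_set_le : measurable [set x | f x <= g x].
Proof.
have H := measurable_fun_ler mf mg.
have := H measurableT [set true] I; by rewrite setTI; congr measurable; apply/seteqP; split => x.
Qed.

End MeasurableOrder.

Definition trunc (R : realType) (K x : R) : R := if `|x| <= K then x else 0.

Section TruncatedMoments.
Variables (R : realType) (rho : probability R R) (v : R).
Hypothesis moments : forall k : nat, rho.-integrable [set: R] (fun x => (x ^+ k)%:E).
Hypothesis mean0 : 0 = \int[rho]_x x.
Hypothesis variance : v = (\int[rho]_x (x ^+ 2)).

Local Notation "''Ex' f" := (Rintegral rho setT f) (at level 10, f at level 8).

Definition trunc_moment (K : R) (m : nat) : R := 'Ex (fun x => trunc K x ^+ m).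
Definition moment (m : nat) : R := 'Ex (fun x => x ^+ m).

Lemma trunc_le (K x : R) : 0 <= K -> `|trunc K x| <= K.
Proof. by rewrite /trunc; case: ifP => // _ K0; rewrite normr0. Qed.

Lemma bmeas_trunc (K : R) : 0 <= K -> bounded_measurable (trunc K).
Proof.
move=> K0; split; last by exists K => x; exact: trunc_le.
apply: (measurable_fun_ifT (g := fun x : R => x) (h := cst 0)) => //.
apply: (measurable_fun_ler (g := cst K)); last exact: measurable_cst.
exact: normr_measurable.
Qed.

Lemma moment_ge0 m : 0 <= moment m.*2.
Proof. by apply: Rintegral_ge0 => x _; rewrite -mul2n exprM exprn_ge0 // sqr_ge0. Qed.

Lemma Ex_moment_le (f : R -> R) (c : R) m : bounded_measurable f -> 
  (forall x, f x <= c * x ^+ m) -> 'Ex f <= c * moment m.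
Proof.
move=> bf fc; rewrite /moment -RintegralZl //; last exact: moments.
apply: le_Rintegral => //; first exact: bmeas_integrable.
exact: (integrableZl measurableT (c) (moments m)).
Qed.

Lemma trunc_moment0 K : trunc_moment K 0 = 1.
Proof. by rewrite /trunc_moment (_ : (fun x => _) = cst 1) ?Ex_cst. Qed.

Lemma trunc_moment2_ge0 K : 0 <= trunc_moment K 2.
Proof. by apply: Ex_ge0 => x; rewrite sqr_ge0. Qed.

Lemma trunc_moment2_le K : 0 <= K -> trunc_moment K 2 <= v.
Proof.
move=> K0; rewrite variance -[leRHS]mul1r; apply: Ex_moment_le.
  by apply: bmeasX; exact: bmeas_trunc.
by move=> x; rewrite mul1r /trunc; case: ifP => // _; rewrite expr0n sqr_ge0.
Qed.

Lemma trunc_moment_le K m : 0 <= K ->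
  `|trunc_moment K m.+2| <= K ^+ m * trunc_moment K 2.
Proof.
move=> K0; have bt := bmeas_trunc K0.
apply: le_trans (Ex_normr rho (bmeasX _ bt)) _.
rewrite /trunc_moment -ExZ; last exact: bmeasX.
apply: Ex_le; [by apply: bmeas_norm; exact: bmeasX| |].
  by apply: bmeasM; [exact: bmeas_cst|exact: bmeasX].
move=> x; rewrite -addn2 exprD normrM normrX [`|_ ^+ 2|]ger0_norm ?sqr_ge0 //.
by rewrite ler_wpM2r ?sqr_ge0 // lerXn2r ?nnegrE // trunc_le.
Qed.

(** Beyond the cutoff, higher powers dominate lower ones with a gain of K^-m; all
    truncation errors are bounded in this way. *)
Lemma pow_tail (K x : R) m j : 0 < K -> K < `|x| -> 
  `|x| ^+ j <= K ^- m * `|x| ^+ (j + m).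
Proof.
move=> K0 Kx; have x0 : 0 < `|x| by exact: lt_trans Kx.
rewrite exprD mulrCA ler_peMr ?exprn_ge0 // -exprVn -exprMn exprn_ege1 //.
by rewrite mulrC ler_pdivlMr // mul1r ltW.
Qed.

Lemma moment2_sub_trunc K : 0 < K -> v - K ^- 2 * moment 4 <= trunc_moment K 2.
Proof.
move=> K0; have bt := bmeas_trunc (ltW K0).
rewrite lerBlDr variance.
have i1 := bmeas_integrable rho (bmeasX 2 bt).
have i2 : rho.-integrable setT (EFin \o (fun x => K ^- 2 * x ^+ 4)).
  exact: (integrableZl measurableT (K ^- 2) (moments 4)).
rewrite /trunc_moment /moment -RintegralZl //; last exact: moments.
rewrite -RintegralD //; apply: le_Rintegral => //; first exact: moments.
  exact: (integrableD measurableT i1 i2).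
have x4 (x : R) : x ^+ 4 = (x ^+ 2) ^+ 2 by rewrite -exprM.
move=> x _ /=; rewrite /trunc; case: ifP => [_|/negbT].
  by rewrite lerDl mulr_ge0 ?x4 ?sqr_ge0 // invr_ge0 sqr_ge0.
rewrite -ltNge => /(pow_tail 2 2 K0); rewrite expr0n add0r.
by rewrite -[(2 + 2)%N]/4%N !x4 !real_normK ?num_real.
Qed.

(** As the law is centred, the mean of the truncation is the negative of the mean
    of what has been cut off. *)
Lemma trunc_moment1_le K p : 0 < K ->
  `|trunc_moment K 1| <= K ^- p.*2.+1 * moment p.+1.*2.
Proof.
move=> K0; have bt := bmeas_trunc (ltW K0).
have i0 : rho.-integrable setT (EFin \o (fun x : R => x)).
  by have := moments 1; under eq_fun do rewrite expr1.
have i1 := bmeas_integrable rho (bmeasX 1 bt).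
have i2 : rho.-integrable setT (EFin \o (fun x => x - trunc K x ^+ 1)).
  exact: (integrableB measurableT i0 i1).
have -> : trunc_moment K 1 = - 'Ex (fun x => x - trunc K x ^+ 1).
  by rewrite RintegralB // -mean0 sub0r opprK.
rewrite normrN; apply: le_trans (le_normr_Rintegral _ i2) _ => //.
rewrite /moment -RintegralZl //; last exact: moments.
apply: le_Rintegral => //.
- have : rho.-integrable setT (EFin \o (fun x => `|x - trunc K x ^+ 1|)).
    by have := integrable_abse i2.
  by [].
- exact: (integrableZl measurableT (K ^- p.*2.+1) (moments p.+1.*2)).
move=> x _ /=; rewrite /trunc expr1; case: ifP => [_|/negbT].
  by rewrite subrr normr0 mulr_ge0 ?invr_ge0 ?(exprn_ge0 _ (ltW K0)) // -mul2n exprM exprn_ge0 // sqr_ge0.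
rewrite -ltNge => /(pow_tail p.*2.+1 1 K0); rewrite subr0 expr1 => /le_trans -> //.
have E (y : R) : y ^+ p.*2.+2 = (y ^+ 2) ^+ p.+1 by rewrite -doubleS -mul2n exprM.
by rewrite add1n ?doubleS !E real_normK ?num_real.
Qed.

Lemma tail_le K p : 0 < K -> 
  fine (rho [set x | K < `|x|]) <= K ^- p.*2 * moment p.*2.
Proof.
move=> K0; have mA : measurable [set x : R | K < `|x|].
  by apply: measurable_set_lt => //; exact: normr_measurable.
rewrite -Ex_indic //; apply: Ex_moment_le; first exact: bmeas_indic.
move=> x; rewrite indicE; case: (boolP (x \in _)) => [/set_mem /= Kx|_].
  by have := pow_tail p.*2 0 K0 Kx; rewrite expr0 add0n -mul2n !exprM real_normK ?num_real.
by rewrite mulr_ge0 ?invr_ge0 ?(exprn_ge0 _ (ltW K0)) // -mul2n exprM exprn_ge0 // sqr_ge0.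
Qed.

End TruncatedMoments.

Section TruncatedEnsemble.
Variables (d : measure_display) (T : measurableType d) (R : realType).
Variables (P : probability T R) (N : nat) (X : 'I_N -> 'I_N -> {RV P >-> R}).
Variable rho : probability R R.
Hypothesis indep : mutually_independent [set k : 'I_N * 'I_N | (k.1 <= k.2)%N]%SET
      (fun k => X k.1 k.2).
Hypothesis law : forall (i j : 'I_N) (A : set R), measurable A ->
    distribution P (X i j) A = rho A.
Variables (K a : R).
Hypothesis K0 : 0 <= K.

Definition trunc_entry (k : 'I_N * 'I_N) (t : T) : R := trunc K (X k.1 k.2 t) / a.

Definition scaled_trunc_moment m : R := trunc_moment rho K m / a ^+ m.

Lemma Ex_law (i j : 'I_N) (f : R -> R) : bounded_measurable f ->
  Rintegral P setT (fun t => f (X i j t)) = Rintegral rho setT f.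
Proof.
move=> bf; rewrite /Rintegral; congr fine.
have bfX : bounded_measurable (fun t => f (X i j t)) by apply: bmeas_comp bf; exact: measurable_funPT.
rewrite -(eq_measure_integral rho (m1 := distribution P (X i j))); last first.
  by move=> A mA _; exact: law.
rewrite integral_distribution //; first by apply/measurable_EFinP; case: bf.
exact: bmeas_integrable.
Qed.

Lemma bmeas_trunc_scaled m : bounded_measurable (fun x => (trunc K x / a) ^+ m).
Proof.
apply: bmeasX; apply: bmeasM; [exact: bmeas_trunc|exact: bmeas_cst].
Qed.

Lemma bmeas_trunc_entry f : bounded_measurable (trunc_entry f).
Proof.
have := bmeas_trunc_scaled 1; under eq_fun do rewrite expr1.
by move=> b1; apply: (bmeas_comp (measurable_funPT (X f.1 f.2)) b1).
Qed.

Lemma Ex_trunc_scaled m : 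
  Rintegral rho setT (fun x => (trunc K x / a) ^+ m) = scaled_trunc_moment m.
Proof.
rewrite /scaled_trunc_moment /trunc_moment mulrC -ExZ; last by apply: bmeasX; exact: bmeas_trunc.
by congr Rintegral; apply/funext => x; rewrite exprMn exprVn mulrC.
Qed.

(** Entries below the diagonal do not occur in h, so that the independent family
    on and above the diagonal suffices. *)
Lemma trunc_entry_prod h : all (@ordered_edge N) h ->
  Rintegral P setT (fun t => \prod_(f <- h) trunc_entry f t)
   = mom_prod scaled_trunc_moment h.
Proof.
move=> oh; set A := [set k : 'I_N * 'I_N | (k.1 <= k.2)%N]%SET.
rewrite (_ : (fun t => _) = (fun t => \prod_(f in A) (trunc K (X f.1 f.2 t) / a) ^+ count_mem f h)).
  rewrite (Ex_prod_indep indep (f := fun k x => (trunc K x / a) ^+ count_mem k h)); last first.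
    by move=> k; exact: bmeas_trunc_scaled.
  rewrite /mom_prod [RHS](bigID (mem A)) /= [X in _ = _ * X]big1 ?mulr1.
    apply: eq_bigr => f _; rewrite -Ex_trunc_scaled.
    exact: (Ex_law _ _ (bmeas_trunc_scaled _)).
  move=> f; rewrite inE => fA.
  rewrite (_ : count_mem f h = 0%N); last by apply/count_memPn; apply: contra fA => /(allP oh).
  by rewrite /scaled_trunc_moment trunc_moment0 expr0 divr1.
apply/funext => t; elim: h oh => [|g h IH] /=.
  by move=> _; rewrite big_nil big1.
move=> /andP[og oh]; rewrite big_cons IH //.
have gA : g \in A by rewrite inE.
rewrite (bigD1 g) //= [RHS](bigD1 g) //= eqxx exprS mulrA; congr (_ * _).
by apply: eq_bigr => f /andP[_]; rewrite eq_sym => /negbTE ->.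
Qed.

End TruncatedEnsemble.

(** * Polynomial decay and the Borel-Cantelli lemma *)

Section PowerDecay.
Variable R : realType.
Implicit Types (p a eps : R).

(** Up to a constant, n^(-1-p) is at most the increment of -n^(-p), which makes its
    sum telescope. *)
Lemma powR_telescope p n : 0 < p -> (0 < n)%N ->
  n%:R `^ (- p) / n%:R <= (2 + p) / p * (n%:R `^ (- p) - n.+1%:R `^ (- p)).
Proof.
move=> p0 n0; set x : R := n%:R.
have x0 : 0 < x by rewrite ltr0n.
have x1 : 1 <= x by rewrite ler1n.
have -> : n.+1%:R = x * ((x + 1) / x) by rewrite mulrCA divff ?mulr1 ?natr1 // gt_eqF.
clearbody x; set y := (x + 1) / x.
have y0 : 0 < y by rewrite divr_gt0 // addr_gt0.
rewrite powRM ?(ltW x0) ?(ltW y0) //; set u := x `^ _.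
have u0 : 0 < u by exact: powR_gt0.
have lny : (x + 1)^-1 <= ln y.
  have z0 : -1 < - (x + 1)^-1.
    by rewrite ltrN2 invf_lt1 ?addr_gt0 // ltrDr.
  have := le_ln1Dx z0.
  have -> : 1 + - (x + 1)^-1 = y^-1.
    by rewrite /y invf_div; field; apply: lt0r_neq0; lra.
  by rewrite lnV ?posrE // lerN2.
have yp : y `^ (- p) <= (1 + p * ln y)^-1.
  rewrite powRN lef_pV2 ?posrE ?powR_gt0 //.
    by rewrite /powR gt_eqF // expR_ge1Dx.
  by rewrite addr_gt0 // mulr_gt0 // (lt_le_trans _ lny) // invr_gt0 addr_gt0.
have q0 : 0 < (x + 1)^-1 by rewrite invr_gt0 addr_gt0.
have yp2 : y `^ (- p) <= (1 + p * (x + 1)^-1)^-1.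
  apply: le_trans yp _; rewrite lef_pV2 ?posrE ?addr_gt0 ?mulr_gt0 ?(lt_le_trans q0 lny) //.
  by rewrite lerD2l ler_pM2l.
have -> : u - u * y `^ (- p) = u * (1 - y `^ (- p)) by rewrite mulrBr mulr1.
rewrite [leRHS]mulrCA ler_wpM2l ?(ltW u0) //.
apply: (@le_trans _ _ ((2 + p) / p * (1 - (1 + p * (x + 1)^-1)^-1))); last first.
  by rewrite ler_wpM2l ?lerD2l ?lerN2 // divr_ge0 // ?addr_ge0 // ltW.
have -> : 1 - (1 + p * (x + 1)^-1)^-1 = p / (x + 1 + p).
  by field; apply/andP; split; apply: lt0r_neq0; lra.
have -> : (2 + p) / p * (p / (x + 1 + p)) = (2 + p) / (x + 1 + p).
  by field; apply/andP; split; apply: lt0r_neq0; lra.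
rewrite ler_pdivlMr; last lra.
rewrite mulrC ler_pdivrMr //.
have := ler_wpM2r (ltW p0) x1; lra.
Qed.

Lemma powRN_small a eps : 0 < a -> 0 < eps -> \forall N \near \oo, (N%:R : R) `^ (- a) <= eps.
Proof.
move=> a0 e0; exists (Num.truncn (eps^-1 `^ a^-1)).+1 => // N /= hN.
have h : eps^-1 `^ a^-1 <= N%:R.
  by rewrite ltW // (lt_le_trans (truncnS_gt _)) // ler_nat.
have e0' : 0 < eps^-1 by rewrite invr_gt0.
have z0 : 0 < eps^-1 `^ a^-1 by exact: powR_gt0.
have : (eps^-1 `^ a^-1) `^ a <= N%:R `^ a.
  by rewrite ge0_ler_powR ?nnegrE ?(ltW a0) // ltW.
rewrite -powRrM mulVf ?gt_eqF // powRr1 ?(ltW e0') // => h2.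
rewrite powRN -[leRHS]invrK lef_pV2 ?posrE //.
by apply: lt_le_trans h2.
Qed.

Lemma powR_large a (B : R) : 0 < a -> \forall N \near \oo, B <= (N%:R : R) `^ a.
Proof.
move=> a0; have B0 : 0 < (Num.max B 1)^-1 by rewrite invr_gt0 lt_max ltr01 orbT.
have [n _ hn] := powRN_small a0 B0; exists n.+1 => // N /= nN.
have := hn N (ltnW nN); rewrite powRN lef_pV2 ?posrE.
- by rewrite ge_max => /andP[].
- by apply: powR_gt0; rewrite ltr0n; lia.
- by rewrite lt_max ltr01 orbT.
Qed.

Lemma trunc_log_small a eps : 0 < a -> 0 < eps ->
  \forall N \near \oo, ((trunc_log 2 N).+1%:R : R) <= eps * N%:R `^ a.
Proof.
move=> a0 e0.
pose z : R := (a / 2) * ln 2.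
have ln20 : 0 < ln (2 : R) by rewrite ln_gt0 // ltr1n.
have z0 : 0 < z by rewrite /z mulr_gt0 // divr_gt0.
pose D := 1 + z^-1.
have D0 : 0 < D by rewrite addr_gt0 // invr_gt0.
have D1 : 1 <= D by rewrite lerDl invr_ge0 ltW.
have Dz : 1 <= D * z by rewrite /D mulrDl mul1r mulVf ?gt_eqF // lerDr ltW.
have bnd N : (0 < N)%N -> ((trunc_log 2 N).+1%:R : R) <= D * N%:R `^ (a / 2).
  move=> N0; set l := trunc_log 2 N.
  have lN : (2 ^ l <= N)%N by exact: trunc_logP.
  apply: (@le_trans _ _ (D * (1 + z * l%:R))).
    rewrite mulrDr mulr1 mulrA -natr1 addrC lerD // ler_peMl //.
  rewrite ler_wpM2l ?(ltW D0) //.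
  apply: (@le_trans _ _ ((2 ^ l)%:R `^ (a / 2))); last first.
    by rewrite ge0_ler_powR ?nnegrE ?ler_nat // divr_ge0 // ltW.
  rewrite /powR pnatr_eq0 expn_eq0 /=; apply: le_trans (expR_ge1Dx _) _.
  by rewrite ler_expR natrX lnXn // -[ln 2 *+ l]mulr_natr mulrA.
have a20 : 0 < a / 2 by rewrite divr_gt0.
have [n _ hn] := powR_large (D / eps) a20.
exists n.+1 => // N /= nN; have N0 : (0 < N)%N by lia.
apply: le_trans (bnd N N0) _.
have -> : (N%:R : R) `^ a = N%:R `^ (a / 2) * N%:R `^ (a / 2).
  rewrite -powRD; first by congr powR; field.
  by rewrite pnatr_eq0 (gtn_eqF N0) implybT.
rewrite mulrA ler_wpM2r ?powR_ge0 // mulrC -ler_pdivrMr //.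
exact: hn (ltnW nN).
Qed.

End PowerDecay.

(** The first Borel-Cantelli lemma for summable probabilities of order n^(-1-p). *)
Lemma ae_eventually_not d (T : measurableType d) (R : realType) (P : probability T R)
   (A : nat -> set T) (C p : R) : 0 < p -> 0 <= C ->
  (\forall N \near \oo, measurable (A N) /\ (P (A N) <= (C * (N%:R `^ (- p) / N%:R))%:E)%E) ->
  {ae P, forall t, \forall N \near \oo, ~ A N t}.
Proof.
move=> p0 C0 [n0 _ hA].
have [m [n0m m1]] : exists m, (n0 <= m)%N /\ (0 < m)%N.
  by exists (maxn n0 1); lia.
pose B n := if (m <= n)%N then A n else set0.
have mB n : measurable (B n).
  by rewrite /B; case: ifP => // mn; have [] := hA n (leq_trans n0m mn).
have B0 n : (0 <= P (B n))%E by [].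
pose D := C * ((2 + p) / p).
have D0 : 0 <= D by rewrite mulr_ge0 // divr_ge0 ?addr_ge0 ?(ltW p0).
pose u (n : nat) : R := n%:R `^ (- p).
have BD k : (\sum_(0 <= i < k) P (B i) <= (D * (u m - u (maxn m k)))%:E)%E.
  elim: k => [|k IH]; first by rewrite big_nil maxn0 subrr mulr0.
  rewrite big_nat_recr //= /B; case: ifP => mk; last first.
    rewrite measure0 adde0; apply: le_trans IH _.
    have -> : maxn m k = m by lia.
    by have -> : maxn m k.+1 = m by lia.
  have [_ PA] := hA k (leq_trans n0m mk).
  apply: le_trans (leeD IH PA) _.
  rewrite -EFinD lee_fin (maxn_idPr mk) (maxn_idPr (leqW mk)).
  have k0 : (0 < k)%N by lia.
  apply: le_trans (lerD (lexx _) (ler_wpM2l C0 (powR_telescope p0 k0))) _.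
  rewrite mulrA -/D -/(u k) -/(u k.+1) -mulrDr ler_wpM2l //.
  by rewrite addrA subrK.
have fin : (\sum_(n <oo) P (B n) < +oo)%E.
  apply: (@le_lt_trans _ _ (D * u m)%:E); last exact: ltry.
  apply: lime_le; first exact: is_cvg_nneseries.
  apply: nearW => k; apply: le_trans (BD k) _.
  by rewrite lee_fin ler_wpM2l // gerBl powR_ge0.
exists (lim_sup_set B); split.
- by apply: bigcap_measurable => // n _; apply: bigcup_measurable.
- exact: lim_sup_set_cvg0.
move=> t /= nt n _; apply: contrapT => nBt; apply: nt.
exists (maxn n m) => // N /= hN At; apply: nBt; exists N => /=; first lia.
by rewrite /B ifT //; lia.
Qed.

(** * Matrices of a fixed size *)

Lemma markov_bmeas d (T : measurableType d) (R : realType) (P : probability T R)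
  (f : T -> R) (c : R) : bounded_measurable f -> (forall t, 0 <= f t) -> 0 < c ->
  measurable [set t | c <= f t] /\
  (P [set t | (c <= f t)%R] <= (Rintegral P setT f / c)%:E)%E.
Proof.
move=> bf f0 c0; have mA : measurable [set t | c <= f t].
  by apply: measurable_set_le => //; case: bf.
split => //.
rewrite -[leLHS]fineK ?fin_num_measure // lee_fin -Ex_indic // ler_pdivlMr //.
rewrite mulrC -ExZ; last exact: bmeas_indic.
apply: Ex_le => //; first by apply: bmeasM; [exact: bmeas_cst|exact: bmeas_indic].
move=> t; rewrite indicE; case: (boolP (t \in _)) => [/set_mem|_]; first by rewrite mulr1.
by rewrite mulr0.
Qed.

Lemma expmxZ (R : comRingType) N (a : R) (A : 'M[R]_N) n : (a *: A) ^+ n = a ^+ n *: A ^+ n.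
Proof.
elim: n => [|n IH]; first by rewrite !expr0 scale1r.
rewrite !exprS IH -[_ * _]/((a *: A) *m (a ^+ n *: A ^+ n)).
by rewrite -scalemxAl -scalemxAr scalerA.
Qed.

Section FixedSize.
Variables (d : measure_display) (T : measurableType d) (R : realType).
Variables (P : probability T R) (N : nat) (X : 'I_N -> 'I_N -> {RV P >-> R}).
Variables (rho : probability R R) (v : R).
Hypothesis moments : forall k : nat, rho.-integrable [set: R] (fun x => (x ^+ k)%:E).
Hypothesis variance : v = (\int[rho]_x (x ^+ 2)).
Hypothesis Xsym : forall (i j : 'I_N) (t : T), X i j t = X j i t.
Hypothesis indep : mutually_independent [set k : 'I_N * 'I_N | (k.1 <= k.2)%N]%SET
      (fun k => X k.1 k.2).
Hypothesis law : forall (i j : 'I_N) (A : set R), measurable A ->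
    distribution P (X i j) A = rho A.
Variables (e : rel 'I_N) (w : nat) (s K : R).
Hypothesis esym : symmetric e.
Hypothesis w0 : (0 < w)%N.
Hypothesis edeg : forall u, (#|[pred y | e u y]| <= w)%N.
Hypotheses (s0 : 0 < s) (vs : v <= s ^+ 2) (sK : s <= K).
Let a := s * Num.sqrt w%:R.
Let iw : R := w%:R^-1.
Let kap := K / a.
Hypothesis Ka : K <= a.
Hypothesis tm1 : `|trunc_moment rho K 1| <= a * iw.

Definition full_mx (t : T) : 'M[R]_N := \matrix_(i, j) if e i j then X i j t else 0.
Let Y : T -> 'M[R]_N := band_mx e (trunc_entry X K a).

Let wr0 : 0 < w%:R :> R. Proof. by rewrite ltr0n. Qed.
Let a0 : 0 < a. Proof. by rewrite mulr_gt0 // sqrtr_gt0. Qed.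
Let a2 : a ^+ 2 = s ^+ 2 * w%:R. Proof. by rewrite exprMn sqr_sqrtr // ltW. Qed.
Let K0 : 0 < K. Proof. exact: lt_le_trans sK. Qed.
Let iw0 : 0 <= iw. Proof. by rewrite invr_ge0 ltW. Qed.
Let kap0 : 0 <= kap. Proof. by rewrite divr_ge0 // ltW. Qed.
Let kap1 : kap <= 1. Proof. by rewrite ler_pdivrMr // mul1r. Qed.
Let iw_le_kap2 : iw <= kap ^+ 2.
Proof.
rewrite exprMn exprVn a2 invfM mulrA ler_peMl // -ler_pdivrMr ?invr_gt0 ?exprn_gt0 //.
by rewrite invrK mul1r ler_sqr ?nnegrE // ltW.
Qed.
Let degiw u : #|[pred y | e u y]|%:R * iw <= 1.
Proof. by rewrite ler_pdivrMr // mul1r ler_nat. Qed.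

Let mom := scaled_trunc_moment rho K a.

(** Each moment beyond the second one costs a factor K, and the second moment is
    at most v <= s^2. *)
Lemma mom_weight m : `|mom m| <= mult_weight iw kap m.
Proof.
rewrite /mom /scaled_trunc_moment normrM normfV [`|a ^+ m|]ger0_norm ?exprn_ge0 ?(ltW a0) //.
rewrite ler_pdivrMr ?exprn_gt0 //.
case: m => [|[|m]]; first by rewrite trunc_moment0 normr1 mulr1.
  by rewrite /= !expr0 !mulr1 expr1 mulrC.
rewrite /=; apply: le_trans (trunc_moment_le rho m (ltW K0)) _.
rewrite exprMn exprVn -[m.+2]addn2 exprD a2.
have -> : iw * (K ^+ m / a ^+ m) * (a ^+ m * (s ^+ 2 * w%:R)) = K ^+ m * s ^+ 2.
  move: (a ^+ m) (expf_neq0 m (lt0r_neq0 a0)) (K ^+ m) => A A0 B.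
  by rewrite /iw; field; rewrite A0 lt0r_neq0.
rewrite ler_wpM2l ?exprn_ge0 ?(ltW K0) //.
exact: le_trans (trunc_moment2_le moments variance (ltW K0)) vs.
Qed.

Let mom0 : mom 0 = 1.
Proof. by rewrite /mom /scaled_trunc_moment trunc_moment0 expr0 divr1. Qed.

Let Zb f : bounded_measurable (trunc_entry X K a f).
Proof. exact: bmeas_trunc_entry (ltW K0) _. Qed.

Let Zprod h : all (@ordered_edge N) h ->
  Rintegral P setT (fun t => \prod_(f <- h) trunc_entry X K a f t) = mom_prod mom h.
Proof. exact: (trunc_entry_prod indep law a (ltW K0)). Qed.

Lemma full_mx_sym t : (full_mx t)^T = full_mx t.
Proof. by apply/matrixP => i j; rewrite !mxE esym Xsym. Qed.

Lemma band_mx_sym t : (Y t)^T = Y t.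
Proof. by apply/matrixP => i j; rewrite !mxE esym uedgeC. Qed.

Definition overflow : set T := [set t | exists i j, K < `|X i j t|].

Lemma full_mxE t : ~ overflow t -> full_mx t = a *: Y t.
Proof.
move=> no; apply/matrixP => i j; rewrite !mxE; case: ifP => _; last by rewrite mulr0.
rewrite /trunc_entry mulrC divfK ?(lt0r_neq0 a0) // /trunc.
have le i' j' : `|X i' j' t| <= K.
  by rewrite leNgt; apply/negP => lt; apply: no; exists i', j'.
rewrite le /uedge; case: ifP => // _; exact: Xsym.
Qed.

Lemma measurable_overflow : measurable overflow.
Proof.
rewrite (_ : overflow = \bigcup_(k in [set: 'I_N * 'I_N]) [set t | K < `|X k.1 k.2 t|]).
  apply: fin_bigcup_measurable => // k _; apply: measurable_set_lt => //.
  by apply: measurableT_comp => //; exact: measurable_funPT.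
apply/seteqP; split => t; first by move=> [i [j h]]; exists (i, j).
by move=> [[i j] _ h]; exists i, j.
Qed.

(** Markov's inequality for the moment of order 2p, for each of the N^2 entries. *)
Lemma overflow_le p : (P overflow <= (N%:R ^+ 2 * (K ^- p.*2 * moment rho p.*2))%:E)%E.
Proof.
have mo := measurable_overflow.
rewrite -[leLHS]fineK ?fin_num_measure // lee_fin -Ex_indic //.
pose B := [set x : R | K < `|x|].
have mB : measurable B by apply: measurable_set_lt => //; exact: normr_measurable.
have bB (k : 'I_N * 'I_N) : bounded_measurable (fun t => \1_B (X k.1 k.2 t)).
  by apply: (bmeas_comp (f := \1_B)); [exact: measurable_funPT|exact: bmeas_indic].
apply: (@le_trans _ _ (Rintegral P setT (fun t => \sum_k \1_B (X k.1 k.2 t)))).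
  apply: Ex_le; [exact: bmeas_indic|exact: bmeas_sum|].
  move=> t; rewrite indicE; case: (boolP (t \in _)) => [/set_mem [i [j h]]|_].
    rewrite (bigD1 (i, j)) //= indicE mem_set // lerDl.
    by apply: sumr_ge0 => k _; rewrite indicE.
  by apply: sumr_ge0 => k _; rewrite indicE.
rewrite Ex_sum // (eq_bigr (fun=> fine (rho B))); last first.
  move=> k _; rewrite (Ex_law law _ _ (bmeas_indic _ mB)) Ex_indic //.
rewrite sumr_const card_prod card_ord -[leLHS]mulr_natl natrM -expr2.
by rewrite ler_wpM2l ?exprn_ge0 //; exact: tail_le.
Qed.

Definition large_trace (r : R) k : set T := [set t | r ^+ (2 * k) <= \tr (Y t ^+ (2 * k))].

Lemma large_trace_le (r : R) k : 0 < r -> 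
  measurable (large_trace r k) /\
  (P (large_trace r k) <= (N%:R * (growth iw kap 1 (2 * k).+1 / r) ^+ (2 * k))%:E)%E.
Proof.
move=> r0; have [] := @markov_bmeas _ _ _ P (fun t => \tr (Y t ^+ (2 * k))) (r ^+ (2 * k))
   (bmeas_trace e Zb _).
- by move=> t; apply: trace_pow_ge0; exact: band_mx_sym.
- by rewrite exprn_gt0.
move=> mA PA; split => //; apply: le_trans PA _.
rewrite lee_fin expr_div_n mulrA ler_wpM2r ?invr_ge0 ?exprn_ge0 ?(ltW r0) //.
exact: (Ex_trace_le Zb Zprod mom_weight iw0 kap0 degiw (ltnSn _)).
Qed.

Lemma opnorm_full_le (r : R) k t : 0 < r -> ~ overflow t -> ~ large_trace r k.+1 t ->
  opnorm (full_mx t) <= a * r.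
Proof.
move=> r0 no nl; apply: (opnorm_le_trace (k := k)).
- exact: full_mx_sym.
- by rewrite mulr_ge0 // ltW.
rewrite full_mxE // expmxZ mxtraceZ [leRHS]exprMn ler_wpM2l ?exprn_ge0 ?(ltW a0) //.
by move/negP: nl; rewrite -ltNge => /ltW.
Qed.

Let mean_trace k := Rintegral P setT (fun t => \tr (Y t ^+ k.*2)).

Definition deviant_trace (eta : R) k : set T :=
  [set t | (N%:R * eta) ^+ 2 <= (\tr (Y t ^+ k.*2) - mean_trace k) ^+ 2].

Lemma deviant_trace_le (eta gam : R) k M : (0 < N)%N -> 0 < eta -> 1 <= gam ->
  (k.+1.*2.*2 < M)%N ->
  measurable (deviant_trace eta k.+1) /\
  (P (deviant_trace eta k.+1) <=
    (2 * k.+1.*2%:R * M%:R ^+ 2 * growth iw kap gam M ^+ k.+1.*2.*2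
       / (gam * eta ^+ 2 * N%:R))%:E)%E.
Proof.
move=> N0 eta0 g1 kM; have NR : 0 < N%:R :> R by rewrite ltr0n.
have bt := bmeas_trace e Zb k.+1.*2.
have [] := @markov_bmeas _ _ _ P (fun t => (\tr (Y t ^+ k.+1.*2) - mean_trace k.+1) ^+ 2)
   ((N%:R * eta) ^+ 2) (bmeasX 2 (bmeasB bt (bmeas_cst T _))).
- by move=> t; exact: sqr_ge0.
- by rewrite exprn_gt0 // mulr_gt0.
move=> mA PA; split => //; apply: le_trans PA _; rewrite lee_fin.
have VE : (k.+1.*2 = (k.*2.+1).+1)%N by rewrite doubleS.
have kM' : ((k.*2.+1).+1.*2 < M)%N by rewrite -VE.
have := variance_trace_le esym Zb Zprod mom_weight iw0 kap0 degiw kap1 iw_le_kap2 mom0 g1 kM'.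
rewrite -VE => V; rewrite ler_pdivrMr ?exprn_gt0 ?mulr_gt0 //.
apply: le_trans V _; rewrite le_eqVlt; apply/orP; left; apply/eqP.
field; rewrite !lt0r_neq0 //; exact: lt_le_trans g1.
Qed.

Lemma mean_trace_ge (gam : R) k M theta (good : nat -> pred 'I_N) : 1 <= gam ->
  (k.*2 < M)%N ->
  (forall k u, good k.+1 u -> (theta + M <= #|[pred y | e u y]|)%N) ->
  (forall k u y, good k.+1 u -> e u y -> good k y) ->
  #|good k.*2|%:R * (dyck theta k.*2 0)%:R * mom 2 ^+ k
    - N%:R * growth iw kap gam M ^+ k.*2 / gam <= mean_trace k.
Proof.
move=> g1 kM gdeg gstep.
have := Ex_trace_ge esym Zb Zprod mom_weight iw0 kap0 degiw mom0 g1 kM.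
apply: le_trans; rewrite lerD2r ler_wpM2r //.
  by rewrite exprn_ge0 // /mom /scaled_trunc_moment divr_ge0 ?trunc_moment2_ge0 // exprn_ge0 // ltW.
rewrite -natrM ler_nat -sum_nat_const big_mkcond /=; apply: leq_sum => x _.
case: ifP => // gx.
apply: (clean_closings_ge esym gdeg gstep (mem_head x [::]) (@covers0 _ _) (tree_start e x)) => //.
Qed.

(** If the trace is close to its mean, it exceeds N * (c / s)^(2k), and it is at
    most N times the power of the norm. *)
Lemma opnorm_full_ge (c eta : R) k t : (0 < N)%N -> 0 <= c -> 0 < eta ->
  N%:R * ((c / s) ^+ k.+1.*2 + eta) <= mean_trace k.+1 -> 
  ~ overflow t -> ~ deviant_trace eta k.+1 t ->
  c * Num.sqrt w%:R <= opnorm (full_mx t).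
Proof.
move=> N0 c0 eta0 mt no nd; have NR : 0 < N%:R :> R by rewrite ltr0n.
have cs0 : 0 <= c * Num.sqrt w%:R by rewrite mulr_ge0 // sqrtr_ge0.
rewrite -(@ler_pXn2r _ (2 * k.+1)) ?nnegrE ?opnorm_ge0 // -(ler_pM2l NR).
apply: le_trans (trace_le_opnorm _ (full_mx_sym t)).
rewrite full_mxE // expmxZ mxtraceZ mul2n.
have -> : c * Num.sqrt w%:R = a * (c / s) by rewrite /a mulrAC mulrCA divff ?mulr1 // lt0r_neq0.
rewrite [(a * _) ^+ _]exprMn mulrCA ler_wpM2l ?exprn_ge0 ?(ltW a0) //.
move/negP: nd; rewrite -ltNge => nd.
have ne0 : 0 < N%:R * eta by rewrite mulr_gt0.
have : `|\tr (Y t ^+ k.+1.*2) - mean_trace k.+1| < N%:R * eta.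
  rewrite -(@ltr_pXn2r _ 2) ?nnegrE ?(ltW ne0) // real_normK ?num_real //.
rewrite ltr_norml => /andP[h _]; move: mt; rewrite mulrDr => mt.
by move: h mt; set y := \tr _; set z := mean_trace _; lra.
Qed.

End FixedSize.

(** * Almost sure asymptotics *)

Lemma exp_beats_quadratic (R : realType) (y : R) : 1 < y ->
  exists k, 4 * (k.+1.*2.+1 * k.+2)%:R <= y ^+ k.+1.
Proof.
move=> y1; pose z := y - 1; have z0 : 0 < z by rewrite subr_gt0.
have ber n : n%:R * z <= y ^+ n.
  elim: n => [|n IH]; first by rewrite mul0r expr0.
  have yn : 1 <= y ^+ n by rewrite exprn_ege1 // ltW.
  have -> : y ^+ n.+1 = y ^+ n + z * y ^+ n by rewrite exprS /z mulrBl mul1r addrC subrK.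
  by rewrite -natr1 mulrDl mul1r lerD // ler_peMr // ltW.
(* With k + 1 = 3 * n the bound (1 + z)^n >= n * z, cubed, beats 4(6n+1)(3n+1) <= 112 n^2. *)
pose n := (Num.truncn (112 / z ^+ 3)).+1.
exists (3 * n).-1; have n0 : (0 < n)%N by [].
have -> : (3 * n).-1.+1 = (3 * n)%N by lia.
have nz : 112 <= n%:R * z ^+ 3.
  by rewrite -ler_pdivrMr ?exprn_gt0 // ltW // truncnS_gt.
have -> : y ^+ (3 * n) = (y ^+ n) ^+ 3 by rewrite mulnC exprM.
apply: (@le_trans _ _ ((n%:R * z) ^+ 3)); last first.
  by rewrite lerXn2r ?nnegrE ?mulr_ge0 ?exprn_ge0 ?(ltW z0) // (le_trans ler01) // ltW.
apply: (@le_trans _ _ (112 * n%:R ^+ 2)); last first.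
  have -> : (n%:R * z) ^+ 3 = n%:R * z ^+ 3 * n%:R ^+ 2 by ring.
  by rewrite ler_wpM2r // exprn_ge0.
rewrite -natrX -!natrM ler_nat; nia.
Qed.

Lemma expr_small (R : realType) (x eps : R) : 0 <= x -> x < 1 -> 0 < eps ->
  exists2 L, (0 < L)%N & x ^+ (2 * L) <= eps.
Proof.
move=> x0 x1 eps0.
have /cvgrPdist_lt /(_ _ eps0) [n _ hn] : x ^+ n @[n --> \oo] --> 0.
  by apply: cvg_expr; rewrite ger0_norm.
exists n.+1 => //; have := hn (2 * n.+1)%N.
rewrite /= sub0r normrN ger0_norm ?exprn_ge0 // => h.
by apply/ltW/h; rewrite mul2n -addnn addSn leqW // leq_addr.
Qed.

Lemma double_S_le L l : (0 < L)%N -> ((2 * (L * l.+1)).+1 <= 3 * L * l.+1)%N.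
Proof. by move=> L0; nia. Qed.

Section Asymptotics.
Variables (d : measure_display) (T : measurableType d) (R : realType).
Variables (P : probability T R) (X : forall N : nat, 'I_N -> 'I_N -> {RV P >-> R}).
Arguments X : clear implicits.
Variables (rho : probability R R) (v : R).
Hypothesis hX : wigner_ensemble X rho 0 v.
Variables (e : forall N, rel 'I_N) (w : nat -> nat) (c q : R).
Arguments e : clear implicits.
Hypotheses (c0 : 0 < c) (q0 : 0 < q).
Hypothesis hw : forall N, (0 < N)%N -> c * N%:R `^ q <= (w N)%:R.
Hypothesis wN : forall N, (w N <= N)%N.
Hypothesis esym : forall N, symmetric (e N).
Hypothesis edeg : forall N u, (#|[pred y | e N u y]| <= w N)%N.

Let moments : forall k : nat, rho.-integrable [set: R] (fun x => (x ^+ k)%:E).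
Proof. by case: hX. Qed.
Let mean0 : 0 = \int[rho]_x x. Proof. by case: hX. Qed.
Let variance : v = (\int[rho]_x (x ^+ 2)).
Proof. by case: hX => _ _ _ _ _ ->; rewrite expr0n subr0. Qed.

Let v0 : 0 <= v.
Proof. by rewrite variance; apply: Rintegral_ge0 => x _; rewrite sqr_ge0. Qed.

(** Any small power of N would do.  With q / 8 the bound kappa of the scaled
    entries is at most of order [cutoff]^-3, as the bandwidth is at least of order
    [cutoff]^8. *)
Definition cutoff (N : nat) : R := N%:R `^ (q / 8).
Let q8 : 0 < q / 8. Proof. by rewrite divr_gt0. Qed.

Let cutoff_large (B : R) : \forall N \near \oo, B <= cutoff N.
Proof. exact: powR_large. Qed.

Let cutoffX (N : nat) n : cutoff N ^+ n = N%:R `^ (q / 8 * n%:R).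
Proof. by rewrite /cutoff -powR_mulrn ?powR_ge0 // -powRrM. Qed.

Let w_ge N : (0 < N)%N -> c * cutoff N ^+ 8 <= (w N)%:R.
Proof. by move=> N0; rewrite cutoffX divfK ?hw // pnatr_eq0. Qed.

Let N_le : exists p, forall N, (0 < N)%N -> N%:R <= cutoff N ^+ p.
Proof.
exists (Num.truncn (8 / q)).+1 => N N0; rewrite cutoffX.
rewrite -[leLHS]powRr1 ?ler0n // ler_powR ?ler1n //.
have := truncnS_gt (8 / q); rewrite ltr_pdivrMr // => h.
by rewrite mulrAC ler_pdivlMr // mul1r mulrC ltW.
Qed.

Let sqrtw N := Num.sqrt (w N)%:R : R.

Lemma parameters_near s : 0 < s -> \forall N \near \oo,
  [/\ (0 < N)%N, (0 < w N)%N, s <= cutoff N, cutoff N <= s * sqrtw N &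
      `|trunc_moment rho (cutoff N) 1| <= s * sqrtw N * (w N)%:R^-1 ].
Proof.
move=> s0; have [p hp] := N_le.
near=> N.
have N0 : (0 < N)%N by near: N; exact: nbhs_infty_gt.
have x1 : 1 <= cutoff N by near: N; exact: cutoff_large.
have x0 : 0 < cutoff N by exact: lt_le_trans x1.
have sx : s <= cutoff N by near: N; exact: cutoff_large.
have cx : (s ^+ 2 * c)^-1 <= cutoff N by near: N; exact: cutoff_large.
have mx : moment rho p.+1.*2 / s <= cutoff N by near: N; exact: cutoff_large.
have w0 : (0 < w N)%N.
  by rewrite -(@ltr0n R) (lt_le_trans _ (w_ge N0)) // mulr_gt0 // exprn_gt0.
have wr0 : 0 < (w N)%:R :> R by rewrite ltr0n.
have sw0 : 0 < sqrtw N by rewrite sqrtr_gt0.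
split=> //.
- rewrite -(@ler_pXn2r _ 2) ?nnegrE ?mulr_ge0 ?(ltW x0) ?(ltW s0) ?(ltW sw0) //.
  rewrite exprMn sqr_sqrtr ?(ltW wr0) //.
  apply: (@le_trans _ _ (s ^+ 2 * (c * cutoff N ^+ 8))); last first.
    by rewrite ler_wpM2l ?sqr_ge0 // w_ge.
  rewrite mulrA (exprD _ 2 6) [leRHS]mulrCA ler_peMr ?sqr_ge0 //.
  apply: (@le_trans _ _ (s ^+ 2 * c * cutoff N)).
    by rewrite -ler_pdivrMl ?mulr1 // mulr_gt0 // exprn_gt0.
  rewrite ler_wpM2l ?mulr_ge0 ?(ltW s0) ?(ltW c0) //.
  by rewrite exprS ler_peMr ?(ltW x0) // exprn_ege1.
- apply: le_trans (trunc_moment1_le moments mean0 p x0) _.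
  have -> : s * sqrtw N / (w N)%:R = s / sqrtw N.
    rewrite -[(w N)%:R]sqr_sqrtr ?(ltW wr0) // -/(sqrtw N); field.
    exact: lt0r_neq0.
  rewrite ler_pdivlMr // -mulrA ler_pdivrMl ?exprn_gt0 // [leLHS]mulrC.
  apply: (@le_trans _ _ (cutoff N ^+ p * (cutoff N * s))); last first.
    by rewrite mulrA ler_wpM2r ?(ltW s0) // -exprSr ler_weXn2l // ltnS -addnn leq_addr.
  rewrite ler_pM ?moment_ge0 ?(ltW sw0) //; last by rewrite -ler_pdivrMr.
  apply: le_trans (hp N N0).
  apply: (@le_trans _ _ (w N)%:R); last by rewrite ler_nat.
  rewrite -[leRHS]sqr_sqrtr ?(ltW wr0) // -/(sqrtw N) expr2 ler_peMr ?(ltW sw0) //.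
  by rewrite -sqrtr1 ler_wsqrtr // ler1n.
Unshelve. all: by end_near. Qed.

(** For M of smaller order than [cutoff] the base of the walk sum tends to 2. *)
Lemma growth_near s : 0 < s -> exists2 C : R, 0 < C &
  \forall N \near \oo, forall M, (0 < M)%N ->
   M%:R ^+ 3 * (w N)%:R^-1 + M%:R ^+ 2 * (cutoff N / (s * sqrtw N))
    <= C * (M%:R / cutoff N) ^+ 3.
Proof.
move=> s0; have sc0 : 0 < Num.sqrt c by rewrite sqrtr_gt0.
exists (c^-1 + (s * Num.sqrt c)^-1); first by rewrite addr_gt0 ?invr_gt0 // mulr_gt0.
near=> N => M M0.
have N0 : (0 < N)%N by near: N; exact: nbhs_infty_gt.
have x1 : 1 <= cutoff N by near: N; exact: cutoff_large.
have x0 : 0 < cutoff N by exact: lt_le_trans x1.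
have M1 : 1 <= M%:R :> R by rewrite ler1n.
have Mr0 : 0 < M%:R :> R by rewrite ltr0n.
have wx := w_ge N0.
have wr0 : 0 < (w N)%:R :> R by apply: lt_le_trans wx; rewrite mulr_gt0 // exprn_gt0.
have swx : Num.sqrt c * cutoff N ^+ 4 <= sqrtw N.
  rewrite -(@ler_pXn2r _ 2) ?nnegrE ?mulr_ge0 ?sqrtr_ge0 ?exprn_ge0 ?(ltW x0) //.
  by rewrite exprMn !sqr_sqrtr ?(ltW c0) ?(ltW wr0) // -exprM.
have sw0 : 0 < sqrtw N by rewrite sqrtr_gt0.
rewrite mulrDl expr_div_n; apply: lerD.
  rewrite mulrCA ler_wpM2l ?exprn_ge0 ?(ltW Mr0) // -invfM lef_pV2 ?posrE ?mulr_gt0 ?exprn_gt0 //.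
  apply: le_trans wx; rewrite ler_wpM2l ?(ltW c0) //.
  by rewrite ler_weXn2l.
rewrite [leRHS]mulrCA; apply: ler_pM.
- by rewrite exprn_ge0 // ltW.
- by rewrite divr_ge0 ?(ltW x0) // ltW // mulr_gt0.
- by rewrite ler_weXn2l.
rewrite -invfM ler_pdivrMr ?mulr_gt0 // ler_pdivlMl ?mulr_gt0 ?exprn_gt0 //.
have -> : s * Num.sqrt c * cutoff N ^+ 3 * cutoff N = s * (Num.sqrt c * cutoff N ^+ 4) by ring.
by rewrite ler_wpM2l ?(ltW s0).
Unshelve. all: by end_near. Qed.

Lemma overflow_ae : {ae P, forall t, \forall N \near \oo, ~ overflow (X N) (cutoff N) t}.
Proof.
have [p hp] := N_le.
apply: (@ae_eventually_not _ _ _ P (fun N => overflow (X N) (cutoff N)) (moment rho p.*2.*2) 1) => //.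
  exact: moment_ge0.
near=> N.
have N0 : (0 < N)%N by near: N; exact: nbhs_infty_gt.
have Nr0 : 0 < N%:R :> R by rewrite ltr0n.
have x1 : 1 <= cutoff N by near: N; exact: cutoff_large.
have x0 : 0 < cutoff N by exact: lt_le_trans x1.
split; first exact: measurable_overflow.
case: hX => _ _ hl _ _ _.
apply: le_trans (overflow_le moments (hl N) ltr01 x1 p.*2) _.
rewrite lee_fin mulrA mulrC ler_wpM2l ?moment_ge0 //.
rewrite powRN powRr1 ?(ltW Nr0) // -invfM -expr2.
rewrite ler_pdivrMr ?exprn_gt0 // mulrC ler_pdivlMr ?exprn_gt0 // -exprD.
have -> : (p.*2.*2 = p * 4)%N by rewrite -!muln2 -mulnA.
by rewrite exprM lerXn2r ?nnegrE ?(ltW Nr0) ?exprn_ge0 ?(ltW x0) // hp.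
Unshelve. all: by end_near. Qed.

(** The order of the trace is twice a large multiple of log N: then N times the
    power of the ratio is at most N^-2. *)
Lemma upper_ae eps : 0 < eps -> {ae P, forall t, \forall N \near \oo,
  opnorm (full_mx (X N) (e N) t) / sqrtw N <= 2 * Num.sqrt v + eps}.
Proof.
move=> eps0; pose s := Num.sqrt v + eps / 4.
have sv0 : 0 <= Num.sqrt v by exact: sqrtr_ge0.
have s0 : 0 < s by rewrite /s; lra.
have vs : v <= s ^+ 2.
  rewrite -[leLHS]sqr_sqrtr // lerXn2r ?nnegrE ?(ltW s0) // /s; lra.
pose r := (2 * Num.sqrt v + eps) / s.
have r2 : 2 < r by rewrite /r ltr_pdivlMr // /s; lra.
have r0 : 0 < r by exact: lt_trans r2.
pose mu := (2 + r) / 2.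
have mu2 : 2 < mu by rewrite /mu; lra.
pose ratio := mu / r.
have ratio0 : 0 < ratio by rewrite divr_gt0 // (lt_trans _ mu2).
have ratio1 : ratio < 1 by rewrite ltr_pdivrMr // mul1r /mu; lra.
have [L L0 hL] : exists2 L, (0 < L)%N & ratio ^+ (2 * L) <= 8^-1.
  by apply: expr_small; rewrite ?invr_gt0 ?(ltW ratio0).
pose k N := (L * (trunc_log 2 N).+1)%N.
have k0 N : (0 < k N)%N by rewrite muln_gt0 L0.
have [C C0 hC] := growth_near s0.
have D0 : 0 < (r - 2) / 2 by rewrite divr_gt0 // subr_gt0.
pose z := Num.min 1 ((r - 2) / 2 / (C * 27 * L%:R ^+ 3)).
have Lr0 : 0 < L%:R :> R by rewrite ltr0n.
have z0 : 0 < z by rewrite lt_min ltr01 divr_gt0 // ?mulr_gt0 // exprn_gt0.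
(* z is chosen so that trunc_log <= z * cutoff keeps the growth below mu. *)
have large : {ae P, forall t, \forall N \near \oo,
    ~ large_trace (X N) (e N) (w N) s (cutoff N) r (k N) t}.
  apply: (@ae_eventually_not _ _ _ P (fun N => large_trace (X N) (e N) (w N) s (cutoff N) r (k N)) 1 1) => //.
  near=> N.
  have [N0 w0 sx xw tm1] : [/\ (0 < N)%N, (0 < w N)%N, s <= cutoff N, cutoff N <= s * sqrtw N &
      `|trunc_moment rho (cutoff N) 1| <= s * sqrtw N * (w N)%:R^-1 ].
    by near: N; exact: parameters_near.
  have x0 : 0 < cutoff N by exact: lt_le_trans sx.
  have Nr0 : 0 < N%:R :> R by rewrite ltr0n.
  case: hX => hs hi hl _ _ _.
  have [mA PA] := large_trace_le moments variance (hi N) (hl N) (@esym N) w0 (@edeg N) s0 vs sx tm1 (k N) r0.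
  split=> //; apply: le_trans PA _; rewrite lee_fin mul1r.
  set G := growth _ _ _ _.
  have Gmu : G <= mu.
    rewrite /G /growth mul1r.
    have -> : mu = 2 + (r - 2) / 2 by rewrite /mu; field.
    rewrite lerD2l.
    have kN : ((2 * k N).+1%:R : R) <= 3 * L%:R * (trunc_log 2 N).+1%:R.
      by rewrite -!natrM ler_nat double_S_le.
    have tl : ((trunc_log 2 N).+1%:R : R) <= z * cutoff N.
      by near: N; exact: trunc_log_small.
    have hCN : forall M, (0 < M)%N ->
      M%:R ^+ 3 * (w N)%:R^-1 + M%:R ^+ 2 * (cutoff N / (s * sqrtw N))
       <= C * (M%:R / cutoff N) ^+ 3 by near: N; exact: hC.
    apply: le_trans (hCN _ _) _ => //.
    have Mx : ((2 * k N).+1%:R / cutoff N : R) <= 3 * L%:R * z.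
      by rewrite ler_pdivrMr //; apply: le_trans kN _; rewrite -[leRHS]mulrA ler_wpM2l.
    apply: (@le_trans _ _ (C * (3 * L%:R * z) ^+ 3)).
      rewrite ler_wpM2l ?(ltW C0) // lerXn2r ?nnegrE ?divr_ge0 ?(ltW x0) //.
      by rewrite !mulr_ge0 // ltW.
    have z3 : z ^+ 3 <= z.
      rewrite exprS ler_piMr ?(ltW z0) // exprn_ile1 ?(ltW z0) // /z ge_min lexx //.
    apply: (@le_trans _ _ (C * 27 * L%:R ^+ 3 * z)).
      have -> : C * (3 * L%:R * z) ^+ 3 = C * 27 * L%:R ^+ 3 * z ^+ 3 by ring.
      by rewrite ler_wpM2l // !mulr_ge0 ?exprn_ge0 // ltW.
    by rewrite mulrC -ler_pdivlMr ?mulr_gt0 ?exprn_gt0 // /z ge_min lexx orbT.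
  have G0 : 0 <= G.
    by rewrite growth_ge0 ?invr_ge0 // divr_ge0 ?(ltW x0) // (le_trans _ xw) // ltW.
  have Gr : G / r <= ratio by rewrite ler_wpM2r // invr_ge0 ltW.
  apply: (@le_trans _ _ (N%:R * ratio ^+ (2 * k N))).
    have Gr0 : 0 <= G / r by rewrite divr_ge0 // ltW.
    by rewrite ler_wpM2l //; apply: lerXn2r; rewrite ?nnegrE // ltW.
  rewrite powRN powRr1 ?(ltW Nr0) // -invfM -expr2 -ler_pdivlMl //.
  have -> : N%:R^-1 * (N%:R ^+ 2)^-1 = (N%:R ^+ 3)^-1 :> R.
    by rewrite -invfM -exprS.
  rewrite /k mulnA exprM.
  apply: (@le_trans _ _ (8^-1 ^+ (trunc_log 2 N).+1)).
    by rewrite lerXn2r ?nnegrE ?exprn_ge0 ?(ltW ratio0) // invr_ge0.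
  rewrite exprVn lef_pV2 ?posrE ?exprn_gt0 //.
  have -> : (8 : R) = 2 ^+ 3 by rewrite -natrX.
  rewrite -exprM mulnC exprM lerXn2r ?nnegrE ?exprn_ge0 // -natrX ler_nat ltnW //.
  exact: trunc_log_ltn.
have := overflow_ae; move: large; apply: filterS2 => t tl to.
near=> N.
have [N0 w0 sx xw tm1] : [/\ (0 < N)%N, (0 < w N)%N, s <= cutoff N, cutoff N <= s * sqrtw N &
    `|trunc_moment rho (cutoff N) 1| <= s * sqrtw N * (w N)%:R^-1 ].
  by near: N; exact: parameters_near.
have sw0 : 0 < sqrtw N by rewrite sqrtr_gt0 ltr0n.
case: hX => hs _ _ _ _ _.
have nl : ~ large_trace (X N) (e N) (w N) s (cutoff N) r (k N).-1.+1 t.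
  by rewrite prednK //; near: N; exact: tl.
have no : ~ overflow (X N) (cutoff N) t by near: N; exact: to.
have := opnorm_full_le (hs N) (@esym N) w0 s0 r0 no nl.
rewrite ler_pdivrMr // => /le_trans -> //.
by rewrite -/(sqrtw N) mulrAC [s * r]mulrC /r divfK // lt0r_neq0.
Unshelve. all: by end_near. Qed.

(** A vertex in good j is the centre of a ball of radius j, all of whose interior
    points have almost full degree. *)
Definition wide_neighbourhoods := forall (k : nat) (eps : R), 0 < eps -> eps < 1 ->
  \forall N \near \oo, exists good : nat -> pred 'I_N,
   [/\ forall j u, good j.+1 u -> (1 - eps) * (w N)%:R <= #|[pred y | e N u y]|%:R,
       forall j u y, good j.+1 u -> e N u y -> good j y &
       (1 - eps) * N%:R <= #|good k|%:R].

Lemma w_large (B : R) : \forall N \near \oo, B <= (w N)%:R.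
Proof.
near=> N.
have N0 : (0 < N)%N by near: N; exact: nbhs_infty_gt.
have x1 : 1 <= cutoff N by near: N; exact: cutoff_large.
have xB : B / c <= cutoff N by near: N; exact: cutoff_large.
apply: le_trans (w_ge N0); rewrite mulrC -ler_pdivrMr //.
apply: le_trans xB _; rewrite exprS ler_peMr ?exprn_ege1 // (le_trans _ x1) //.
Unshelve. all: by end_near. Qed.

Lemma variance_near eps : 0 < eps ->
  \forall N \near \oo, v - eps <= trunc_moment rho (cutoff N) 2.
Proof.
move=> eps0; near=> N.
have x1 : 1 <= cutoff N by near: N; exact: cutoff_large.
have x0 : 0 < cutoff N by exact: lt_le_trans x1.
have xm : moment rho 4 / eps <= cutoff N by near: N; exact: cutoff_large.
apply: le_trans (moment2_sub_trunc moments variance x0).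
rewrite lerD2l lerN2 ler_pdivrMl ?exprn_gt0 // mulrC -ler_pdivrMl // mulrC.
by apply: le_trans xm _; rewrite expr2 ler_peMr // ltW.
Unshelve. all: by end_near. Qed.

(** For given c1 < 2 * sqrt v the length of the walks is fixed so large that the
    Catalan growth (4 v')^k, for some v' between c1^2 / 4 and v, beats c1^(2k)
    together with all polynomial factors.  The remaining losses tend to 0 with N. *)
Lemma lower_ae eps0 : wide_neighbourhoods -> 0 < eps0 ->
  {ae P, forall t, \forall N \near \oo,
     2 * Num.sqrt v - eps0 <= opnorm (full_mx (X N) (e N) t) / sqrtw N}.
Proof.
move=> wide eps00; set c1 := 2 * Num.sqrt v - eps0.
have sv0 : 0 <= Num.sqrt v by exact: sqrtr_ge0.
have [c1le|c1gt] := leP c1 0.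
  apply: aeW => t; apply: nearW => N; apply: le_trans c1le _.
  by rewrite divr_ge0 ?opnorm_ge0 ?sqrtr_ge0.
have c1v : c1 ^+ 2 / 4 < v.
  have : c1 ^+ 2 < (2 * Num.sqrt v) ^+ 2.
    by apply: ltrXn2r; rewrite ?nnegrE ?mulr_ge0 ?(ltW c1gt) // /c1 ltrBlDr ltrDl.
  by rewrite exprMn sqr_sqrtr // -natrX ltr_pdivrMr // mulrC.
have v_gt0 : 0 < v by apply: le_lt_trans c1v; rewrite divr_ge0 ?sqr_ge0.
pose v' := (c1 ^+ 2 / 4 + v) / 2.
have v'v : v' < v by rewrite /v'; lra.
have v'c : c1 ^+ 2 / 4 < v' by rewrite /v'; lra.
have v'0 : 0 < v' by apply: le_lt_trans v'c; rewrite divr_ge0 ?sqr_ge0.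
have [k hk] : exists k, 4 * (k.+1.*2.+1 * k.+2)%:R <= (4 * v' / c1 ^+ 2) ^+ k.+1.
  apply: exp_beats_quadratic; rewrite ltr_pdivlMr ?exprn_gt0 // mul1r mulrC -ltr_pdivrMr //.
pose s := Num.sqrt v + 1.
have s0 : 0 < s by rewrite /s; lra.
have vs : v <= s ^+ 2 by rewrite -[leLHS]sqr_sqrtr // lerXn2r ?nnegrE ?(ltW s0) // /s lerDl.
pose eps := Num.min (1 / 4) ((v - v') / (1 + 2 * v)).
have v21 : 0 < 1 + 2 * v by lra.
have eps_gt0 : 0 < eps by rewrite lt_min !divr_gt0 //= subr_gt0.
have eps4 : eps <= 1 / 4 by rewrite /eps ge_min lexx.
have epsv : v' <= (1 - 2 * eps) * (v - eps).
  have : eps <= (v - v') / (1 + 2 * v) by rewrite /eps ge_min lexx orbT.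
  rewrite ler_pdivlMr // => h.
  have := sqr_ge0 eps; rewrite expr2; nra.
pose n := k.+1.*2.
pose B := (c1 / s) ^+ n.
have B0 : 0 < B by rewrite exprn_gt0 // divr_gt0.
pose eta := B / 2.
have eta0 : 0 < eta by rewrite divr_gt0.
pose M := n.*2.+1.
have M0 : (0 < M)%N by [].
have Mr0 : 0 < M%:R :> R by rewrite ltr0n.
have [C C0 hC] := growth_near s0.
(* The largest weight of bad steps that keeps the growth bounded, by 3. *)
pose gam N := cutoff N ^+ 3 / (C * M%:R ^+ 3).
have CM0 : 0 < C * M%:R ^+ 3 by rewrite mulr_gt0 // exprn_gt0.
have gam_large D : \forall N \near \oo, D <= gam N.
  near=> N; have x1 : 1 <= cutoff N by near: N; exact: cutoff_large.
  have xD : D * (C * M%:R ^+ 3) <= cutoff N by near: N; exact: cutoff_large.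
  rewrite /gam ler_pdivlMr //; apply: le_trans xD _.
  by rewrite exprS ler_peMr ?exprn_ege1 // (le_trans _ x1).
have growth3 : \forall N \near \oo,
    0 <= growth (w N)%:R^-1 (cutoff N / (s * sqrtw N)) (gam N) M <= 3.
  near=> N.
  have x1 : 1 <= cutoff N by near: N; exact: cutoff_large.
  have x0 : 0 < cutoff N by exact: lt_le_trans x1.
  have g1 : 1 <= gam N by near: N; exact: gam_large.
  have g0 : 0 < gam N by exact: lt_le_trans g1.
  have hCN : forall M, (0 < M)%N ->
      M%:R ^+ 3 * (w N)%:R^-1 + M%:R ^+ 2 * (cutoff N / (s * sqrtw N))
       <= C * (M%:R / cutoff N) ^+ 3 by near: N; exact: hC.
  rewrite growth_ge0 ?invr_ge0 ?divr_ge0 ?mulr_ge0 ?sqrtr_ge0 ?(ltW s0) ?(ltW x0) //=.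
  have -> : (3 : R) = 2 + 1 by rewrite natr1.
  rewrite /growth lerD2l.
  apply: le_trans (ler_wpM2l (ltW g0) (hCN M M0)) _.
  rewrite /gam le_eqVlt; apply/orP; left; apply/eqP.
  by field; rewrite !lt0r_neq0.
pose Dv t N := deviant_trace (X N) (e N) (w N) s (cutoff N) eta k.+1 t.
have dev : {ae P, forall t, \forall N \near \oo, ~ Dv t N}.
  apply: (@ae_eventually_not _ _ _ P (fun N => deviant_trace (X N) (e N) (w N) s (cutoff N) eta k.+1)
    (2 * n%:R * M%:R ^+ 2 * 3 ^+ n.*2 * (C * M%:R ^+ 3) / eta ^+ 2) (q / 8 * 3)) => //.
  - by rewrite mulr_gt0.
  - apply: divr_ge0; [apply: mulr_ge0; last exact: ltW|exact: sqr_ge0].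
    by do !apply: mulr_ge0 => //; exact: exprn_ge0.
  near=> N.
  have [N0 w0 sx xw tm1] : [/\ (0 < N)%N, (0 < w N)%N, s <= cutoff N, cutoff N <= s * sqrtw N &
      `|trunc_moment rho (cutoff N) 1| <= s * sqrtw N * (w N)%:R^-1 ].
    by near: N; exact: parameters_near.
  have x0 : 0 < cutoff N by exact: lt_le_trans sx.
  have Nr0 : 0 < N%:R :> R by rewrite ltr0n.
  have g1 : 1 <= gam N by near: N; exact: gam_large.
  have g0 : 0 < gam N by exact: lt_le_trans g1.
  case: hX => hs hi hl _ _ _.
  have [mA PA] := deviant_trace_le moments variance (hi N) (hl N) (@esym N) w0 (@edeg N)
     s0 vs sx xw tm1 N0 eta0 g1 (ltnSn _ : (k.+1.*2.*2 < M)%N).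
  split=> //; apply: le_trans PA _; rewrite lee_fin -/n.
  have /andP[G0 G3] : 0 <= growth (w N)%:R^-1 (cutoff N / (s * sqrtw N)) (gam N) M <= 3.
    by near: N; exact: growth3.
  apply: (@le_trans _ _ (2 * n%:R * M%:R ^+ 2 * 3 ^+ n.*2 / (gam N * eta ^+ 2 * N%:R))).
    apply: ler_wpM2r; first by rewrite invr_ge0 ltW // mulr_gt0 // mulr_gt0 // exprn_gt0.
    apply: ler_wpM2l; first by rewrite !mulr_ge0.
    by apply: lerXn2r; rewrite ?nnegrE.
  rewrite powRN -cutoffX /gam.
  rewrite le_eqVlt; apply/orP; left; apply/eqP.
  move: (2 * _ * _ * _) (C * _) CM0 (cutoff N ^+ 3) (exprn_gt0 3 x0) (eta ^+ 2)
    (exprn_gt0 2 eta0) (N%:R) Nr0 => A1 A2 A20 A3 A30 A4 A40 A5 A50.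
  by field; rewrite !lt0r_neq0.
pose r1 := 4 * v' / s ^+ 2.
have r1n : 4 * B * (n.+1 * k.+2)%:R <= r1 ^+ k.+1.
  have -> : r1 ^+ k.+1 = (4 * v' / c1 ^+ 2) ^+ k.+1 * B.
    rewrite /B /n -mul2n exprM -exprMn /r1; congr (_ ^+ _).
    by field; rewrite !lt0r_neq0.
  by rewrite mulrAC ler_wpM2r // ltW.
have := overflow_ae; move: dev; apply: filterS2 => t td to.
near=> N.
have [N0 w0 sx xw tm1] : [/\ (0 < N)%N, (0 < w N)%N, s <= cutoff N, cutoff N <= s * sqrtw N &
    `|trunc_moment rho (cutoff N) 1| <= s * sqrtw N * (w N)%:R^-1 ].
  by near: N; exact: parameters_near.
have x0 : 0 < cutoff N by exact: lt_le_trans sx.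
have Nr0 : 0 < N%:R :> R by rewrite ltr0n.
have wr0 : 0 < (w N)%:R :> R by rewrite ltr0n.
have sw0 : 0 < sqrtw N by rewrite sqrtr_gt0.
have g1 : 1 <= gam N by near: N; exact: gam_large.
have g0 : 0 < gam N by exact: lt_le_trans g1.
have nd : ~ Dv t N by near: N; exact: td.
have no : ~ overflow (X N) (cutoff N) t by near: N; exact: to.
case: hX => hs hi hl _ _ _.
rewrite ler_pdivlMr //.
apply: (opnorm_full_ge (hs N) (@esym N) w0 s0 N0 (ltW c1gt) eta0 _ no nd).
have [good [gdeg gstep gcard]] : exists good : nat -> pred 'I_N,
   [/\ forall j u, good j.+1 u -> (1 - eps) * (w N)%:R <= #|[pred y | e N u y]|%:R,
       forall j u y, good j.+1 u -> e N u y -> good j y &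
       (1 - eps) * N%:R <= #|good n|%:R].
  by near: N; apply: wide => //; apply: le_lt_trans eps4 _; rewrite ltr_pdivrMr // mul1r ltr1n.
(* The successor makes theta at least (1 - 2 * eps) * w; the surplus of at most one is absorbed by eps * w. *)
pose theta := (Num.truncn ((1 - 2 * eps) * (w N)%:R)).+1.
have eps2 : 0 < 1 - 2 * eps by lra.
have th1 : (1 - 2 * eps) * (w N)%:R <= theta%:R by rewrite ltW // truncnS_gt.
have th2 : theta%:R <= (1 - 2 * eps) * (w N)%:R + 1.
  rewrite /theta -natr1 lerD2r truncn_le // mulr_ge0 ?ler0n // ltW //.
have wM : (1 + M%:R) / eps <= (w N)%:R by near: N; exact: w_large.
have gdeg' j u : good j.+1 u -> (theta + M <= #|[pred y | e N u y]|)%N.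
  move=> /gdeg h; rewrite -(ler_nat R) natrD; apply: le_trans h.
  by move: wM; rewrite ler_pdivrMr // => wM; lra.
have knM : (k.+1.*2 < M)%N by rewrite ltnS /n -[X in (_ <= X)%N]addnn leq_addr.
apply: le_trans (mean_trace_ge moments variance (hi N) (hl N) (@esym N) w0 (@edeg N)
     s0 vs sx tm1 g1 knM gdeg' gstep).
rewrite -/n.
set G := growth _ _ _ _.
have /andP[G0 G3] : 0 <= G <= 3 by rewrite /G; near: N; exact: growth3.
set m2 := scaled_trunc_moment _ _ _ _.
have m2v : (v - eps) / (s ^+ 2 * (w N)%:R) <= m2.
  rewrite /m2 /scaled_trunc_moment exprMn sqr_sqrtr ?(ltW wr0) //.
  apply: ler_wpM2r; last by near: N; exact: variance_near.
  by rewrite invr_ge0 ltW // mulr_gt0 // exprn_gt0.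
have veps : 0 <= v - eps.
  by rewrite -(pmulr_rge0 _ eps2) (le_trans (ltW v'0)).
have m20 : 0 <= m2.
  by apply: le_trans m2v; rewrite divr_ge0 // mulr_ge0 ?sqr_ge0 ?(ltW wr0).
have main : 4 * B <= (dyck theta n 0)%:R * m2 ^+ k.+1.
  have dg := dyck_ge theta k.+1; rewrite -/n in dg.
  have nk0 : 0 < (n.+1 * k.+2)%:R :> R by rewrite ltr0n.
  rewrite -(ler_pM2r nk0); apply: le_trans r1n _.
  have dgR : ((4 * theta%:R) ^+ k.+1 : R) <= (dyck theta n 0)%:R * (n.+1 * k.+2)%:R.
    by rewrite -natrM -natrM -natrX ler_nat.
  rewrite mulrAC; apply: le_trans (ler_wpM2r (exprn_ge0 _ m20) dgR).
  have sw2 : 0 < s ^+ 2 * (w N)%:R by rewrite mulr_gt0 // exprn_gt0.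
  have vs0 : 0 <= (v - eps) / (s ^+ 2 * (w N)%:R) by rewrite divr_ge0 // ltW.
  rewrite -exprMn; apply: lerXn2r; rewrite ?nnegrE.
  - by rewrite /r1 divr_ge0 ?sqr_ge0 // mulr_ge0 // ltW.
  - by rewrite mulr_ge0 // mulr_ge0.
  apply: (@le_trans _ _ (4 * theta%:R * ((v - eps) / (s ^+ 2 * (w N)%:R)))); last first.
    by apply: ler_wpM2l => //; rewrite mulr_ge0.
  apply: (@le_trans _ _ (4 * ((1 - 2 * eps) * (w N)%:R) * ((v - eps) / (s ^+ 2 * (w N)%:R)))); last first.
    by apply: ler_wpM2r => //; apply: ler_wpM2l.
  have -> : 4 * ((1 - 2 * eps) * (w N)%:R) * ((v - eps) / (s ^+ 2 * (w N)%:R)) =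
     4 * ((1 - 2 * eps) * (v - eps)) / s ^+ 2.
    have alg (A y ss z : R) : 0 < y -> 0 < ss ->
        4 * (A * y) * (z / (ss ^+ 2 * y)) = 4 * (A * z) / ss ^+ 2.
      by move=> y0 ss0; field; rewrite !lt0r_neq0.
    exact: alg.
  by rewrite ler_wpM2r ?invr_ge0 ?sqr_ge0 // ler_wpM2l.
have err : N%:R * G ^+ n / gam N <= N%:R * eta.
  rewrite -mulrA ler_wpM2l // ler_pdivrMr // mulrC -ler_pdivrMr //.
  apply: (@le_trans _ _ (3 ^+ n / eta)).
    by rewrite ler_wpM2r ?invr_ge0 ?(ltW eta0) // lerXn2r ?nnegrE.
  by near: N; exact: gam_large.
have half : N%:R / 2 <= #|good n|%:R :> R.
  by apply: le_trans gcard; rewrite mulrC ler_wpM2r //; lra.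
rewrite -mulrA -/B.
have N20 : 0 <= N%:R / 2 :> R by rewrite divr_ge0.
have B40 : 0 <= 4 * B by rewrite mulr_ge0 // ltW.
have -> : N%:R * (B + eta) = N%:R / 2 * (4 * B) - N%:R * eta by rewrite /eta; field.
by apply: lerB err; exact: ler_pM.
Unshelve. all: by end_near. Qed.

End Asymptotics.

(** * Degrees in band graphs *)

Lemma card_le_inj N (A : pred 'I_N) (f : 'I_N -> nat) n :
  (forall j, A j -> (f j < n)%N) -> {in A &, injective f} -> (#|A| <= n)%N.
Proof.
move=> fn finj; rewrite cardE -(size_map f) -(size_iota 0 n).
apply: uniq_leq_size => [|_ /mapP[j jA ->]].
  rewrite map_inj_in_uniq ?enum_uniq // => i j; rewrite !mem_enum; exact: finj.
by rewrite mem_iota /= add0n fn //; move: jA; rewrite mem_enum.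
Qed.

Lemma card_ge_inj N (A : pred 'I_N) (f : nat -> nat) n :
  (forall k, (k < n)%N -> exists2 j : 'I_N, A j & val j = f k) ->
  {in gtn n &, injective f} -> (n <= #|A|)%N.
Proof.
move=> fA finj; rewrite cardE -(size_map val) -{1}(size_iota 0 n) -(size_map f).
apply: uniq_leq_size => [|_ /mapP[k + ->]].
  rewrite map_inj_in_uniq ?iota_uniq // => i j; rewrite !mem_iota /= !add0n; exact: finj.
rewrite mem_iota /= add0n => /fA [j Aj <-].
by apply: map_f; rewrite mem_enum.
Qed.

Section Bands.
Variables (N b : nat).
Implicit Types u y : 'I_N.

Definition strict_rel : rel 'I_N := fun i j => (`|i - j| <= b)%N.
Definition periodic_rel : rel 'I_N := fun i j => (circ_abs N `|i - j| <= b)%N.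

Lemma strict_rel_sym : symmetric strict_rel.
Proof. by move=> i j; rewrite /strict_rel; congr (_ <= _)%N; lia. Qed.

Lemma periodic_rel_sym : symmetric periodic_rel.
Proof. by move=> i j; rewrite /periodic_rel; congr (circ_abs _ _ <= _)%N; lia. Qed.

Lemma strict_degree_le u : (#|[pred y | strict_rel u y]| <= minn N (2 * b + 1))%N.
Proof.
rewrite leq_min; apply/andP; split; first by rewrite -[leqRHS]card_ord max_card.
apply: (@card_le_inj _ _ (fun j => j + b - u)%N) => [j|i j]; rewrite /= ?inE /strict_rel; first lia.
by move=> hi hj h; apply: val_inj => /=; lia.
Qed.

Lemma strict_degree_interior u : (b <= u)%N -> (u + b < N)%N ->
  (2 * b + 1 <= #|[pred y | strict_rel u y]|)%N.
Proof.
move=> bu ub; apply: (@card_ge_inj _ _ (fun k => k + u - b)%N) => [k kb|i j]; last first.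
  rewrite !inE; lia.
have kN : (k + u - b < N)%N by lia.
by exists (Ordinal kN) => //=; rewrite /strict_rel /=; lia.
Qed.

Lemma strict_degree_ge u : (b < N)%N -> (b + 1 <= #|[pred y | strict_rel u y]|)%N.
Proof.
move=> bN; have uN := ltn_ord u.
apply: (@card_ge_inj _ _ (fun k => k + (u - b))%N) => [k kb|i j]; last first.
  rewrite !inE; lia.
have kN : (k + (u - b) < N)%N by lia.
by exists (Ordinal kN) => //=; rewrite /strict_rel /=; lia.
Qed.

Lemma periodic_degree_le u : (#|[pred y | periodic_rel u y]| <= minn N (2 * b + 1))%N.
Proof.
rewrite leq_min; apply/andP; split; first by rewrite -[leqRHS]card_ord max_card.
(* The rotation that moves u to the position b of the cycle. *)
pose f (j : 'I_N) := (if j + b < u then j + b + N - u else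
   if j + b - u < N then j + b - u else j + b - u - N)%N.
have uN := ltn_ord u.
have [Nb|bN] := leqP N (2 * b + 1).
  by apply: leq_trans Nb; rewrite -[leqRHS]card_ord max_card.
apply: (@card_le_inj _ _ f) => [j|i j]; rewrite /= ?inE /periodic_rel /circ_abs /f.
  by have jN := ltn_ord j; case: ifP => ?; [|case: ifP => ?]; lia.
have iN := ltn_ord i; have jN := ltn_ord j.
move=> hi hj h; apply: val_inj => /=; move: h.
by case: ifP => ?; [|case: ifP => ?]; (case: ifP => ?; [|case: ifP => ?]); lia.
Qed.

Lemma periodic_degree_ge u : (minn N (2 * b + 1) <= #|[pred y | periodic_rel u y]|)%N.
Proof.
have uN := ltn_ord u.
have [Nb|bN] := leqP N (2 * b + 1).
  rewrite (eq_card (B := predT)) ?card_ord // => j.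
  rewrite !inE /periodic_rel /circ_abs; have jN := ltn_ord j; lia.
(* The rotation that moves the position b of the cycle to u. *)
pose f k := (if k + u < b then k + u + N - b else
   if k + u - b < N then k + u - b else k + u - b - N)%N.
apply: (@card_ge_inj _ _ f) => [k kb|i j]; last first.
  rewrite !inE /f => hi hj.
  by case: ifP => ?; [|case: ifP => ?]; (case: ifP => ?; [|case: ifP => ?]); lia.
have kN : (f k < N)%N by rewrite /f; case: ifP => ?; [|case: ifP => ?]; lia.
exists (Ordinal kN) => //=; rewrite /periodic_rel /circ_abs /=.
by move: kN; rewrite /f; case: ifP => ?; [|case: ifP => ?]; lia.
Qed.

Lemma card_interior k : (N - 2 * (k * b) <= #|[pred u : 'I_N | (k * b <= u) && (u + k * b < N)]|)%N.
Proof.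
apply: (@card_ge_inj _ _ (fun j => j + k * b)%N) => [j jN|i j]; last first.
  rewrite !inE; lia.
have kN : (j + k * b < N)%N by lia.
by exists (Ordinal kN) => //=; lia.
Qed.

End Bands.

(** * Measurability and conclusion *)

Section MeasurableNorm.
Variables (d : measure_display) (T : measurableType d) (R : realType) (N : nat).
Variable W : T -> 'M[R]_N.
Hypothesis mW : forall i j, measurable_fun [set: T] (fun t => W t i j).

Lemma measurable_fsum I (s : seq I) (F : I -> T -> R) :
  (forall i, measurable_fun [set: T] (F i)) ->
  measurable_fun [set: T] (fun t => \sum_(i <- s) F i t).
Proof.
move=> mF; elim: s => [|i s IH].
  by under eq_fun do rewrite big_nil; exact: measurable_cst.
by under eq_fun do rewrite big_cons; exact: measurable_funD.
Qed.

Lemma measurable_trace_pow n : measurable_fun [set: T] (fun t => \tr (W t ^+ n)).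
Proof.
suff mp m i j : measurable_fun [set: T] (fun t => (W t ^+ m) i j).
  by apply: measurable_fsum => i; exact: mp.
elim: m i j => [|m IH] i j.
  by under eq_fun do rewrite expr0; exact: measurable_cst.
under eq_fun do rewrite exprS mxE.
by apply: measurable_fsum => k; exact: measurable_funM.
Qed.

Lemma measurable_opnorm : (forall t, (W t)^T = W t) ->
  measurable_fun [set: T] (fun t => opnorm (W t)).
Proof.
move=> sW; apply: (measurability _ (RGenOInfty.measurableE R)) => //.
move=> /= _ [_ [a ->] <-]; rewrite preimage_itvoy setTI.
rewrite (_ : [set x | _] = ~` [set t | opnorm (W t) <= a]); last first.
  by apply/seteqP; split => t /=; rewrite ltNge => /negP.
apply: measurableC; have [a0|a0] := leP 0 a; last first.
  rewrite (_ : [set t | _] = set0) //; apply/seteqP; split => t //= h.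
  by have := le_lt_trans (le_trans (opnorm_ge0 (W t)) h) a0; rewrite ltxx.
rewrite (_ : [set t | _] =
   \bigcap_k [set t | \tr (W t ^+ (2 * k.+1)) <= N%:R * a ^+ (2 * k.+1)]).
  apply: bigcapT_measurable => k; apply: measurable_set_le; last exact: measurable_cst.
  exact: measurable_trace_pow.
apply/seteqP; split => t /=.
  by move=> /(opnorm_leP (sW t) a0) h k _; exact: h.
by move=> h; apply/(opnorm_leP (sW t) a0) => k; exact: h.
Qed.

End MeasurableNorm.

(** On a set that is not measurable the value of P carries no information, whence
    the first hypothesis. *)
Lemma probability_ae d (T : measurableType d) (R : realType) (P : probability T R)
    (Q : T -> Prop) : measurable [set t | Q t] -> {ae P, forall t, Q t} ->
  P [set t | Q t] = 1%E.
Proof.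
move=> mQ [B [mB PB QB]].
have P0 : P (~` [set t | Q t]) = 0%E.
  apply/eqP; rewrite eq_le measure_ge0 andbT -PB.
  by apply: le_measure; rewrite ?inE //; exact: measurableC.
by rewrite -[X in P X]setCK probability_setC ?P0 ?sube0 //; exact: measurableC.
Qed.

Section Limits.
Variables (d : measure_display) (T : measurableType d) (R : realType) (P : probability T R).
Variables (S : nat -> T -> R) (l : R).
Hypothesis mS : forall N, measurable_fun [set: T] (S N).

Lemma ae_harmonic (Q : R -> T -> nat -> Prop) :
  (forall eps, 0 < eps -> {ae P, forall t, \forall N \near \oo, Q eps t N}) ->
  {ae P, forall t, forall n, \forall N \near \oo, Q n.+1%:R^-1 t N}.
Proof. by move=> H; apply: ae_foralln => n; apply: H; rewrite invr_gt0 ltr0n. Qed.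

Hypothesis upper : forall eps, 0 < eps ->
  {ae P, forall t, \forall N \near \oo, S N t <= l + eps}.

Lemma probability_limsup_le :
  P [set t | (limn_esup (fun N => (S N t)%:E) <= l%:E)%E] = 1%E.
Proof.
apply: probability_ae.
  have mL : measurable_fun [set: T] (fun t => limn_esup (fun N => (S N t)%:E)).
    by apply: (measurable_fun_limn_esup (f := fun N t => (S N t)%:E)) => N; exact/measurable_EFinP.
  by rewrite -[X in measurable X]setTI; exact: emeasurable_fun_infty_c.
have := ae_harmonic upper; apply: filterS => t H.
apply/lee_addgt0Pr => e e0.
have [n hn] : exists n, n.+1%:R^-1 <= e.
  exists (Num.truncn e^-1); rewrite -[leRHS]invrK lef_pV2 ?posrE ?invr_gt0 ?ltr0n //.
  by rewrite ltW // truncnS_gt.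
have [m _ hm] := H n.
apply: (@le_trans _ _ (ereal_sup ((fun N => (S N t)%:E) @` [set N | (m <= N)%N]))).
  by apply: ereal_inf_lbound; exists [set N | (m <= N)%N] => //=; exists m.
apply: ge_ereal_sup => _ [N /= mN <-].
by rewrite -EFinD lee_fin; apply: le_trans (hm N mN) _; rewrite lerD2l.
Qed.

Hypothesis lower : forall eps, 0 < eps ->
  {ae P, forall t, \forall N \near \oo, l - eps <= S N t}.

(** The set of convergence is written with countably many operations, one for each
    tolerance 1 / (n + 1). *)
Lemma probability_cvg : P [set t | S N t @[N --> \oo] --> l] = 1%E.
Proof.
pose Q n t m := forall N, (m <= N)%N -> `|S N t - l| <= n.+1%:R^-1.
have QE t : S N t @[N --> \oo] --> l <-> forall n, exists m, Q n t m.
  split => [/cvgrPdist_le H n|H].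
    have [|m _ hm] := H n.+1%:R^-1; first by rewrite invr_gt0 ltr0n.
    by exists m => N mN; rewrite distrC; exact: hm.
  apply/cvgrPdist_le => e e0; have [m hm] := H (Num.truncn e^-1).
  exists m => // N /= mN; rewrite distrC; apply: le_trans (hm N mN) _.
  rewrite -[leRHS]invrK lef_pV2 ?posrE ?invr_gt0 ?ltr0n //.
  by rewrite ltW // truncnS_gt.
apply: probability_ae.
  rewrite (_ : [set t | _] = \bigcap_n \bigcup_m \bigcap_(N in [set N | (m <= N)%N])
     [set t | `|S N t - l| <= n.+1%:R^-1]).
    apply: bigcapT_measurable => n; apply: bigcupT_measurable => m.
    apply: bigcap_measurable => [|N _]; first by exists m => /=.
    apply: measurable_set_le; last exact: measurable_cst.
    by apply: measurableT_comp => //; apply: measurable_funB => //; exact: measurable_cst.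
  apply/seteqP; split => t /=.
    by move=> /QE h n _; have [m hm] := h n; exists m.
  by move=> h; apply/QE => n; have [m _ hm] := h n I; exists m.
have := ae_harmonic lower; have := ae_harmonic upper; apply: filterS2 => t Hu Hl.
apply/QE => n; have [m1 _ h1] := Hu n; have [m2 _ h2] := Hl n.
exists (maxn m1 m2) => N mN; rewrite ler_distl.
by rewrite h1 ?h2 //=; move: mN; rewrite geq_max => /andP[].
Qed.

End Limits.

Section ScaledNorm.
Variables (R : realType) (d : measure_display) (T : measurableType d).
Variables (P : probability T R) (X : forall N : nat, 'I_N -> 'I_N -> {RV P >-> R}).
Arguments X : clear implicits.
Variables (rho : probability R R) (v : R).
Hypothesis hX : wigner_ensemble X rho 0 v.
Variables (e : forall N : nat, rel 'I_N) (w : nat -> nat).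
Arguments e : clear implicits.
Hypothesis esym : forall N, symmetric (e N).

Lemma measurable_scaled N :
  measurable_fun [set: T] (fun t => opnorm (full_mx (X N) (e N) t) / Num.sqrt (w N)%:R).
Proof.
apply: measurable_funM; last exact: measurable_cst.
apply: measurable_opnorm => [i j|t].
  under eq_fun do rewrite mxE; case: (e N i j); last exact: measurable_cst.
  exact: measurable_funPT.
by apply: full_mx_sym; [case: hX|exact: esym].
Qed.

End ScaledNorm.

Lemma cvg0_near (R : realType) (b : nat -> nat) (k : nat) (eps : R) : 0 < eps ->
  (b N)%:R / N%:R @[N --> \oo] --> (0 : R) ->
  \forall N \near \oo, (2 * (k * b N))%:R <= eps * N%:R.
Proof.
move=> eps0 /cvgrPdist_le hb; near=> N.
have N0 : (0 < N)%N by near: N; exact: nbhs_infty_gt.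
have k0 : 0 < (2 * k).+1%:R :> R by rewrite ltr0n.
have : `|0 - (b N)%:R / N%:R| <= eps / (2 * k).+1%:R.
  by near: N; apply: hb; rewrite divr_gt0.
rewrite sub0r normrN ger0_norm ?divr_ge0 // ler_pdivrMr ?ltr0n //.
rewrite mulrAC ler_pdivlMr // => h; apply: le_trans h.
by rewrite -natrM ler_nat mulnA [leqRHS]mulnC leq_mul2r leqnSn orbT.
Unshelve. all: by end_near. Qed.

Lemma cvg1_near (R : realType) (b : nat -> nat) (eps : R) : 0 < eps ->
  (b N)%:R / N%:R @[N --> \oo] --> (1 : R) ->
  \forall N \near \oo, (1 - eps) * N%:R <= (b N)%:R.
Proof.
move=> eps0 /cvgrPdist_le /(_ _ eps0) hb; near=> N.
have N0 : (0 < N)%N by near: N; exact: nbhs_infty_gt.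
have : `|1 - (b N)%:R / N%:R| <= eps by near: N; exact: hb.
rewrite ler_norml => /andP[_ h].
by rewrite -ler_pdivlMr ?ltr0n // lerBlDl -lerBlDr.
Unshelve. all: by end_near. Qed.

Theorem theorem28 (R : realType) (d : measure_display) (T : measurableType d)
    (P : probability T R)
    (X : forall N : nat, 'I_N -> 'I_N -> {RV P >-> R})
    (rho : probability R R) (v : R)
    (hX : wigner_ensemble X rho 0 v)
    (b : nat -> nat)
    (hb : forall N : nat, (0 < N)%N -> (b N <= N - 1)%N)
    (hw : exists c q : R, 0 < c /\ 0 < q /\
       forall N : nat, (0 < N)%N -> c * N%:R `^ q <= (bandwidth b N)%:R) :
  (P [set t | (limn_esup (fun N => (scaled_opnorm b (strict_band b X) t N)%:E)
                 <= (2 * Num.sqrt v)%:E)%E] = 1%E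
   /\
   P [set t | (limn_esup (fun N => (scaled_opnorm b (periodic_band b X) t N)%:E)
                 <= (2 * Num.sqrt v)%:E)%E] = 1%E)
  /\
  P [set t | scaled_opnorm b (periodic_band b X) t N @[N --> \oo]
               --> 2 * Num.sqrt v] = 1%E
  /\
  (((b N)%:R / N%:R @[N --> \oo] --> (0 : R)) \/
   ((b N)%:R / N%:R @[N --> \oo] --> (1 : R)) ->
   P [set t | scaled_opnorm b (strict_band b X) t N @[N --> \oo]
                --> 2 * Num.sqrt v] = 1%E).
Proof.
have [c [q [c0 [q0 hcq]]]] := hw.
pose es N : rel 'I_N := @strict_rel N (b N).
pose ep N : rel 'I_N := @periodic_rel N (b N).
have ess N : symmetric (es N) by exact: strict_rel_sym.
have eps N : symmetric (ep N) by exact: periodic_rel_sym.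
have wN N : (bandwidth b N <= N)%N by exact: geq_minl.
have ms := measurable_scaled hX (bandwidth b) ess.
have mp := measurable_scaled hX (bandwidth b) eps.
have us := upper_ae hX c0 q0 hcq wN ess (fun N => @strict_degree_le N (b N)).
have up := upper_ae hX c0 q0 hcq wN eps (fun N => @periodic_degree_le N (b N)).
have lows := lower_ae hX c0 q0 hcq wN ess (fun N => @strict_degree_le N (b N)).
have lowp := lower_ae hX c0 q0 hcq wN eps (fun N => @periodic_degree_le N (b N)).
split; first split.
- exact: (probability_limsup_le ms us).
- exact: (probability_limsup_le mp up).
split.
  apply: (probability_cvg mp up) => eps0 eps00; apply: lowp => //.
  move=> k r r0 r1; apply: nearW => N; exists (fun _ => predT); split => //.
    move=> j u _; apply: (@le_trans _ _ (bandwidth b N)%:R).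
      by rewrite ler_piMl // gerBl ltW.
    by rewrite ler_nat; exact: periodic_degree_ge.
  by rewrite card_ord ler_piMl // gerBl ltW.
move=> blim; apply: (probability_cvg ms us) => eps0 eps00; apply: lows => //.
move=> k r r0 r1; case: blim => [b0|b1].
  near=> N.
  have N0 : (0 < N)%N by near: N; exact: nbhs_infty_gt.
  have kb : (2 * (k * b N))%:R <= r * N%:R :> R by near: N; exact: cvg0_near.
  exists (fun j u => (j * b N <= u)%N && (u + j * b N < N)%N); split.
  - move=> j u /andP[ju uj]; apply: (@le_trans _ _ (bandwidth b N)%:R).
      by rewrite ler_piMl // gerBl ltW.
    rewrite ler_nat; apply: leq_trans (geq_minr _ _) _.
    apply: strict_degree_interior; first by apply: leq_trans ju; rewrite leq_pmull.
    by apply: leq_ltn_trans uj; rewrite leq_add2l leq_pmull.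
  - move=> j u y /andP[ju uj]; rewrite /es /strict_rel => uy.
    by move: ju uj uy; rewrite mulSn; move: (j * b N)%N => jb ju uj uy; apply/andP; split; lia.
  - apply: (@le_trans _ _ (N - 2 * (k * b N))%:R).
      rewrite mulrBl mul1r lerBlDr; apply: le_trans (_ : (N - 2 * (k * b N) + 2 * (k * b N))%:R <= _).
        by rewrite ler_nat addnC -leq_subLR.
      by rewrite natrD lerD2l.
    by rewrite ler_nat; exact: card_interior.
near=> N.
have N0 : (0 < N)%N by near: N; exact: nbhs_infty_gt.
have bN : (1 - r) * N%:R <= (b N)%:R by near: N; exact: cvg1_near.
exists (fun _ => predT); split => //.
  move=> j u _; apply: (@le_trans _ _ ((1 - r) * N%:R)).
    by rewrite ler_wpM2l ?ler_nat // subr_ge0 ltW.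
  apply: le_trans bN _; rewrite ler_nat.
  have bN : (b N < N)%N by have := hb N N0; lia.
  by apply: leq_trans (strict_degree_ge u bN); rewrite leq_addr.
by rewrite card_ord ler_piMl // gerBl ltW.
Unshelve. all: by end_near. Qed.
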